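(* Let $K$ be an algebraically closed field of arbitrary characteristic and let $n\geq 2$. Identify the $K$-endomorphisms of degree $\leq n$ of the free associative algebra $K\langle x,y\rangle$ with points of $K^p$, $p=2(1+2+2^2+\cdots+2^n)=2^{n+2}-2$, via their coefficients. Then the set of $K$-automorphisms of degree $n$ of $K\langle x,y\rangle$ is a constructible subset of $K^p$ of dimension $n+6$.
   Context: $K\langle x,y\rangle$ is the free unital associative $K$-algebra on $x,y$. A $K$-endomorphism $\varphi$ of it is written $\varphi=(f,g)$ with $f=\varphi(x)$, $g=\varphi(y)$. Its degree is $\deg(\varphi)=\max\{\deg(f),\deg(g)\}$, where $\deg$ is the total degree in $x,y$. The space of homogeneous polynomials of degree $m$ in $K\langle x,y\rangle$ has dimension $2^m$. An endomorphism $(f,g)$ of degree $\leq n$ is identified with the point of $K^p$ whose coordinates are the coefficients of $f$ and of $g$ at all noncommutative monomials of degree $\leq n$. $K^p$ carries the Zariski topology. A subset is constructible if it is a finite union of intersections of an open set and a closed set, and its dimension is the dimension of its Zariski closure. *)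

(* Defs.v *)
From HB Require Import structures.
From mathcomp Require Import all_boot all_order all_algebra.
From mathcomp Require Import boolp classical_sets topology.
From mathcomp.multinomials Require Import mpoly.
From mathcomp.multinomials Require monalg.

Set Implicit Arguments.
Unset Strict Implicit.
Unset Printing Implicit Defensive.

Import GRing.Theory.

Local Open Scope ring_scope.
Local Open Scope classical_set_scope.

(* An alias of 'rV[K]_p, so that the Zariski topology does not compete with
   the entrywise topology that the library puts on matrices. *)
Definition affine_space (K : fieldType) (p : nat) : Type := 'rV[K]_p.

Section Zariski.
Variables (K : fieldType) (p : nat).

HB.instance Definition _ := Choice.on (affine_space K p).

Definition zero_locus (S : set {mpoly K[p]}) : set (affine_space K p) :=
  [set v : 'rV[K]_p | forall q : {mpoly K[p]}, S q -> q.@[v 0] = 0].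

Definition zariski_open : set_system (affine_space K p) :=
  [set U | exists S, U = ~` zero_locus S].

Lemma zariski_openT : zariski_open setT.
Proof.
exists [set 1]; apply/seteqP; split=> v //= _ /(_ 1 erefl) /eqP.
by rewrite meval1 oner_eq0.
Qed.

Lemma zariski_openI : setI_closed zariski_open.
Proof.
move=> _ _ [S ->] [T ->].
exists [set q | exists f g, [/\ S f, T g & q = f * g]].
rewrite -setCU; congr (~` _); apply/seteqP; split=> v /=.
  case=> [Sv|Tv] _ [f [g [Sf Tg ->]]]; rewrite mevalM.
    by rewrite (Sv f) // mul0r.
  by rewrite (Tv g) // mulr0.
move=> STv; have [Sv|nSv] := pselect (zero_locus S v); [by left|right].
move=> g Tg; apply: contrapT => gv; apply: nSv => f Sf.
have /eqP := STv _ (ex_intro _ f (ex_intro _ g (And3 Sf Tg erefl))).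
by rewrite mevalM mulf_eq0 => /orP[/eqP|/eqP /gv].
Qed.

Lemma zariski_open_bigU (I : Type) (f : I -> set (affine_space K p)) :
  (forall i, zariski_open (f i)) -> zariski_open (\bigcup_i f i).
Proof.
move=> fop; exists [set q | exists2 S, S q & exists i, f i = ~` zero_locus S].
apply/seteqP; split=> v /=.
  move=> [i _ fiv] Z; have [S fi] := fop i.
  by move: fiv; rewrite fi; apply=> q Sq; apply: Z; exists S => //; exists i.
apply: contra_notP => nfv q [S Sq [i fi]]; apply: contrapT => qv; apply: nfv.
by exists i => //; rewrite fi => /(_ _ Sq).
Qed.

HB.instance Definition _ := isOpenTopological.Build (affine_space K p)
  zariski_openT zariski_openI zariski_open_bigU.

Lemma zariski_closedP (Z : set (affine_space K p)) :
  closed Z <-> exists S, Z = zero_locus S.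
Proof.
rewrite -openC; split=> -[S ZS]; exists S.
  by rewrite -[LHS]setCK ZS setCK.
by rewrite ZS.
Qed.

End Zariski.

Section Dimension.
Variable T : topologicalType.
Implicit Types A X Z : set T.

Definition constructible A :=
  exists (m : nat) (U C : 'I_m -> set T),
    [/\ forall i, open (U i), forall i, closed (C i)
      & A = \bigcup_i (U i `&` C i)].

Definition irreducible Z :=
  Z !=set0 /\
  forall A B, closed A -> closed B -> Z `<=` A `|` B -> Z `<=` A \/ Z `<=` B.

(* Only the terms F 0, ..., F d of the sequence matter. *)
Definition irreducible_chain X (d : nat) (F : nat -> set T) :=
  (forall i, (i <= d)%N -> [/\ closed (F i), irreducible (F i) & F i `<=` X]) /\
  (forall i, (i < d)%N -> F i `<` F i.+1).

(* The Krull dimension of a closed set X is d. *)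
Definition closed_has_dim X (d : nat) :=
  (exists F, irreducible_chain X d F) /\
  (forall e F, irreducible_chain X e F -> (e <= d)%N).

Definition has_dim A (d : nat) := closed_has_dim (closure A) d.

End Dimension.

(* Imported only here because its polynomial notations shadow those of mpoly. *)
Import monalg.

(* K<x,y>: the monoid algebra over K of the free monoid on two letters; the
   letter 0 is x and the letter 1 is y. *)
Notation free_alg2 K := {malg K[{fmonom 'I_2}]}.

Section FreeAlgebra.
Variable K : fieldType.

Definition letter (a : 'I_2) : free_alg2 K := << fmu a >>.

(* mmeasure is one more than the degree, and 0 at the zero polynomial, whose
   degree is thus set to 0. *)
Definition deg (f : free_alg2 K) : nat := (mmeasure (@fdeg 'I_2) f).-1.

Definition endo_deg (phi : {lrmorphism free_alg2 K -> free_alg2 K}) : nat :=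
  maxn (deg (phi (letter 0))) (deg (phi (letter 1))).

End FreeAlgebra.

(* The coordinates: a generator together with a word of length at most n. *)
Notation endo_coord n := ('I_2 * {k : 'I_n.+1 & (k : nat).-tuple 'I_2})%type.

Lemma card_coord n : #|{: endo_coord n}| = (2 ^ n.+2 - 2)%N.
Proof.
rewrite card_prod card_ord card_tagged sumnE big_map big_enum /=.
under eq_bigr do rewrite card_tuple card_ord.
rewrite (expnS _ n.+1) -[X in (_ - X)%N]muln1 -mulnBr; congr (2 * _)%N.
elim: n => [|n IH]; first by rewrite big_ord1.
rewrite big_ord_recr /= IH [in RHS]expnS mul2n -addnn addnC addnBA //.
by rewrite expn_gt0.
Qed.

Section Automorphisms.
Variables (K : fieldType) (n : nat).

Definition coord_of (i : 'I_(2 ^ n.+2 - 2)) : endo_coord n :=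
  enum_val (cast_ord (esym (card_coord n)) i).

Definition endo_point (phi : {lrmorphism free_alg2 K -> free_alg2 K}) :
    affine_space K (2 ^ n.+2 - 2) :=
  \row_i let: (a, w) := coord_of i in
    monalg.mcoeff (FMonom (tagged w)) (phi (letter K a)).

Definition aut_locus : set (affine_space K (2 ^ n.+2 - 2)) :=
  [set v | exists phi : {lrmorphism free_alg2 K -> free_alg2 K},
     [/\ bijective phi, endo_deg phi = n & v = endo_point phi]].

End Automorphisms.

Arguments aut_locus K n : clear implicits.

(* Main.v *)
(** Abelianization sends an automorphism of K<x,y> to one of K[x,y]. The
    coordinates of K[x,y] are first reduced to x: if (P, Q) is an automorphism,
    the flow of translation Q + tau fixes P; degenerating that flow along a
    weight gives a nontrivial flow fixing the leading form of P, hence all of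
    its factors, and a degree count on the factor x_j^a - r x_i^b of a face of
    the Newton polygon forces a = 1 or b = 1, in any characteristic. An
    elementary substitution then lowers the degrees of P.

    Abelianization is moreover injective: in the monoid algebra of the free
    product of N^2 with <N>, with x |-> x and y |-> y + N, suitable leading
    monomials of an automorphism that is trivial on K[x,y] do not commute, so
    they generate a free monoid and no cancellation can occur. Therefore every
    automorphism is tame, and a pair of degree n >= 2 is, up to swapping and
    adding a multiple of one component to the other, a tower
    f_(i+1) = p_i(f_i) + f_(i-1) over an affine pair with prod deg(p_i) = n.
    Normalizing the p_i, the locus is the union, over the finitely many
    factorizations of n, of images of nonvanishing sets of polynomials under
    polynomial maps in at most n + 6 parameters.

    Such a union is constructible by quantifier elimination. A chain of e
    strict inclusions of irreducible closed sets gives e polynomials which are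
    algebraically independent on the top one, hence e <= n + 6. Conversely, one
    family with n + 6 parameters, each of them visible in a coefficient of the
    automorphism, yields a chain of length n + 6 by freeing the parameters one
    at a time. *)

Require Import Defs.
From HB Require Import structures.
From mathcomp Require Import all_boot all_order all_algebra all_field.
From mathcomp Require Import ring lra zify.
From mathcomp Require Import boolp classical_sets topology.
From mathcomp Require Import finmap.
From mathcomp.multinomials Require Import mpoly.
From mathcomp.multinomials Require monalg.

Set Implicit Arguments.
Unset Strict Implicit.
Unset Printing Implicit Defensive.
Import Order.TTheory GRing.Theory Num.Theory.
Local Open Scope ring_scope.

(** * Weights and leading forms *)

(** Origin of n + 6: an affine pair has 6 coefficients; the innermost [p_i], of degree d, adds d - 1
    parameters, its constant and linear terms being absorbed by the affine pair; any other [p_i]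
    adds d, only its constant term being absorbed; one more parameter adds a multiple of one
    component to the other. As d + e <= d e for d, e >= 2, the total is at most n + 6, reached by a
    single factor: 6 + (n - 1) + 1. In positive characteristic a derivation does not determine an
    action of the additive group, so a flow is recorded as a substitution [T], polynomial in tau and
    equal to the identity at tau = 0. Having tau-degree 0 replaces being killed by a derivation. In
    the free algebra itself, leading monomials may be powers of one word, hence commute. After y |->
    y + N, the part without N is known when the automorphism is trivial on K[x,y], and a weight can
    be chosen for which some monomial with N ties with it; distinct monomials of equal nonzero
    weight, not both free of N, never commute. *)

Lemma seq_argmax (I : eqType) (R : realDomainType) (f : I -> R) (s : seq I) :
  s != [::] -> exists2 x, x \in s & forall y, y \in s -> f y <= f x.
Proof.
elim: s => // x [|y s] IH _.
  by exists x; rewrite ?inE // => z; rewrite inE => /eqP->.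
have [//|u us hu] := IH.
have [le|lt] := lerP (f x) (f u).
  exists u; first by rewrite inE us orbT.
  by move=> z; rewrite inE => /orP[/eqP->//|/hu].
exists x; rewrite ?inE ?eqxx // => z; rewrite inE => /orP[/eqP->//|/hu h].
exact: le_trans h (ltW lt).
Qed.

Section Weights.
Variables (K : fieldType) (n : nat).
Implicit Types (p q : {mpoly K[n]}) (m : 'X_{1..n}) (w : 'I_n -> int).

Definition wt w m : int := \sum_i w i *+ m i.

Lemma wtD w m1 m2 : wt w (m1 + m2)%MM = wt w m1 + wt w m2.
Proof.
by rewrite -big_split; apply: eq_bigr => i _; rewrite mnmDE mulrnDr.
Qed.

Lemma wtU w i : wt w U_(i)%MM = w i.
Proof.
rewrite /wt (bigD1 i) //= mnm1E eqxx mulr1n big1 ?addr0 // => j /negPf ji.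
by rewrite mnm1E eq_sym ji.
Qed.

Lemma wt0 w : wt w 0%MM = 0.
Proof. by rewrite /wt big1 // => i _; rewrite mnm0E. Qed.

Definition wle w (k : int) p := forall m, m \in msupp p -> wt w m <= k.

Definition wcmp w (k : int) p : {mpoly K[n]} :=
  \sum_(m <- msupp p | wt w m == k) p@_m *: 'X_[m].

Lemma mcoeff_wcmp w k p m : (wcmp w k p)@_m = if wt w m == k then p@_m else 0.
Proof.
rewrite /wcmp raddf_sum /= (eq_bigr (fun i => p@_i * (i == m)%:R)); last first.
  by move=> i _; rewrite mcoeffZ mcoeffX.
have [mp|mp] := boolP (m \in msupp p); last first.
  rewrite (memN_msupp_eq0 mp) if_same big_seq_cond big1 // => i /andP[ip _].
  by case: eqP => [e|_]; [rewrite -e ip in mp|rewrite mulr0].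
case: ifP => wm.
  rewrite big_mkcond (bigD1_seq m) ?msupp_uniq //= wm eqxx mulr1 big1 ?addr0 //.
  by move=> i /negPf im; rewrite im mulr0 if_same.
by rewrite big1 // => i wi; case: eqP => [e|_]; [rewrite -e wi in wm|rewrite mulr0].
Qed.

Lemma wcmpD w k p q : wcmp w k (p + q) = wcmp w k p + wcmp w k q.
Proof.
apply/mpolyP => m; rewrite mcoeffD !mcoeff_wcmp mcoeffD.
by case: ifP => // _; rewrite addr0.
Qed.

Lemma wcmpZ w k c p : wcmp w k (c *: p) = c *: wcmp w k p.
Proof.
by apply/mpolyP => m; rewrite mcoeffZ !mcoeff_wcmp mcoeffZ; case: ifP; rewrite ?mulr0.
Qed.

Lemma wle0 w k : wle w k 0.
Proof. by move=> m; rewrite msupp0. Qed.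

Lemma wleD w k p q : wle w k p -> wle w k q -> wle w k (p + q).
Proof.
move=> hp hq m /msuppD_le; rewrite mem_cat => /orP[/hp|/hq] //.
Qed.

Lemma wleZ w k c p : wle w k p -> wle w k (c *: p).
Proof. by move=> hp m /msuppZ_le/hp. Qed.

Lemma wleM w i j p q : wle w i p -> wle w j q -> wle w (i + j) (p * q).
Proof.
move=> hp hq m /msuppM_le /allpairsP[[m1 m2] /= [h1 h2 ->]].
by rewrite wtD lerD ?hp ?hq.
Qed.

Lemma wleW w i j p : i <= j -> wle w i p -> wle w j p.
Proof. by move=> ij hp m /hp h; apply: le_trans ij. Qed.

Lemma wcmp_lt w i j p : i < j -> wle w i p -> wcmp w j p = 0.
Proof.
move=> ij hp; apply/mpolyP => m; rewrite mcoeff_wcmp mcoeff0; case: eqP => // e.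
by apply: memN_msupp_eq0; apply/negP => /hp; rewrite e leNgt ij.
Qed.

Lemma wcmp_split w k p : wle w k p -> wle w (k - 1) (p - wcmp w k p).
Proof.
move=> hp m; rewrite mcoeff_msupp mcoeffB mcoeff_wcmp.
have [_|ne] := eqVneq (wt w m) k; first by rewrite subrr eqxx.
by rewrite subr0 -mcoeff_msupp => /hp h; lia.
Qed.

Lemma wcmp_le w k p : wle w k (wcmp w k p).
Proof.
by move=> m; rewrite mcoeff_msupp mcoeff_wcmp; have [->|_] := eqVneq (wt w m) k; rewrite ?eqxx.
Qed.

Lemma wcmpM_hom w i j p q :
  wcmp w (i + j) (wcmp w i p * wcmp w j q) = wcmp w i p * wcmp w j q.
Proof.
apply/mpolyP => m; rewrite mcoeff_wcmp; case: eqP => // ne.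
apply/esym/memN_msupp_eq0/negP => /msuppM_le /allpairsP[[m1 m2] /= [h1 h2 e]].
apply: ne; rewrite e wtD; congr (_ + _).
  by move: h1; rewrite mcoeff_msupp mcoeff_wcmp; have [->|_] := eqVneq (wt w m1) i; rewrite ?eqxx.
by move: h2; rewrite mcoeff_msupp mcoeff_wcmp; have [->|_] := eqVneq (wt w m2) j; rewrite ?eqxx.
Qed.

Lemma wcmpM w i j p q : wle w i p -> wle w j q ->
  wcmp w (i + j) (p * q) = wcmp w i p * wcmp w j q.
Proof.
move=> hp hq.
have -> : p * q = wcmp w i p * wcmp w j q
  + ((p - wcmp w i p) * q + wcmp w i p * (q - wcmp w j q)) by ring.
have lt : i + j - 1 < i + j by lia.
rewrite wcmpD wcmpM_hom (wcmp_lt lt) ?addr0 //; apply: wleD; first by rewrite addrAC; apply: wleM hq; apply: wcmp_split.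
by rewrite -addrA; apply: wleM; [apply: wcmp_le|apply: wcmp_split].
Qed.

(** The form [a] may be zero: the weight is bounded by [k], not equal to it. This makes the relation
    stable under sums, where top parts may cancel. *)
Definition wtop w k p a := wle w k p /\ wcmp w k p = a.

Lemma wtopD w k p q a b : wtop w k p a -> wtop w k q b -> wtop w k (p + q) (a + b).
Proof. by move=> [hp <-] [hq <-]; split; [apply: wleD|rewrite wcmpD]. Qed.

Lemma wtop0 w k : wtop w k 0 0.
Proof.
split; first exact: wle0.
by apply/mpolyP => m; rewrite mcoeff_wcmp mcoeff0 if_same.
Qed.

Lemma wtopZ w k c p a : wtop w k p a -> wtop w k (c *: p) (c *: a).
Proof. by move=> [hp <-]; split; [apply: wleZ|rewrite wcmpZ]. Qed.

Lemma wtopM w i j p q a b : wtop w i p a -> wtop w j q b -> wtop w (i + j) (p * q) (a * b).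
Proof. by move=> [hp <-] [hq <-]; split; [apply: wleM|rewrite wcmpM]. Qed.

Lemma wtopX w m : wtop w (wt w m) 'X_[m] 'X_[m].
Proof.
split; first by move=> m'; rewrite msuppX inE => /eqP->.
apply/mpolyP => m'; rewrite mcoeff_wcmp mcoeffX.
by case: (altP (m =P m')) => [->|_]; rewrite ?eqxx ?if_same.
Qed.

Lemma wtopC w c : wtop w 0 c%:MP c%:MP.
Proof.
rewrite -[c%:MP]mulr1 mul_mpolyC; apply: wtopZ.
by rewrite -mpolyX0 -(wt0 w); apply: wtopX.
Qed.

Lemma wtop_exp w i p a k : wtop w i p a -> wtop w (i *+ k) (p ^+ k) (a ^+ k).
Proof.
move=> h; elim: k => [|k IH]; first by rewrite !expr0 mulr0n -mpolyC1; apply: wtopC.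
by rewrite !exprS mulrS; apply: wtopM.
Qed.

Lemma wtop_prod w (I : Type) (r : seq I) (k : I -> int) (F A : I -> {mpoly K[n]}) :
  (forall i, wtop w (k i) (F i) (A i)) ->
  wtop w (\sum_(i <- r) k i) (\prod_(i <- r) F i) (\prod_(i <- r) A i).
Proof.
move=> h; elim: r => [|i r IH]; first by rewrite !big_nil -mpolyC1; apply: wtopC.
by rewrite !big_cons; apply: wtopM.
Qed.

Lemma wtop_sum w k (I : eqType) (r : seq I) (F A : I -> {mpoly K[n]}) :
  (forall i, i \in r -> wtop w k (F i) (A i)) ->
  wtop w k (\sum_(i <- r) F i) (\sum_(i <- r) A i).
Proof.
elim: r => [|i r IH] h; first by rewrite !big_nil; apply: wtop0.
rewrite !big_cons; apply: wtopD; first by apply: h; rewrite mem_head.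
by apply: IH => j jr; apply: h; rewrite inE jr orbT.
Qed.

Lemma wtop_exists w p : p != 0 -> exists2 k, wle w k p & wcmp w k p != 0.
Proof.
rewrite -msupp_eq0 => p0.
have [m mp hm] := seq_argmax (wt w) p0.
exists (wt w m) => //; apply/eqP => /(congr1 (fun p => p@_m)) /eqP.
by rewrite mcoeff_wcmp eqxx mcoeff0 -[_ == 0]negbK -mcoeff_msupp mp.
Qed.

Lemma wcmp_neq0_le w i j p : wcmp w i p != 0 -> wle w j p -> i <= j.
Proof. by move=> h hj; rewrite leNgt; apply/negP => /wcmp_lt /(_ hj) /eqP; apply/negP. Qed.

End Weights.

Section WeightComp.
Variables (K : fieldType) (n k : nat).

(** With each variable of [P] weighted like what replaces it, a monomial of weight below [W]
    contributes nothing in weight [W]; only the top part of [P], at the top parts of [F], remains.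
    Its value may vanish. *)
Lemma wtop_comp (v : 'I_n -> int) (w : 'I_k -> int) (F A : n.-tuple {mpoly K[k]})
    (P : {mpoly K[n]}) W :
  (forall i, wtop w (v i) (tnth F i) (tnth A i)) -> wle v W P ->
  wtop w W (P \mPo F) (wcmp v W P \mPo A).
Proof.
move=> h hP; rewrite comp_mpolyEX raddf_sum [X in wtop _ _ _ X]big_mkcond /=.
apply: (@wtop_sum K k w W _ (msupp P)) => m mP.
have hm : wtop w (wt v m) ('X_[m] \mPo F) ('X_[m] \mPo A).
  rewrite !comp_mpolyX; apply: wtop_prod => i; exact: wtop_exp.
have [<-|ne] := eqVneq (wt v m) W; first by rewrite comp_mpolyZ; apply: wtopZ.
have lt : wt v m < W by rewrite lt_neqAle ne hP.
case: hm => hm _; split; first by apply: wleZ; apply: wleW (ltW lt) hm.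
by rewrite wcmpZ (wcmp_lt lt hm) scaler0.
Qed.
End WeightComp.

(** * Flows on a polynomial ring *)

Lemma comp_mpolyA (R : comRingType) (n k l : nat) (p : {mpoly R[n]})
    (F : n.-tuple {mpoly R[k]}) (G : k.-tuple {mpoly R[l]}) :
  (p \mPo F) \mPo G = p \mPo [tuple tnth F i \mPo G | i < n].
Proof.
rewrite (comp_mpolyEX p F) raddf_sum [RHS]comp_mpolyEX.
apply: eq_bigr => m _; rewrite /= comp_mpolyZ !comp_mpolyX rmorph_prod.
by congr (_ *: _); apply: eq_bigr => i _; rewrite rmorphXn tnth_mktuple.
Qed.

Lemma mpoly_divX (R : comRingType) (n : nat) (i : 'I_n) (p : {mpoly R[n]}) :
  (forall m, m \in msupp p -> (0 < m i)%N) -> exists q, p = 'X_i * q.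
Proof.
move=> h; exists (\sum_(m <- msupp p) p@_m *: 'X_[m - U_(i)]).
rewrite [LHS]mpolyE mulr_sumr [LHS]big_seq [RHS]big_seq; apply: eq_bigr => m mp.
rewrite -scalerAr -mpolyXD addmC submK //.
by apply/mnm_lepP => j; rewrite mnm1E; case: eqP => [<-|//]; apply: h.
Qed.

Section Tau.
Variables (K : fieldType) (n : nat).
Implicit Types (p u v : {mpoly K[n]}) (q : {mpoly K[n.+1]}).

(** The last variable [ord_max] is the time tau; [incl] is the inclusion of K[x] in K[x][tau] and
    [sig] is evaluation at tau = 0. *)
Definition emb (j : 'I_n) : 'I_n.+1 := lift ord_max j.
Definition incl p : {mpoly K[n.+1]} := p \mPo [tuple 'X_(emb j) | j < n].
Definition sig q : {mpoly K[n]} :=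
  q \mPo [tuple oapp (fun j => 'X_j) 0 (unlift ord_max i) | i < n.+1].

HB.instance Definition _ := GRing.RMorphism.copy incl
  (comp_mpoly [tuple 'X_(emb j) | j < n] : {mpoly K[n]} -> {mpoly K[n.+1]}).
HB.instance Definition _ := GRing.RMorphism.copy sig
  (comp_mpoly [tuple oapp (fun j => 'X_j) 0 (unlift ord_max i) | i < n.+1]
     : {mpoly K[n.+1]} -> {mpoly K[n]}).

Lemma inclX j : incl 'X_j = 'X_(emb j).
Proof. by rewrite /incl comp_mpolyXU -tnth_nth tnth_mktuple. Qed.

Lemma sigX j : sig 'X_(emb j) = 'X_j.
Proof. by rewrite /sig comp_mpolyXU -tnth_nth tnth_mktuple liftK. Qed.

Lemma sig_tau : sig 'X_ord_max = 0.
Proof. by rewrite /sig comp_mpolyXU -tnth_nth tnth_mktuple unlift_none. Qed.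

Lemma inclK : cancel incl sig.
Proof.
move=> p; rewrite /incl /sig comp_mpolyA -[RHS]comp_mpoly_id.
congr (_ \mPo _); apply: eq_from_tnth => i; rewrite !tnth_mktuple.
exact: sigX.
Qed.

Lemma tau_free q : (forall m, m \in msupp q -> m ord_max = 0%N) -> q = incl (sig q).
Proof.
move=> h; rewrite /incl /sig comp_mpolyA comp_mpolyEX [LHS]mpolyE.
rewrite [LHS]big_seq [RHS]big_seq; apply: eq_bigr => m /h m0; congr (_ *: _).
rewrite comp_mpolyX mpolyXE_id; apply: eq_bigr => i _.
rewrite !tnth_mktuple; case: unliftP => [j ->|->] /=; last by rewrite m0 !expr0.
by rewrite -/(incl _) inclX.
Qed.

Lemma sig_pos q : (forall m, m \in msupp q -> (0 < m ord_max)%N) -> sig q = 0.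
Proof. by move=> /mpoly_divX[r ->]; rewrite rmorphM /= sig_tau mul0r. Qed.

Definition wtau (i : 'I_n.+1) : int := (i == ord_max)%:R.

Lemma wt_tau m : wt wtau m = m ord_max.
Proof.
rewrite /wt (bigD1 ord_max) //= /wtau eqxx big1 ?addr0 ?natz // => i /negPf->.
by rewrite mul0rn.
Qed.

Lemma wtau_emb i : wtau (emb i) = 0.
Proof. by rewrite /wtau /emb eq_sym (negPf (neq_lift _ _)). Qed.

Lemma tau_split q : exists r : {mpoly K[n.+1]}, q = incl (sig q) + 'X_ord_max * r /\
  (forall m : 'X_{1..n.+1}, m ord_max = 0%N -> ('X_ord_max * r)@_m = 0).
Proof.
set q0 := wcmp wtau 0 q.
have h m : m \in msupp (q - q0) -> (0 < m ord_max)%N.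
  rewrite mcoeff_msupp mcoeffB mcoeff_wcmp wt_tau lt0n.
  by apply: contra => /eqP->; rewrite eqxx subrr.
have q0E : q0 = incl (sig q0).
  apply: tau_free => m; rewrite mcoeff_msupp mcoeff_wcmp wt_tau.
  by have [|//] := eqVneq (Posz (m ord_max)) 0; [case|rewrite eqxx].
have [r rE] := mpoly_divX h; exists r; split.
  rewrite -rE -[sig q](subrK (sig q0)) -rmorphB /= (sig_pos h) add0r -q0E.
  by rewrite addrC subrK.
by move=> m m0; rewrite -rE; apply: memN_msupp_eq0; apply/negP => /h; rewrite m0.
Qed.

Lemma taule_incl p : wle wtau 0 (incl p).
Proof.
have [||] := @wtop_comp K _ _ (fun=> 0) wtau [tuple 'X_(emb j) | j < n]
  [tuple 'X_(emb j) | j < n] p 0 => //.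
  by move=> i; rewrite tnth_mktuple -(wtau_emb i) -wtU; apply: wtopX.
by move=> m _; rewrite /wt big1 // => i _; rewrite mul0rn.
Qed.

Lemma taule0 q : wle wtau 0 q -> q = incl (sig q).
Proof. by move=> h; apply: tau_free => m /h; rewrite wt_tau; case: (m ord_max). Qed.

Lemma tau_top_ge0 k q : wcmp wtau k q != 0 -> 0 <= k.
Proof.
apply: contraNT; rewrite -ltNge => k0; apply/eqP/mpolyP => m.
by rewrite mcoeff_wcmp mcoeff0 wt_tau; case: eqP => // e; rewrite -e in k0.
Qed.

(** Of a flow, only the normalization at tau = 0 is kept; it survives degeneration. *)
Definition section_of (T : n.-tuple {mpoly K[n.+1]}) :=
  forall i, sig (tnth T i) = 'X_i.

Definition invariant (T : n.-tuple {mpoly K[n.+1]}) u := u \mPo T = incl u.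

Section Inv.
Variable T : n.-tuple {mpoly K[n.+1]}.
Hypothesis sT : section_of T.

Lemma sig_comp u : sig (u \mPo T) = u.
Proof.
rewrite /sig comp_mpolyA -[RHS]comp_mpoly_id; congr (_ \mPo _).
by apply: eq_from_tnth => i; rewrite !tnth_mktuple; apply: sT.
Qed.

(** Degrees in tau add up: those of [u \mPo T] and [v \mPo T] sum to at most 0, so [u \mPo T] is
    free of tau and equals its value [u] at tau = 0. *)
Lemma inv_factor u v : u * v != 0 -> invariant T (u * v) -> invariant T u.
Proof.
move=> uv0 iuv; rewrite /invariant -{2}(sig_comp u); apply: taule0.
have : (u \mPo T) * (v \mPo T) != 0.
  rewrite -rmorphM; apply: contra uv0 => /eqP e.
  by rewrite -(sig_comp (u * v)) e rmorph0.
rewrite mulf_eq0 negb_or => /andP[/wtop_exists - /(_ wtau)[k1 h1 n1]].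
move=> /wtop_exists - /(_ wtau)[k2 h2 n2].
have : wcmp wtau (k1 + k2) (incl (u * v)) != 0.
  rewrite -iuv (_ : (u * v) \mPo T = (u \mPo T) * (v \mPo T)); last exact: rmorphM.
  by rewrite (wcmpM h1 h2); apply: mulf_neq0 n1 n2.
move=> /wcmp_neq0_le /(_ (@taule_incl (u * v))) k12.
have := tau_top_ge0 n1; have := tau_top_ge0 n2 => g2 g1.
by have <- : k1 = 0 by lia.
Qed.

Lemma inv_factor_r u v : u * v != 0 -> invariant T (u * v) -> invariant T v.
Proof. by rewrite mulrC; apply: inv_factor. Qed.

Lemma inv_exp u k : (0 < k)%N -> u != 0 -> invariant T (u ^+ k) -> invariant T u.
Proof.
case: k => // k _ u0; rewrite exprS; apply: inv_factor; rewrite -exprS.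
exact: expf_neq0.
Qed.

Lemma invX i : invariant T 'X_i -> tnth T i = 'X_(emb i).
Proof. by rewrite /invariant inclX comp_mpolyXU -tnth_nth. Qed.

End Inv.
End Tau.

(** * Degeneration of a flow along a weight *)

Section Degenerate.
Variables (K : fieldType) (n : nat).

Lemma section_coeff (T : n.-tuple {mpoly K[n.+1]}) i (m : 'X_{1..n.+1}) :
  section_of T -> m ord_max = 0%N -> (tnth T i)@_m = ('X_(emb i))@_m.
Proof.
move=> sT m0; have [r [-> h]] := tau_split (tnth T i).
by rewrite sT inclX mcoeffD h // addr0.
Qed.

Lemma wt_emb (l : 'I_n.+1 -> int) (m : 'X_{1..n.+1}) :
  wt l m = \sum_j l (emb j) *+ m (emb j) + l ord_max *+ m ord_max.
Proof.
rewrite /wt big_ord_recr /=; congr (_ + _); apply: eq_bigr => j _.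
by have -> : widen_ord (leqnSn n) j = emb j by apply: val_inj; rewrite /= /bump leqNgt ltn_ord.
Qed.

(* The weight of tau is the largest one for which no term of [T i] outweighs
   ['X_i]; the extremal terms survive in the limit, so it is not trivial. *)
Lemma degenerate (T : n.-tuple {mpoly K[n.+1]}) (P : {mpoly K[n]}) (w : 'I_n -> int) :
  section_of T -> (exists i, tnth T i != 'X_(emb i)) -> invariant T P ->
  exists T' : n.-tuple {mpoly K[n.+1]},
    [/\ section_of T', exists i, tnth T' i != 'X_(emb i)
      & forall W, wle w W P -> invariant T' (wcmp w W P)].
Proof.
move=> sT [i0 ni0] iP.
pose S := [seq x <- flatten [seq [seq (i, m) | m <- msupp (tnth T i)] | i <- enum 'I_n]
            | (0 < (x.2 : 'X_{1..n.+1}) ord_max)%N].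
have inS i m : m \in msupp (tnth T i) -> (0 < m ord_max)%N -> (i, m) \in S.
  move=> mT m0; rewrite mem_filter m0 /=; apply/flattenP.
  exists [seq (i, m) | m <- msupp (tnth T i)]; last by apply: map_f.
  by apply: map_f; rewrite mem_enum.
have SP i m : (i, m) \in S -> m \in msupp (tnth T i) /\ (0 < m ord_max)%N.
  rewrite mem_filter /= => /andP[-> /flattenP[s /mapP[j _ ->] /mapP[m' hm' [-> ->]]]].
  by [].
have S0 : S != [::].
  apply: contra ni0 => /eqP S0; apply/eqP.
  rewrite -inclX -sT; apply: tau_free => m mT; apply/eqP; rewrite -leqn0 leqNgt.
  by apply/negP => /(inS _ _ mT); rewrite S0.
pose E (x : 'I_n * 'X_{1..n.+1}) : int := \sum_j w j *+ x.2 (emb j) - w x.1.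
have [[i1 m1] /SP[m1T m1p] hmax] := seq_argmax (fun x => (E x)%:~R / (x.2 ord_max)%:R : rat) S0.
(* [e / M] is the largest gain in weight per power of tau among the terms of [T]. Scaling [w] by [M]
   keeps the weight [- e] of tau an integer. *)
pose M := m1 ord_max; pose e := E (i1, m1).
pose l (i : 'I_n.+1) : int := oapp (fun j => w j *+ M) (- e) (unlift ord_max i).
have lE j : l (emb j) = w j *+ M by rewrite /l /emb liftK.
have lm : l ord_max = - e by rewrite /l unlift_none.
have wtl (m : 'X_{1..n.+1}) : wt l m = (\sum_j w j *+ m (emb j)) *+ M - e *+ m ord_max.
  rewrite wt_emb lm mulNrn -sumrMnl; congr (_ - _).
  by apply: eq_bigr => j _; rewrite lE mulrnAC.
have wX i : wt l U_(emb i)%MM = w i *+ M by rewrite wtU lE.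
have TU i m : m \in msupp (tnth T i) -> m ord_max = 0%N -> m = U_(emb i)%MM.
  rewrite mcoeff_msupp => mT m0; move: mT; rewrite section_coeff // mcoeffX.
  by have [->//|_] := eqVneq U_(emb i)%MM m; rewrite eqxx.
have Tle i : wle l (w i *+ M) (tnth T i).
  move=> m mT; have [m0|mp] := posnP (m ord_max).
    by rewrite (TU _ _ mT m0) wX.
  have := hmax _ (inS _ _ mT mp); rewrite /= -/M -/e.
  rewrite ler_pdivrMr ?ltr0n // mulrAC ler_pdivlMr ?ltr0n //.
  move=> h; have {h} : E (i, m) * M%:Z <= e * (m ord_max)%:Z.
    by rewrite -(ler_int rat) !intrM -!pmulrn.
  rewrite -!natz !mulr_natr wtl.
  by rewrite /E /= mulrnBl; lia.
pose T' := [tuple wcmp l (w i *+ M) (tnth T i) | i < n].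
exists T'; split.
- move=> i; rewrite tnth_mktuple.
  have [r [rE h]] := tau_split (wcmp l (w i *+ M) (tnth T i)).
  suff -> : wcmp l (w i *+ M) (tnth T i) = 'X_(emb i) + (wcmp l (w i *+ M) (tnth T i) - 'X_(emb i)).
    rewrite rmorphD /= sigX sig_pos ?addr0 // => m.
    rewrite mcoeff_msupp mcoeffB mcoeff_wcmp lt0n; apply: contra => /eqP m0.
    rewrite section_coeff // mcoeffX.
    have [<-|_] := eqVneq U_(emb i)%MM m; last by rewrite if_same subrr.
    by rewrite wX eqxx subrr.
  by rewrite addrC subrK.
- exists i1; rewrite tnth_mktuple; apply/eqP => /(congr1 (fun q => q@_m1)) /eqP.
  rewrite mcoeff_wcmp mcoeffX wtl -/M /e /E /= mulrnBl opprB addrC subrK eqxx.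
  have /negPf-> : (U_(emb i1)%MM : 'X_{1..n.+1}) != m1.
    apply: contraTneq m1p => <-; rewrite mnm1E /emb eq_sym.
    by rewrite (negPf (neq_lift _ _)).
  by rewrite -[_ == _]negbK -mcoeff_msupp m1T.
- move=> W hW; rewrite /invariant.
  have wtM (m : 'X_{1..n}) : wt (fun j => w j *+ M) m = wt w m *+ M.
    by rewrite /wt -sumrMnl; apply: eq_bigr => j _; rewrite mulrnAC.
  have cE : wcmp (fun j => w j *+ M) (W *+ M) P = wcmp w W P.
    apply/mpolyP => m; rewrite !mcoeff_wcmp wtM.
    by rewrite eqrMn2r eqn0Ngt m1p.
  have hWM : wle (fun j => w j *+ M) (W *+ M) P.
    by move=> m /hW; rewrite wtM lerMn2r => ->; rewrite orbT.
  (* Both sides of [P \mPo T = incl P] are compared in weight [W *+ M], each computed by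
     [wtop_comp]. *)
  rewrite -cE.
  have [||_ <-] := @wtop_comp K n n.+1 (fun j => w j *+ M) l T T' P (W *+ M).
  + by move=> i; rewrite tnth_mktuple; split.
  + exact: hWM.
  rewrite iP.
  have [||_] := @wtop_comp K n n.+1 (fun j => w j *+ M) l [tuple 'X_(emb j) | j < n]
    [tuple 'X_(emb j) | j < n] P (W *+ M).
  + by move=> i; rewrite tnth_mktuple -wX; apply: wtopX.
  + exact: hWM.
  exact: id.
Qed.

End Degenerate.

(** * The cusp x_j^a = r x_i^b *)

Lemma mderiv_exp (R : comRingType) (n : nat) (i : 'I_n) (p : {mpoly R[n]}) k :
  (p ^+ k)^`M(i) = (p ^+ k.-1 * p^`M(i)) *+ k.
Proof.
elim: k => [|[|k] IH]; first by rewrite expr0 -mpolyC1 mderivC mulr0n.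
  by rewrite expr1 expr0 mul1r.
by rewrite exprS mderivM IH /= mulrnAr mulrA -exprS mulrC [in RHS]mulrS.
Qed.

Lemma swap_binom (F : fieldType) (V : lmodType F) (r : F) (u v u' v' : V) :
  r != 0 -> u - r *: v = u' - r *: v' -> v - r^-1 *: u = v' - r^-1 *: u'.
Proof.
move=> r0 /(congr1 (fun p => - r^-1 *: p)).
by rewrite !scalerBr !scaleNr !scalerA mulVf // !scale1r ![- _ - - _]addrC !opprK.
Qed.

Section Cusp.
Variables (K : fieldType) (n : nat).
Implicit Types (A B : {mpoly K[n.+1]}).

Lemma incl_binom (i j : 'I_n) (r : K) a b :
  incl ('X_j ^+ a - r *: 'X_i ^+ b) = 'X_(emb j) ^+ a - r *: 'X_(emb i) ^+ b.
Proof.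
rewrite -!mul_mpolyC rmorphB rmorphM !rmorphXn /= !inclX.
by rewrite /incl comp_mpolyC.
Qed.

Lemma wle_deriv (m : nat) (w : 'I_m -> int) k i (p : {mpoly K[m]}) :
  w i = 0 -> wle w k p -> wle w k p^`M(i).
Proof.
move=> wi hp m'; rewrite mcoeff_msupp mcoeff_mderiv => h.
have /hp : (m' + U_(i))%MM \in msupp p.
  by rewrite mcoeff_msupp; apply: contra h => /eqP->; rewrite mul0rn.
by rewrite wtD wtU wi addr0.
Qed.

(* Differentiating the cusp equation along [i] and eliminating [A ^+ a] bounds
   the tau-degrees of [A] and [B] as in the Mason-Stothers theorem. *)
Lemma cusp_core A B (i j : 'I_n) (r : K) (a b : nat) :
  i != j -> (2 <= a)%N -> (2 <= b)%N -> coprime a b -> r != 0 -> b%:R != 0 :> K ->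
  sig A = 'X_j -> sig B = 'X_i ->
  A ^+ a - r *: B ^+ b = 'X_(emb j) ^+ a - r *: 'X_(emb i) ^+ b ->
  A = 'X_(emb j) /\ B = 'X_(emb i).
Proof.
move=> ij a2 b2 cab r0 bK sA sB eqAB.
have sN0 (C : {mpoly K[n.+1]}) (k : 'I_n) : sig C = 'X_k -> C != 0.
  move=> sC; apply/eqP => C0; have /eqP := congr1 (mcoeff U_(k)%MM) sC.
  by rewrite C0 rmorph0 mcoeff0 mcoeffX eqxx eq_sym oner_eq0.
have [nu hA nA] := wtop_exists (@wtau n) (sN0 _ _ sA).
have [mu hB nB] := wtop_exists (@wtau n) (sN0 _ _ sB).
have nu0 := tau_top_ge0 nA; have mu0 := tau_top_ge0 nB.
have tA : wtop (@wtau n) nu A (wcmp (@wtau n) nu A) by split.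
have tB : wtop (@wtau n) mu B (wcmp (@wtau n) mu B) by split.
set H := 'X_(emb j) ^+ a - r *: 'X_(emb i) ^+ b in eqAB.
have HE : H = incl ('X_j ^+ a - r *: 'X_i ^+ b).
  exact/esym/incl_binom.
have hH : wle (@wtau n) 0 H by rewrite HE; apply: taule_incl.
have [tAa cAa] := wtop_exp a tA; have [tBb cBb] := wtop_exp b tB.
(* [H] is free of tau, so the highest powers of tau in [A ^+ a] and [r *: B ^+ b] cancel, or have
   exponent 0. *)
have top : nu *+ a = mu *+ b.
  have [lt|lt|//] := ltgtP (nu *+ a) (mu *+ b).
    have : wcmp (@wtau n) (mu *+ b) H != 0.
      rewrite -eqAB -scaleNr wcmpD wcmpZ (wcmp_lt lt tAa) add0r cBb mscalerI.
      by rewrite oppr_eq0 (negPf r0) expf_neq0.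
    by move=> /wcmp_neq0_le /(_ hH); lia.
  have : wcmp (@wtau n) (nu *+ a) H != 0.
    rewrite -eqAB -scaleNr wcmpD wcmpZ (wcmp_lt lt tBb) scaler0 addr0 cAa.
    exact: expf_neq0.
  by move=> /wcmp_neq0_le /(_ hH); lia.
have [nuE|nuN] := eqVneq nu 0.
  have muE : mu = 0 by lia.
  rewrite muE in hB; rewrite nuE in hA.
  by split; [rewrite (taule0 hA) sA inclX|rewrite (taule0 hB) sB inclX].
exfalso.
pose D := @mderiv n.+1 K (emb i).
have Dj : D 'X_(emb j) = 0.
  rewrite /D mderivX mnm1E; case: eqP => [/lift_inj e|_]; last by rewrite scale0r.
  by rewrite e eqxx in ij.
have Di : D 'X_(emb i) = 1.
  rewrite /D mderivX mnm1E eqxx scale1r -mpolyX0; congr mpolyX.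
  by apply/mnmP => k; rewrite mnmBE subnn mnm0E.
have Dt : D 'X_ord_max = 0.
  by rewrite /D mderivX mnm1E (negPf (neq_lift _ _)) scale0r.
have dE : (A ^+ a.-1 * D A) *+ a - r *: (B ^+ b.-1 * D B) *+ b
    = - r *: ('X_(emb i) ^+ b.-1) *+ b.
  have e1 : D (A ^+ a - r *: B ^+ b)
      = (A ^+ a.-1 * D A) *+ a - r *: (B ^+ b.-1 * D B) *+ b.
    by rewrite /D mderivB mderivZ !mderiv_exp scalerMnr.
  rewrite -e1 eqAB /H /D mderivB mderivZ !mderiv_exp -/D Dj Di mulr0 mulr1.
  by rewrite mul0rn sub0r scaleNr mulNrn scalerMnr.
have wD (C : {mpoly K[n.+1]}) k : wle (@wtau n) k C -> wle (@wtau n) k (D C).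
  by apply: wle_deriv; apply: wtau_emb.
(* A weighted Wronskian of [A] and [B]: eliminating [A ^+ a] between the equation and its derivative
   writes [B ^+ b.-1 * S] through terms of tau-degree at most [nu]. *)
pose S := r *: (B * D A) *+ a - r *: (D B * A) *+ b.
have key : B ^+ b.-1 * S = - r *: ('X_(emb i) ^+ b.-1 * A) *+ b - (H * D A) *+ a.
  have Aa : A ^+ a.-1 * A = r *: (B ^+ b.-1 * B) + H.
    by rewrite -!exprSr !prednK ?(ltn_trans _ a2) ?(ltn_trans _ b2) // -eqAB addrC subrK.
  have := congr1 (fun p => p * A) dE; rewrite mulrBl !mulrnAl => dE'.
  rewrite -!scalerAl in dE'; rewrite -dE'.
  have -> : A ^+ a.-1 * D A * A = (A ^+ a.-1 * A) * D A by rewrite mulrAC.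
  rewrite Aa /S mulrDl -!mul_mpolyC; ring.
have hR : wle (@wtau n) nu (B ^+ b.-1 * S).
  rewrite key; apply: wleD.
    rewrite -scaler_nat; apply/wleZ/wleZ; rewrite -[nu]add0r; apply: wleM hA.
    rewrite -(mul0rn _ b.-1) -(wtau_emb i) -wtU.
    by case: (wtop_exp b.-1 (wtopX K (@wtau n) U_(emb i)%MM)).
  rewrite -scaler_nat -scaleNr; apply/wleZ; rewrite -[nu]add0r; apply: wleM hH _.
  exact: wD.
(* If [S] is nonzero, [(b - 1) mu <= nu]; with [a nu = b mu] this gives [a (b - 1) <= b], so
   [a = b = 2], against coprimality. If [S = 0], setting tau = 0 in [key] leaves
   [b r x_i^(b-1) x_j = 0]. *)
have [S0|S0] := eqVneq S 0; last first.
  have [s hs ns] := wtop_exists (@wtau n) S0.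
  have s0 := tau_top_ge0 ns.
  have [tBb1 cBb1] := wtop_exp b.-1 tB.
  have : wcmp (@wtau n) (mu *+ b.-1 + s) (B ^+ b.-1 * S) != 0.
    by rewrite (wcmpM tBb1 hs) cBb1; apply: mulf_neq0 ns; apply: expf_neq0.
  move=> /wcmp_neq0_le /(_ hR) le.
  have mupos : 0 < mu by nia.
  have ab : (a * b.-1 <= b)%N by nia.
  have /andP[/eqP ea /eqP eb] : (a == 2)%N && (b == 2)%N by nia.
  by rewrite ea eb in cab.
have := congr1 (@sig K n) key; rewrite S0 mulr0 rmorph0.
have sDA : sig (D A) = 0.
  have [q [-> _]] := tau_split A; rewrite sA inclX /D mderivD mderivM -/D Dj Dt.
  by rewrite mul0r !add0r rmorphM /= sig_tau mul0r.
rewrite -scaler_nat rmorphB rmorphMn rmorphM /= sDA mulr0 mul0rn subr0.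
rewrite -mul_mpolyC -[- r *: _]mul_mpolyC !rmorphM rmorphXn /= sigX sA.
rewrite /sig !comp_mpolyC => /esym/eqP; rewrite !mulf_eq0 !mpolyC_eq0.
rewrite oppr_eq0 (negPf r0) (negPf bK) /= expf_eq0.
by rewrite -!msize_poly_eq0 !msizeX !andbF.
Qed.

(** [cusp_core] needs [b] nonzero in [K]. Coprime exponents cannot both vanish in [K], so if [b]
    does, the two variables exchange roles, with [r^-1] for [r]. *)
Lemma cusp (T : n.-tuple {mpoly K[n.+1]}) (i j : 'I_n) (r : K) (a b : nat) :
  i != j -> (2 <= a)%N -> (2 <= b)%N -> coprime a b -> r != 0 -> section_of T ->
  invariant T ('X_j ^+ a - r *: 'X_i ^+ b) ->
  tnth T j = 'X_(emb j) /\ tnth T i = 'X_(emb i).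
Proof.
move=> ij a2 b2 cab r0 sT.
rewrite /invariant incl_binom raddfB /= comp_mpolyZ !rmorphXn /= !comp_mpolyXU -!tnth_nth.
move=> e.
have [bK|bK] := eqVneq (b%:R : K) 0; last by apply: cusp_core e.
have aK : a%:R != 0 :> K.
  apply/eqP => aK; have /eqP := oner_neq0 K; apply.
  have [u v uv _] := egcdnP b (ltn_trans (isT : 0 < 1)%N a2).
  move: uv; rewrite (eqP (cab : gcdn a b == 1%N)) => /(congr1 (fun k => k%:R : K)).
  by rewrite natrD !natrM aK bK !mulr0 add0r => /esym.
have r1 : r^-1 != 0 by rewrite invr_eq0.
have := @cusp_core (tnth T i) (tnth T j) j i r^-1 b a.
rewrite eq_sym coprime_sym => /(_ ij b2 a2 cab r1 aK (sT _) (sT _)) h.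
by case: (h (swap_binom r0 e)).
Qed.

End Cusp.

(** * Newton polygons *)

Lemma I2_cases (i j k : 'I_2) : i != j -> k = i \/ k = j.
Proof.
move=> ij; have [->|ki] := eqVneq k i; [by left|right]; apply: val_inj.
by move: ij ki; rewrite -!val_eqE /=; case: i j k => [[|[|i]] hi] [[|[|j]] hj] [[|[|k]] hk].
Qed.

Lemma big_I2 (R : nmodType) (F : 'I_2 -> R) (i j : 'I_2) : i != j -> \sum_k F k = F i + F j.
Proof.
move=> ij; rewrite (bigD1 i) //= (bigD1 j) 1?eq_sym //= big1 ?addr0 // => k /andP[ki kj].
by have [e|e] := I2_cases k ij; rewrite e eqxx in ki kj.
Qed.

Lemma X_neq0 (R : nzRingType) (n : nat) (i : 'I_n) : 'X_i != 0 :> {mpoly R[n]}.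
Proof. by rewrite -msize_poly_eq0 msizeX. Qed.

Section Degv.
Variables (R : nzRingType) (n : nat).
Implicit Types (p : {mpoly R[n]}).

Definition degv (i : 'I_n) p := (\max_(m <- msupp p) (m : 'X_{1..n}) i)%N.

Lemma degv_ge i p (m : 'X_{1..n}) : m \in msupp p -> (m i <= degv i p)%N.
Proof. by move=> mp; apply: leq_bigmax_seq. Qed.

Lemma degv_le i p d : (forall m : 'X_{1..n}, m \in msupp p -> (m i <= d)%N) -> (degv i p <= d)%N.
Proof. by move=> h; apply/bigmax_leqP_seq => m mp _; apply: h. Qed.

Lemma degv_lt i p d : (0 < d)%N ->
  (forall m : 'X_{1..n}, m \in msupp p -> (m i < d)%N) -> (degv i p < d)%N.
Proof. by case: d => // d _ h; rewrite ltnS; apply: degv_le. Qed.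

Lemma degv_attained i p : (0 < degv i p)%N ->
  exists2 m : 'X_{1..n}, m \in msupp p & m i = degv i p.
Proof.
move=> d0; have p0 : msupp p != [::].
  by apply: contraTneq d0; rewrite /degv => ->; rewrite big_nil.
have [m mp h] := seq_argmax (fun m : 'X_{1..n} => (m i)%:Z) p0.
exists m => //; apply/eqP; rewrite eqn_leq degv_ge //=; apply: degv_le => m' /h.
by rewrite lez_nat.
Qed.

End Degv.

Section Newton.
Variable K : closedFieldType.
Implicit Types (P : {mpoly K[2]}) (T : 2.-tuple {mpoly K[3]}).

Lemma wt2 (w : 'I_2 -> int) (m : 'X_{1..2}) i j : i != j ->
  wt w m = w i *+ m i + w j *+ m j.
Proof. exact: big_I2. Qed.

Lemma not_both_inv T (i j : 'I_2) : i != j ->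
  (exists k, tnth T k != 'X_(emb k)) -> invariant T 'X_i -> invariant T 'X_j -> False.
Proof.
move=> ij [k]; have [->|->] := I2_cases k ij; move=> /eqP nT hi hj; apply: nT.
  exact: invX.
exact: invX.
Qed.

Lemma inv_scale T (c : K) P : c != 0 -> invariant T (c *: P) -> invariant T P.
Proof.
move=> c0; by rewrite /invariant /incl !comp_mpolyZ; apply: scalerI.
Qed.

Definition wgt2 (i : 'I_2) (a b : nat) (k : 'I_2) : int := if k == i then a%:Z else b%:Z.

Lemma wt_wgt2 i j a b (m : 'X_{1..2}) : i != j ->
  wt (wgt2 i a b) m = (a * m i + b * m j)%N.
Proof.
move=> ij; rewrite (wt2 _ _ ij) /wgt2 eqxx [j == i]eq_sym (negPf ij).
by rewrite PoszD !PoszM -[_ *+ m i]mulr_natr -[_ *+ m j]mulr_natr !natz.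
Qed.

Lemma X2E i j (m : 'X_{1..2}) : i != j -> 'X_[K, m] = 'X_i ^+ m i * 'X_j ^+ m j.
Proof.
move=> ij; rewrite !mpolyXn -mpolyXD; congr mpolyX; apply/mnmP => k.
rewrite mnmDE !mulmnE !mnm1E; have [->|->] := I2_cases k ij.
  by rewrite eqxx [j == i]eq_sym (negPf ij) mul1n mul0n addn0.
by rewrite eqxx (negPf ij) mul1n mul0n.
Qed.

(* A vertex of the Newton polygon off the axes would make both variables invariant. *)
Lemma pure_top T P (i j : 'I_2) (m0 : 'X_{1..2}) : i != j -> section_of T ->
  (exists k, tnth T k != 'X_(emb k)) -> invariant T P ->
  m0 \in msupp P -> m0 i = degv i P -> (0 < degv i P)%N -> m0 j = 0%N.
Proof.
move=> ij sT nT iP m0P m0d d0.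
pose S := [seq m <- msupp P | (m : 'X_{1..2}) i == degv i P].
have m0S : m0 \in S by rewrite mem_filter m0d eqxx.
have S0 : S != [::] by apply: contraTneq m0S => ->.
have [m1 m1S hm1] := seq_argmax (fun m : 'X_{1..2} => (m j)%:Z) S0.
have le01 : (m0 j <= m1 j)%N by have := hm1 _ m0S; rewrite lez_nat.
apply/eqP; rewrite -leqn0; apply: leq_trans le01 _; rewrite leqn0 eqn0Ngt.
apply/negP => m1j.
move: m1S; rewrite mem_filter => /andP[/eqP m1i m1P].
(* Exceeding every exponent of [x_j], [N] makes the weight [(N, 1)] order monomials
   lexicographically, so [m1] alone forms the leading form. *)
pose N := (degv j P).+1.
have [T' [sT' nT' hT']] := degenerate (wgt2 i N 1) sT nT iP.
have hle : wle (wgt2 i N 1) (wt (wgt2 i N 1) m1) P.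
  move=> m mP; rewrite !(wt_wgt2 _ _ _ ij) lez_nat !mul1n m1i.
  have := degv_ge i mP; rewrite leq_eqVlt => /orP[/eqP mi|lt].
    rewrite mi leq_add2l; have := hm1 m; rewrite mem_filter mi eqxx mP => /(_ isT).
    by rewrite lez_nat.
  apply: leq_trans (leq_addr _ _); apply: (@leq_trans (N * (m i).+1)).
    by rewrite mulnS addnC leq_add2r ltnW // ltnS degv_ge.
  by rewrite leq_mul2l lt orbT.
have cE : wcmp (wgt2 i N 1) (wt (wgt2 i N 1) m1) P = P@_m1 *: 'X_[m1].
  apply/mpolyP => m; rewrite mcoeff_wcmp mcoeffZ mcoeffX.
  have [<-|ne] := eqVneq m1 m; first by rewrite eqxx mulr1.
  rewrite mulr0; case: eqP => // e; apply: memN_msupp_eq0; apply/negP => mP.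
  move: e; rewrite !(wt_wgt2 _ _ _ ij) => -[]; rewrite !mul1n m1i => e.
  have li := degv_ge i mP; have lj := degv_ge j mP; have lj1 := degv_ge j m1P.
  have e1 : m i = degv i P.
    apply/eqP; rewrite eqn_leq li leqNgt; apply/negP => lt.
    have : (N * (m i).+1 <= N * degv i P)%N by rewrite leq_mul2l lt orbT.
    by rewrite mulnS; move: lj e; rewrite -ltnS -/N; lia.
  case/eqP: ne; apply/mnmP => k; have [->|->] := I2_cases k ij; first by rewrite m1i e1.
  by apply/eqP; rewrite -(eqn_add2l (N * degv i P)) -{2}e1 e.
have := hT' _ hle; rewrite cE => /inv_scale; rewrite -mcoeff_msupp => /(_ m1P).
rewrite (X2E m1 ij) m1i => h.
have n0 : 'X_i ^+ degv i P * 'X_j ^+ m1 j != 0 :> {mpoly K[2]}.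
  by rewrite -m1i -(X2E m1 ij) -msize_poly_eq0 msizeX.
apply: (not_both_inv ij nT').
  exact: (inv_exp sT' d0 (X_neq0 _ i) (inv_factor sT' n0 h)).
exact: (inv_exp sT' m1j (X_neq0 _ j) (inv_factor_r sT' n0 h)).
Qed.

(** The homogenization of [p] in degree [g], evaluated at [(U, V)]. It describes the form carried by
    an edge of a Newton polygon, a root of [p] giving a binomial factor. *)
Definition hom2 (U V : {mpoly K[2]}) g (p : {poly K}) :=
  \sum_(k < g.+1) p`_k *: (U ^+ (g - k) * V ^+ k).

Lemma hom2_root U V g (p : {poly K}) r : (size p <= g.+1)%N ->
  hom2 U V g.+1 (p * ('X - r%:P)) = (V - r *: U) * hom2 U V g p.
Proof.
move=> sp; rewrite mulrBl /hom2 !mulr_sumr.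
transitivity (\sum_(k < g.+2) ((p * 'X)`_k *: (U ^+ (g.+1 - k) * V ^+ k)
   - r *: (p`_k *: (U ^+ (g.+1 - k) * V ^+ k)))).
  by apply: eq_bigr => k _; rewrite mulrBr coefB coefMC scalerBl scalerA [r * _]mulrC.
rewrite sumrB big_ord_recl coefMX eqxx scale0r add0r; congr (_ - _).
  apply: eq_bigr => k _; rewrite coefMX lift0 /= subSS -scalerAr.
  by congr (_ *: _); rewrite exprS mulrCA.
rewrite big_ord_recr /= nth_default // scale0r scaler0 addr0.
apply: eq_bigr => k _; rewrite subSn -1?ltnS // exprS -!scalerAl -scalerAr mulrA.
by [].
Qed.

Definition subst2 (j : 'I_2) (q : {mpoly K[2]}) : 2.-tuple {mpoly K[2]} :=
  [tuple if k == j then 'X_j + q else 'X_k | k < 2].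

Lemma tnth_subst2 j q k : tnth (subst2 j q) k = if k == j then 'X_j + q else 'X_k.
Proof. by rewrite tnth_mktuple. Qed.

Lemma comp_subst2 j q k : 'X_k \mPo subst2 j q = if k == j then 'X_j + q else 'X_k.
Proof. by rewrite comp_mpolyXU -tnth_nth tnth_subst2. Qed.

(** The substitution turns the factor [x_j - r x_i^b] of the leading form into [x_j]. No monomial of
    top weight is then a pure power of [x_i], so the degree in [x_i] drops; the weight bound
    controls the degree in [x_j]. *)
Lemma reduce P (i j : 'I_2) b (r : K) V :
  i != j -> (0 < b)%N -> (0 < degv j P)%N -> degv i P = (b * degv j P)%N ->
  wle (wgt2 i 1 b) (degv i P) P ->
  wcmp (wgt2 i 1 b) (degv i P) P = ('X_j - r *: 'X_i ^+ b) * V ->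
  let P' := P \mPo subst2 j (r *: 'X_i ^+ b) in
  (degv i P' < degv i P)%N /\ (degv j P' <= degv j P)%N.
Proof.
move=> ij b0 dj0 dE hle cE P'; set w := wgt2 i 1 b in hle cE.
have wi : w i = 1 by rewrite /w /wgt2 eqxx.
have wj : w j = b by rewrite /w /wgt2 eq_sym (negPf ij).
have [||h1 h2] := @wtop_comp K 2 2 w w (subst2 j (r *: 'X_i ^+ b)) (subst2 j (r *: 'X_i ^+ b)) P (degv i P).
- move=> k; rewrite tnth_subst2; case: eqP => [->|_]; last by rewrite -wtU; apply: wtopX.
  apply: wtopD; first by rewrite -wtU; apply: wtopX.
  apply: wtopZ; rewrite wj -[Posz b]natz -wi -wtU; apply: wtop_exp; exact: wtopX.
- exact: hle.
rewrite -/P' in h1 h2.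
have bound m : m \in msupp P' -> (m i + b * m j <= degv i P)%N.
  by move=> /h1; rewrite (wt_wgt2 _ _ _ ij) mul1n lez_nat.
split; last first.
  by apply: degv_le => m /bound; rewrite dE => h; rewrite -(leq_pmul2l b0); lia.
apply: degv_lt => [|m mP]; first by rewrite dE muln_gt0 b0.
have bm := bound _ mP; rewrite ltn_neqAle (leq_trans (leq_addr _ _) bm) andbT.
apply/eqP => mi; have mj : m j = 0%N.
  by move: bm; rewrite mi -[X in (_ <= X)%N]addn0 leq_add2l leqn0 muln_eq0 eqn0Ngt b0 => /eqP.
have : (wcmp w (degv i P) P')@_m != 0.
  by rewrite mcoeff_wcmp (wt_wgt2 _ _ _ ij) mi mj mul1n muln0 addn0 eqxx -mcoeff_msupp.
rewrite h2 cE rmorphM rmorphB /= comp_mpolyZ rmorphXn /= !comp_subst2 eqxx (negPf ij) addrK.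
rewrite -mcoeff_msupp => /msuppM_le /allpairsP[[m1 m2] /= [h _ e]].
by move: mj; rewrite e mnmDE; move: h; rewrite msuppX inE => /eqP->; rewrite mnm1E eqxx.
Qed.

End Newton.

Section Newton2.
Variable K : closedFieldType.
Implicit Types (P : {mpoly K[2]}) (T : 2.-tuple {mpoly K[3]}).

Definition mon2 (i j : 'I_2) (a b : nat) : 'X_{1..2} := (U_(i) *+ a + U_(j) *+ b)%MM.

Lemma mon2E i j (m : 'X_{1..2}) : i != j -> m = mon2 i j (m i) (m j).
Proof.
move=> ij; apply/mnmP => k; rewrite mnmDE !mulmnE !mnm1E.
have [->|->] := I2_cases k ij; first by rewrite eqxx [j == i]eq_sym (negPf ij) mul1n addn0.
by rewrite eqxx (negPf ij) mul1n.
Qed.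

Lemma mon2i i j a b : i != j -> mon2 i j a b i = a /\ mon2 i j a b j = b.
Proof.
move=> ij; rewrite !mnmDE !mulmnE !mnm1E eqxx [j == i]eq_sym (negPf ij) eqxx.
by rewrite !mul1n !mul0n addn0.
Qed.

(** A monomial beyond the segment joining the points [degv i P] and [degv j P] of the axes involves
    both variables. A leading form of larger weight would thus be divisible by [x_i] and by [x_j],
    making both invariant. *)
Lemma newton_weight T P (i j : 'I_2) : i != j -> section_of T ->
  (exists k, tnth T k != 'X_(emb k)) -> invariant T P ->
  (0 < degv i P)%N -> (0 < degv j P)%N ->
  wle (wgt2 i (degv j P) (degv i P)) (degv i P * degv j P)%N P.
Proof.
move=> ij sT nT iP d0 e0.
set w := wgt2 i _ _.
have P0 : P != 0 by apply: contraTneq d0 => ->; rewrite /degv msupp0 big_nil.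
have [W hW nW] := wtop_exists w P0.
have [T' [sT' nT' hT']] := degenerate w sT nT iP.
have [le|lt] := lerP W (degv i P * degv j P)%N; first exact: wleW le hW.
exfalso.
have wk k : forall m, m \in msupp (wcmp w W P) -> (0 < (m : 'X_{1..2}) k)%N.
  move=> m; rewrite mcoeff_msupp mcoeff_wcmp; have [e|_] := eqVneq (wt w m) W; last by rewrite eqxx.
  rewrite -mcoeff_msupp => mP; rewrite lt0n; apply/eqP => mk.
  move: lt; rewrite -e (wt_wgt2 _ _ _ ij) ltz_nat ltnNge => /negP; apply.
  have li := degv_ge i mP; have lj := degv_ge j mP.
  have [ek|ek] := I2_cases k ij; rewrite ek in mk; rewrite mk muln0 ?addn0 ?add0n.
    by rewrite leq_mul2l lj orbT.
  by rewrite mulnC leq_mul2r li orbT.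
have iX k : invariant T' 'X_k.
  have [q qE] := mpoly_divX (wk k); have := hT' _ hW; rewrite qE; apply: inv_factor => //.
  by rewrite -qE.
exact: (not_both_inv ij nT' (iX i) (iX j)).
Qed.

(** As [a] and [b] are coprime, the lattice points of the edge from [(b g, 0)] to [(0, a g)] are the
    [(b (g - k), a k)], so the edge form is a binary form in [x_i^b] and [x_j^a]. *)
Lemma wcmp_hom2 P (i j : 'I_2) a b g : i != j -> coprime a b -> (0 < a)%N -> (0 < b)%N ->
  (0 < g)%N ->
  wcmp (wgt2 i (a * g) (b * g)) (b * g * (a * g))%N P =
  hom2 ('X_i ^+ b) ('X_j ^+ a) g (\poly_(k < g.+1) P@_(mon2 i j (b * (g - k)) (a * k))).
Proof.
move=> ij cab a0 b0 g0; apply/mpolyP => m; rewrite mcoeff_wcmp (wt_wgt2 _ _ _ ij).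
have kE k : 'X_i ^+ b ^+ (g - k) * 'X_j ^+ a ^+ k = 'X_[mon2 i j (b * (g - k)) (a * k)] :> {mpoly K[2]}.
  by rewrite -!exprM (X2E K (mon2 i j (b * (g - k)) (a * k)) ij); have [-> ->] := mon2i (b * (g - k)) (a * k) ij.
rewrite /hom2 raddf_sum /=.
rewrite (eq_bigr (fun k : 'I_g.+1 => P@_(mon2 i j (b * (g - k)) (a * k))
   * (mon2 i j (b * (g - k)) (a * k) == m)%:R)); last first.
  by move=> k _; rewrite coef_poly ltn_ord kE mcoeffZ mcoeffX.
have [[e]|ne] := eqVneq (Posz (a * g * m i + b * g * m j)) (Posz (b * g * (a * g))); last first.
  rewrite big1 // => k _; have [e|_] := eqVneq (mon2 _ _ _ _) m; last by rewrite mulr0.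
  case/eqP: ne; rewrite -e; have [-> ->] := mon2i (b * (g - k)) (a * k) ij.
  congr Posz; transitivity (a * b * g * ((g - k) + k))%N.
    by move: (g - k)%N (nat_of_ord k) => l k'; ring.
  by rewrite (subnK (ltnSE (ltn_ord k))); ring.
have {}e : (a * m i + b * m j = a * b * g)%N.
  by apply/eqP; rewrite -(eqn_pmul2r g0); apply/eqP; move: e; lia.
have dj : (a %| m j)%N.
  rewrite -(Gauss_dvdr _ cab) -(dvdn_addr _ (dvdn_mulr (m i) (dvdnn a))) e -mulnA.
  exact: dvdn_mulr.
have [k mj] := dvdnP dj.
have le : (b * k <= b * g)%N.
  by rewrite -(leq_pmul2l a0) mulnA [(a * b)%N]mulnC -mulnA [(a * k)%N]mulnC -mj; lia.
rewrite leq_pmul2l // in le.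
have mi : m i = (b * (g - k))%N.
  apply/eqP; rewrite -(eqn_pmul2l a0) mulnBr; apply/eqP.
  by rewrite mulnBr; move: e; rewrite mj; lia.
have mE : m = mon2 i j (b * (g - k)) (a * k) by rewrite {1}(mon2E m ij) mi mj [(a * k)%N]mulnC.
rewrite (bigD1 (Ordinal (le : (k < g.+1)%N))) //= -mE eqxx mulr1 big1 ?addr0 // => l /eqP lk.
have [e2|_] := eqVneq (mon2 _ _ _ _) m; last by rewrite mulr0.
have := (mon2i (b * (g - l)) (a * l) ij).2; rewrite e2 mj mulnC => /eqP.
by rewrite eqn_pmul2l // => /eqP kl; case: lk; apply: val_inj.
Qed.

Lemma wle_scale2 P (i j : 'I_2) x y z g : i != j -> (0 < g)%N ->
  wle (wgt2 i (x * g) (y * g)) (z * g)%N P -> wle (wgt2 i x y) z P.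
Proof.
move=> ij g0 h m /h; rewrite !(wt_wgt2 _ _ _ ij) !lez_nat => le.
by rewrite -(leq_pmul2r g0) mulnDl ![(_ * m _ * g)%N]mulnAC.
Qed.

Lemma wcmp_scale2 P (i j : 'I_2) x y z g : i != j -> (0 < g)%N ->
  wcmp (wgt2 i (x * g) (y * g)) (z * g)%N P = wcmp (wgt2 i x y) z P.
Proof.
move=> ij g0; apply/mpolyP => m; rewrite !mcoeff_wcmp !(wt_wgt2 _ _ _ ij).
by rewrite !eqz_nat -[X in _ = if X then _ else _](eqn_pmul2r g0) mulnDl ![(_ * m _ * g)%N]mulnAC.
Qed.

Lemma wgt2C (i j : 'I_2) x y : i != j -> wgt2 i x y =1 wgt2 j y x.
Proof.
move=> ij k; rewrite /wgt2; have [->|->] := I2_cases k ij.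
  by rewrite eqxx (negPf ij).
by rewrite eqxx eq_sym (negPf ij).
Qed.

Lemma wt_ext n (w w' : 'I_n -> int) : w =1 w' -> wt w =1 wt w'.
Proof. by move=> e m; apply: eq_bigr => i _; rewrite e. Qed.

Lemma pure_mem T P (i j : 'I_2) : i != j -> section_of T ->
  (exists k, tnth T k != 'X_(emb k)) -> invariant T P -> (0 < degv i P)%N ->
  P@_(mon2 i j (degv i P) 0) != 0.
Proof.
move=> ij sT nT iP d0; have [m mP mi] := degv_attained d0.
have mj := pure_top ij sT nT iP mP mi d0.
have <- : m = mon2 i j (degv i P) 0 by rewrite -mi {1}(mon2E m ij) mj.
by rewrite -mcoeff_msupp.
Qed.

(** The edge polynomial has a root [r], nonzero because the end of the edge on the [x_i] axis occurs
    in [P]. The resulting factor is invariant under the degenerated flow, so [cusp] excludes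
    [a, b >= 2], and [reduce] applies in the direction whose exponent is 1. *)
Lemma newton T P (i j : 'I_2) : i != j -> section_of T ->
  (exists k, tnth T k != 'X_(emb k)) -> invariant T P ->
  (0 < degv i P)%N -> (0 < degv j P)%N ->
  exists (i' j' : 'I_2) b r, [/\ i' != j',
    let P' := P \mPo subst2 j' (r *: 'X_i' ^+ b) in
    (degv i' P' < degv i' P)%N & 
    let P' := P \mPo subst2 j' (r *: 'X_i' ^+ b) in (degv j' P' <= degv j' P)%N].
Proof.
move=> ij sT nT iP d0 e0.
pose g := gcdn (degv i P) (degv j P).
have g0 : (0 < g)%N by rewrite gcdn_gt0 d0.
have [b dE] := dvdnP (dvdn_gcdl (degv i P) (degv j P)).
have [a eE] := dvdnP (dvdn_gcdr (degv i P) (degv j P)).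
rewrite -/g in dE eE.
have a0 : (0 < a)%N by move: e0; rewrite eE muln_gt0 => /andP[].
have b0 : (0 < b)%N by move: d0; rewrite dE muln_gt0 => /andP[].
have cab : coprime a b.
  by rewrite /coprime gcdnC -(eqn_pmul2r g0) muln_gcdl -dE -eE mul1n.
have hw := newton_weight ij sT nT iP d0 e0; rewrite dE eE in hw.
have cE := wcmp_hom2 P ij cab a0 b0 g0.
set p := \poly_(k < _) _ in cE.
have ji : j != i by rewrite eq_sym.
have p0 : p`_0 != 0.
  by rewrite coef_poly /= subn0 muln0 -dE; apply: pure_mem iP d0.
have pg : p`_g != 0.
  rewrite coef_poly ltnS leqnn subnn muln0 -eE.
  have -> : mon2 i j 0 (degv j P) = mon2 j i (degv j P) 0 by rewrite /mon2 addmC.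
  exact: pure_mem iP e0.
have sp : (g < size p)%N by rewrite ltnNge; apply: contra pg => /leq_sizeP->.
have /closed_rootP[r pr] : size p != 1 by rewrite neq_ltn (leq_ltn_trans g0 sp) orbT.
have r0 : r != 0.
  by apply: contraNneq p0 => r0; have /rootP := pr; rewrite r0 horner_coef0 => ->.
have /factor_theorem[q pE] := pr.
have q0 : q != 0 by apply: contraNneq p0 => q0; rewrite pE q0 mul0r coef0.
have sq : (size q <= g)%N.
  have := size_poly g.+1 (fun k => P@_(mon2 i j (b * (g - k)) (a * k))).
  by rewrite -/p pE size_Mmonic ?monicXsubC // size_XsubC addn2.
have hr := @hom2_root K ('X_i ^+ b) ('X_j ^+ a) g.-1 q r.
rewrite (prednK g0) in hr; rewrite pE (hr sq) in cE.
set V := hom2 _ _ _ _ in cE.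
have [T' [sT' nT' hT']] := degenerate (wgt2 i (a * g) (b * g)) sT nT iP.
have cn0 : wcmp (wgt2 i (a * g) (b * g)) (b * g * (a * g))%N P != 0.
  apply/eqP => /(congr1 (fun f => f@_(mon2 i j (degv i P) 0))) /eqP.
  rewrite mcoeff_wcmp (wt_wgt2 _ _ _ ij); have [-> ->] := mon2i (degv i P) 0 ij.
  by rewrite muln0 addn0 dE mulnC eqxx mcoeff0 -dE (negPf (pure_mem ij sT nT iP d0)).
have := hT' _ hw; rewrite cE => /(inv_factor sT'); rewrite -cE => /(_ cn0) iH.
have [a1|a1] := eqVneq a 1.
  exists i, j, b, r; rewrite a1 mul1n in eE.
  rewrite a1 mul1n -[X in wgt2 _ X](mul1n g) in hw cE.
  have hw1 : wle (wgt2 i 1 b) (degv i P) P by rewrite dE; apply: wle_scale2 ij g0 hw.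
  have cE1 : wcmp (wgt2 i 1 b) (degv i P) P = ('X_j - r *: 'X_i ^+ b) * V.
    by rewrite dE -(wcmp_scale2 P _ _ _ ij g0) cE expr1.
  have dE' : degv i P = (b * degv j P)%N by rewrite eE.
  by have [h1 h2] := reduce ij b0 e0 dE' hw1 cE1.
have [b1|b1] := eqVneq b 1.
  exists j, i, a, r^-1; rewrite b1 mul1n in dE.
  rewrite b1 mul1n [(g * _)%N]mulnC -[X in wgt2 i _ X](mul1n g) in hw cE.
  have hw1 : wle (wgt2 j 1 a) (degv j P) P.
    by move=> m; rewrite -(wt_ext (wgt2C a 1 ij)) eE; apply: wle_scale2 ij g0 hw m.
  have cE1 : wcmp (wgt2 j 1 a) (degv j P) P = ('X_i - r^-1 *: 'X_j ^+ a) * (- r *: V).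
    transitivity (wcmp (wgt2 i a 1) (a * g)%N P).
      by apply/mpolyP => m; rewrite !mcoeff_wcmp (wt_ext (wgt2C a 1 ij)) -eE.
    rewrite -(wcmp_scale2 P _ _ _ ij g0) cE expr1 -scalerAr scalerAl.
    by rewrite scalerBr scalerA mulNr mulfV // !scaleNr scale1r opprK addrC.
  have eE' : degv j P = (a * degv i P)%N by rewrite dE.
  by have [h1 h2] := reduce ji a0 d0 eE' hw1 cE1.
have [] := cusp ij _ _ cab r0 sT' iH; try by rewrite ltn_neqAle eq_sym ?a1 ?b1 ?a0 ?b0.
move=> hj hi; case: nT' => k /eqP; have [->|->] := I2_cases k ij; by case.
Qed.

End Newton2.

(** * Reduction of the automorphisms of K[x,y] *)

Section Aut2.
Variable K : closedFieldType.
Implicit Types (S : 2.-tuple {mpoly K[2]}).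

Definition inverse2 S S' :=
  (forall i, tnth S i \mPo S' = 'X_i) /\ (forall i, tnth S' i \mPo S = 'X_i).

Lemma comp_mpolyXt (n k : nat) (F : n.-tuple {mpoly K[k]}) i : 'X_i \mPo F = tnth F i.
Proof. by rewrite comp_mpolyXU -tnth_nth. Qed.

(* The translation along the other coordinate fixes the given one. *)
Lemma aut2_section S S' (i j : 'I_2) : i != j -> inverse2 S S' ->
  exists T : 2.-tuple {mpoly K[3]},
    [/\ section_of T, exists k, tnth T k != 'X_(emb k) & invariant T (tnth S i)].
Proof.
move=> ij [SS' S'S].
pose Q := [tuple incl (tnth S l) + (if l == j then 'X_ord_max else 0) | l < 2].
pose T := [tuple tnth S' k \mPo Q | k < 2].
have ST k : tnth S k \mPo T = tnth Q k.
  have := comp_mpolyA (tnth S k) S' Q; rewrite SS' comp_mpolyXt => ->.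
  by congr (_ \mPo _).
exists T; split.
- move=> k; rewrite tnth_mktuple /sig comp_mpolyA -[RHS]S'S; congr (_ \mPo _).
  apply: eq_from_tnth => l; rewrite [LHS]tnth_mktuple [tnth Q l]tnth_mktuple.
  rewrite -/(sig _) rmorphD /= inclK; case: eqP => _; last by rewrite rmorph0 addr0.
  by rewrite sig_tau addr0.
- apply/existsP; apply: contraT; rewrite negb_exists => /forallP triv.
  have : tnth S j \mPo T = incl (tnth S j).
    congr (_ \mPo _); apply: eq_from_tnth => k; have /negPn/eqP-> := triv k.
    by rewrite tnth_mktuple.
  rewrite ST tnth_mktuple eqxx => /eqP; rewrite addrC -subr_eq0 addrK.
  by rewrite (negPf (X_neq0 _ _)).
- by rewrite /invariant ST tnth_mktuple (negPf ij) addr0.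
Qed.

Definition deg2 (P : {mpoly K[2]}) := (\sum_(k < 2) degv k P)%N.

Lemma deg2E P (i j : 'I_2) : i != j -> deg2 P = (degv i P + degv j P)%N.
Proof.
move=> ij; rewrite /deg2 (bigD1 i) //= (bigD1 j) 1?eq_sym //= big1 ?addn0 // => k /andP[ki kj].
by have [e|e] := I2_cases k ij; rewrite e eqxx in ki kj.
Qed.

Lemma jung_step S S' k (i j : 'I_2) : i != j -> inverse2 S S' ->
  (0 < degv i (tnth S k))%N -> (0 < degv j (tnth S k))%N ->
  exists (i' j' : 'I_2) b r, i' != j' /\
    (deg2 (tnth S k \mPo subst2 j' (r *: 'X_i' ^+ b)) < deg2 (tnth S k))%N.
Proof.
move=> ij inv; have [k' kk'] : exists k', k != k'.
  by have [->|->] := I2_cases k ij; [exists j|exists i; rewrite eq_sym].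
have [T [sT nT iT]] := aut2_section kk' inv.
move=> d0 e0; have [i' [j' [b [r [ij' h1 h2]]]]] := newton ij sT nT iT d0 e0.
exists i', j', b, r; split => //; rewrite !(deg2E _ ij') -addSn.
exact: leq_add.
Qed.

Definition del (n : nat) (j : 'I_n) (k : 'I_n) : int := (k == j)%:R.

Lemma wt_del n (j : 'I_n) (m : 'X_{1..n}) : wt (del j) m = m j.
Proof.
rewrite /wt (bigD1 j) //= /del eqxx big1 ?addr0 ?natz // => i /negPf->.
by rewrite mul0rn.
Qed.

Lemma wt_one n (m : 'X_{1..n}) : wt (fun=> 1) m = mdeg m.
Proof. by rewrite mdegE /wt (big_morph Posz PoszD (erefl _)); apply: eq_bigr => i _; rewrite natz. Qed.

Lemma wcmp_supp n (w : 'I_n -> int) k (p : {mpoly K[n]}) :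
  wcmp w k p != 0 -> exists2 m, m \in msupp p & wt w m = k.
Proof.
move=> h; have [m] : exists m, m \in msupp (wcmp w k p).
  by case E: (msupp _) => [|m s]; [rewrite -msupp_eq0 E in h|exists m; rewrite mem_head].
rewrite mcoeff_msupp mcoeff_wcmp; have [e|_] := eqVneq (wt w m) k; last by rewrite eqxx.
by rewrite -mcoeff_msupp => mp; exists m.
Qed.

Lemma X_not_const n (i : 'I_n) (c : K) : 'X_i <> c%:MP :> {mpoly K[n]}.
Proof. by move/(congr1 (fun p => msize p)) => /=; rewrite msizeX mdeg1 msizeC; case: (c != 0). Qed.

Lemma wle_const n (p : {mpoly K[n]}) : wle (fun=> 1) 0 p -> p = (p@_0%MM)%:MP.
Proof.
move=> h; apply/mpolyP => m; rewrite mcoeffC; have [<-|ne] := eqVneq 0%MM m; first by rewrite mulr1.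
rewrite mulr0; apply: memN_msupp_eq0; apply/negP => /h; rewrite wt_one => m0.
by move/eqP: ne; apply; apply/esym/eqP; rewrite -mdeg_eq0 -leqn0 -lez_nat.
Qed.

(** [P] involves only [x_i], so [x_k = P(S'_i)] has total degree [e * d], the product of the degrees
    of [S'_i] and [P]; hence both are 1. *)
Lemma jung_end1 S S' k (i j : 'I_2) : i != j -> inverse2 S S' -> degv j (tnth S k) = 0%N ->
  exists a b, a != 0 /\ tnth S k = a *: 'X_i + b%:MP.
Proof.
move=> ij [SS' S'S]; set P := tnth S k => dj; set d := degv i P.
have S'0 l : tnth S' l != 0.
  by apply/eqP => e; have := S'S l; rewrite e comp_mpoly0 => /esym/eqP; rewrite (negPf (X_neq0 _ _)).
have [e he e0] := wtop_exists (fun=> 1) (S'0 i).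
have [e' he' _] := wtop_exists (fun=> 1) (S'0 j).
have supp m : m \in msupp P -> m = (U_(i) *+ m i)%MM.
  move=> mP; rewrite {1}(mon2E m ij) /mon2; have := degv_ge j mP; rewrite dj leqn0 => /eqP->.
  by rewrite mulm0n addm0.
pose v l := if l == i then e else e'.
have vi : v i = e by rewrite /v eqxx.
have wtP m : m \in msupp P -> wt v m = e * (m i)%:Z.
  move=> mP; rewrite (wt2 _ _ ij) vi; have := degv_ge j mP; rewrite dj leqn0 => /eqP->.
  by rewrite mulr0n addr0 -mulr_natr natz.
have epos : 0 <= e by have [m _ <-] := wcmp_supp e0; rewrite wt_one.
have {}epos : 0 < e.
  rewrite lt_neqAle epos andbT; apply/eqP => ez; rewrite -ez in he.
  by have := S'S i; rewrite (wle_const he) comp_mpolyC => /esym; apply: X_not_const.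
pose A := [tuple wcmp (fun=> 1) (v l) (tnth S' l) | l < 2].
have [] := @wtop_comp K 2 2 v (fun=> 1) S' A P (e * d%:Z).
- move=> l; rewrite tnth_mktuple; split=> //; rewrite /v.
  by have [->|->] := I2_cases l ij; rewrite ?eqxx // eq_sym (negPf ij).
- by move=> m mP; rewrite wtP // ler_pM2l // lez_nat degv_ge.
have Pk : P \mPo S' = 'X_k := SS' k.
have d0 : (0 < d)%N.
  rewrite lt0n; apply/eqP => d0; have PE : P = (P@_0%MM)%:MP.
    apply: wle_const => m mP; rewrite wt_one (supp _ mP).
    by have := degv_ge i mP; rewrite -/d d0 leqn0 => /eqP->; rewrite mulm0n mdeg0.
  by apply: (@X_not_const 2 k P@_0%MM); rewrite -Pk [in LHS]PE comp_mpolyC.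
have [m mP md] := degv_attained d0.
have cE : wcmp v (e * d%:Z) P = P@_m *: 'X_[m].
  apply/mpolyP => m'; rewrite mcoeff_wcmp mcoeffZ mcoeffX.
  have [<-|ne] := eqVneq m m'; first by rewrite wtP // md eqxx mulr1.
  rewrite mulr0; case: eqP => // em; apply: memN_msupp_eq0; apply/negP => mP'.
  move/eqP: ne; apply; rewrite (supp _ mP) (supp _ mP'); congr (_ *+ _)%MM.
  move: em; rewrite wtP // => /(mulfI (lt0r_neq0 epos)) [->]; exact: md.
rewrite Pk cE => _ top.
have : wcmp (fun=> 1) (e * d%:Z) 'X_k != 0 :> {mpoly K[2]}.
  rewrite top comp_mpolyZ (X2E K m ij); have := degv_ge j mP; rewrite dj leqn0 => /eqP->.
  rewrite expr0 mulr1 rmorphXn /= comp_mpolyXt tnth_mktuple vi scaler_eq0 negb_or.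
  by rewrite -mcoeff_msupp mP /= expf_eq0 (negPf e0) andbF.
move/wcmp_supp => [m']; rewrite msuppX inE => /eqP->; rewrite wt_one mdeg1 => ed.
have d1 : d = 1%N by nia.
exists P@_U_(i)%MM, P@_0%MM; split.
  by have := mP; rewrite mcoeff_msupp [X in P@_X](supp _ mP) md -/d d1 mulm1n.
apply/mpolyP => n; rewrite mcoeffD mcoeffZ mcoeffC mcoeffX.
have [<-|ni] := eqVneq U_(i)%MM n.
  case: eqP => [z|_]; last by rewrite mulr1 mulr0 addr0.
  by have := mnm1_eq0 i; rewrite -z eqxx.
have [<-|n0] := eqVneq 0%MM n; first by rewrite mulr0 add0r mulr1.
rewrite !mulr0 addr0; apply: memN_msupp_eq0; apply/negP => nP.
have := degv_ge i nP; rewrite -/d d1; case E: (n i) => [|[|?]] // _.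
  by case/eqP: n0; rewrite (supp _ nP) E mulm0n.
by case/eqP: ni; rewrite [RHS](supp _ nP) E mulm1n.
Qed.

(** Degrees along [x_j] are compared in [q(S) = x_j]. Since [S] fixes [x_i], the degrees [e] of [Q]
    and [l] of [q] satisfy [e * l = 1], and the top part reads [x_j = Q1 * f] with [f] a polynomial
    in [x_i]. By total degree, [f] is constant. *)
Lemma jung_end2 S S' (i j : 'I_2) : i != j -> inverse2 S S' -> tnth S i = 'X_i ->
  exists c u, [/\ c != 0, tnth S j = c *: 'X_j + u & degv j u = 0%N].
Proof.
move=> ij [SS' S'S] Si; set Q := tnth S j; set q := tnth S' j.
have qQ : q \mPo S = 'X_j by apply: S'S.
have Q0 : Q != 0.
  by apply/eqP => e; have := SS' j; rewrite -/Q e comp_mpoly0 => /esym/eqP; rewrite (negPf (X_neq0 _ _)).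
have q0 : q != 0.
  by apply/eqP => e; move: qQ; rewrite e comp_mpoly0 => /esym/eqP; rewrite (negPf (X_neq0 _ _)).
have [e he e0] := wtop_exists (del j) Q0.
have [l hl l0] := wtop_exists (del j) q0.
have epos : 0 <= e by have [m _ <-] := wcmp_supp e0; rewrite wt_del.
have lpos : 0 <= l by have [m _ <-] := wcmp_supp l0; rewrite wt_del.
pose v k : int := if k == j then e else 0.
have vj : v j = e by rewrite /v eqxx.
have vi : v i = 0 by rewrite /v (negPf ij).
have wtv m : wt v m = e * wt (del j) m.
  by rewrite (wt2 _ _ ij) vi vj wt_del mul0rn add0r -mulr_natr natz.
set Q1 := wcmp (del j) e Q in e0.
pose A := [tuple if k == j then Q1 else 'X_i | k < 2].
have [] := @wtop_comp K 2 2 v (del j) S A q (e * l).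
- move=> k; rewrite tnth_mktuple; have [->|->] := I2_cases k ij.
    rewrite vi Si (negPf ij); have <- : wt (del j) U_(i)%MM = 0 by rewrite wtU /del (negPf ij).
    exact: wtopX.
  by rewrite eqxx vj.
- by move=> m /hl h; rewrite wtv ler_wpM2l.
rewrite qQ => hX top.
have {}epos : 0 < e.
  rewrite lt_neqAle epos andbT; apply/eqP => ez; rewrite -ez mul0r in hX.
  have := hX U_(j)%MM; rewrite msuppX inE eqxx => /(_ isT).
  by rewrite wtU /del eqxx.
pose G := wcmp (del j) l q.
have GE : wcmp v (e * l) q = G.
  by apply/mpolyP => m; rewrite !mcoeff_wcmp wtv (inj_eq (mulfI (lt0r_neq0 epos))).
have [n nE] : exists n : nat, l = n by exists `|l|%N; rewrite gez0_abs.
pose f := \sum_(m <- msupp G) G@_m *: 'X_i ^+ m i : {mpoly K[2]}.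
have Gsup m : m \in msupp G -> m j = n.
  rewrite mcoeff_msupp mcoeff_wcmp wt_del nE; case: (eqVneq (m j)%:Z n) => [[//]|_].
  by rewrite eqxx.
have Gcomp (B : 2.-tuple {mpoly K[2]}) : tnth B i = 'X_i -> G \mPo B = tnth B j ^+ n * f.
  move=> Bi; rewrite comp_mpolyEX /f big_distrr /=; apply: eq_big_seq => m mG.
  by rewrite (X2E K m ij) rmorphM !rmorphXn /= !comp_mpolyXt Bi (Gsup _ mG) -scalerAr mulrC.
have f0 : f != 0.
  apply: contraNneq l0 => fz; have := Gcomp [tuple 'X_k | k < 2]; rewrite fz mulr0 => <-.
    by rewrite comp_mpoly_id.
  by rewrite tnth_mktuple.
rewrite GE Gcomp ?tnth_mktuple ?(negPf ij) ?eqxx // in top.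
have : wcmp (del j) (e * l) 'X_j != 0 :> {mpoly K[2]}.
  by rewrite top mulf_eq0 expf_eq0 (negPf f0) (negPf e0) andbF.
move/wcmp_supp => [m']; rewrite msuppX inE => /eqP->; rewrite wtU /del eqxx => el.
have {}el : e * l = 1 by rewrite -el.
have [k kE] : exists k : nat, e = k by exists `|e|%N; rewrite gez0_abs // ltW.
have : (k * n = 1)%N by move: el; rewrite kE nE; case.
move/eqP; rewrite muln_eq1 => /andP[/eqP k1 /eqP n1].
have e1 : e = 1 by rewrite kE k1.
have XE : 'X_j = Q1 * f.
  have -> : Q1 * f = Q1 ^+ n * f by rewrite n1.
  rewrite -top el.
  apply/mpolyP => m; rewrite mcoeff_wcmp mcoeffX; have [<-|//] := eqVneq U_(j)%MM m; last by rewrite if_same.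
  by rewrite wtU /del eqxx.
have [m1 m1Q m1w] := wcmp_supp e0; rewrite wt_del e1 in m1w.
have sQ1 : (2 <= msize Q1)%N.
  have : m1 \in msupp Q1 by rewrite mcoeff_msupp mcoeff_wcmp wt_del e1 m1w eqxx -mcoeff_msupp.
  move/msize_mdeg_lt; apply: leq_ltn_trans; rewrite mdegE (bigD1 j) //=; case: m1w => ->.
  exact: leq_addr.
have sf : (msize f <= 1)%N.
  have := msizeM e0 f0; rewrite -XE msizeX mdeg1.
  have : (0 < msize f)%N by rewrite lt0n msize_poly_eq0.
  move: sQ1; move: (msize Q1) (msize f) => x y; clear; lia.
have fE := msize1_polyC sf.
set c := f@_0%MM in fE.
have c0 : c != 0 by apply: contraNneq f0 => cz; rewrite fE cz mpolyC0.
exists c^-1, (Q - Q1); split; first by rewrite invr_eq0.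
  suff -> : c^-1 *: 'X_j = Q1 by rewrite addrC subrK.
  by rewrite XE fE mulrC mul_mpolyC scalerA mulVf // scale1r.
apply/eqP; rewrite -leqn0; apply: degv_le => m.
by move/(wcmp_split he); rewrite wt_del e1.
Qed.

End Aut2.

(** * Dimension of images of polynomial maps *)

Section AlgDep.
Local Open Scope classical_set_scope.
Variables (K : fieldType) (m e : nat).

Lemma more_rows (r c : nat) (A : 'M[K]_(r, c)) : (c < r)%N -> exists2 u : 'rV[K]_r, u != 0 & u *m A = 0.
Proof.
move=> lt; have : kermx A != 0.
  by rewrite -mxrank_eq0 mxrank_ker subn_eq0 -ltnNge; apply: leq_ltn_trans (rank_leq_col _) lt.
by case/rowV0Pn => u /sub_kermxP uA u0; exists u.
Qed.

Lemma mdeg_msupp_exp (d : nat) (g : e.-tuple {mpoly K[m]}) N (a : 'I_e -> nat) :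
  (forall i, (msize (tnth g i) <= d.+1)%N) -> (forall i, (a i <= N)%N) ->
  (msize (\prod_i tnth g i ^+ a i) <= (e * N * d).+1)%N.
Proof.
move=> hg ha.
have hX (q : {mpoly K[m]}) k : (msize q <= d.+1)%N -> (msize (q ^+ k) <= (k * d).+1)%N.
  move=> hq; elim: k => [|k IH]; first by rewrite expr0 msize1.
  have [->|q0] := eqVneq q 0; first by rewrite exprS mul0r msize0.
  rewrite exprS msizeM ?expf_neq0 // mulSn; move: hq IH; move: (msize (q ^+ k)) (msize q) (k * d)%N => x y z; clear; lia.
have : (msize (\prod_i tnth g i ^+ a i) <= (\sum_(i < e) N * d).+1)%N.
  elim/big_rec2: _ => [|i k q _ IH]; first by rewrite msize1.
  have [->|q0] := eqVneq q 0; first by rewrite mulr0 msize0.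
  have [->|g0] := eqVneq (tnth g i ^+ a i) 0; first by rewrite mul0r msize0.
  have h1 : (msize (tnth g i ^+ a i) <= (N * d).+1)%N.
    by apply: leq_trans (hX _ _ (hg i)) _; rewrite ltnS leq_mul2r ha orbT.
  rewrite msizeM //; move: h1 IH; move: (msize q) (msize _) (N * d)%N => x y z; clear; lia.
by rewrite sum_nat_const card_ord mulnA.
Qed.

Lemma alg_dep (g : e.-tuple {mpoly K[m]}) : (m < e)%N -> exists2 Q : {mpoly K[e]}, Q != 0 & Q \mPo g = 0.
Proof.
move=> me.
pose d := (\max_(i < e) msize (tnth g i))%N.
have hd i : (msize (tnth g i) <= d.+1)%N by apply: leq_trans (leqnSn _); apply: leq_bigmax.
(* Products of powers of the [g_i] with exponents at most [N] only involve exponents up to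
   [M = e N d], and [M + 1 <= C (N + 1)]. With [N = C ^ m], [(M + 1) ^ m <= N (N + 1) ^ m < (N + 1)
   ^ e]: there are more products than coefficients, hence a linear relation. *)
pose C := (e * d).+1; pose N := (C ^ m)%N; pose M := (e * N * d)%N.
pose I := {ffun 'I_e -> 'I_N.+1}; pose J := {ffun 'I_m -> 'I_M.+1}.
have card : (#|{: J}| < #|{: I}|)%N.
  rewrite !card_ffun !card_ord.
  have h1 : (M.+1 <= C * N.+1)%N by rewrite /M /C; nia.
  have h2 : (M.+1 ^ m <= C ^ m * N.+1 ^ m)%N.
    by rewrite -expnMn; elim: (m) => [|k IH]; rewrite ?expn0 // !expnS leq_mul.
  apply: leq_ltn_trans h2 _; apply: (@leq_trans (N.+1 ^ m.+1)).
    by rewrite expnS ltn_mul2r expn_gt0 /= ltnSn.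
  by rewrite leq_exp2l //; rewrite ltnS /N expn_gt0.
pose mon (i : I) : 'X_{1..e} := [multinom (i k : nat) | k < e].
pose mon' (j : J) : 'X_{1..m} := [multinom (j k : nat) | k < m].
pose A := \matrix_(i < #|{: I}|, j < #|{: J}|)
  ('X_[mon (enum_val i)] \mPo g)@_(mon' (enum_val j)).
have [u u0 uA] := more_rows A card.
pose Q := \sum_(i < #|{: I}|) u 0 i *: 'X_[mon (enum_val i)].
have mon_inj : injective mon.
  move=> i i' /mnmP h; apply/ffunP => k; apply: val_inj.
  by have := h k; rewrite !mnmE.
exists Q.
  apply: contraNneq u0 => Q0; apply/eqP/rowP => i; rewrite mxE.
  have := congr1 (fun q : {mpoly K[e]} => q@_(mon (enum_val i))) Q0.
  rewrite mcoeff0 raddf_sum (bigD1 i) //= mcoeffZ mcoeffX eqxx mulr1 big1 ?addr0 // => k ki.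
  rewrite mcoeffZ mcoeffX; case: eqP => [/mon_inj/enum_val_inj e'|_]; last by rewrite mulr0.
  by rewrite e' eqxx in ki.
have -> : Q \mPo g = \sum_(i < #|{: I}|) u 0 i *: ('X_[mon (enum_val i)] \mPo g).
  by rewrite raddf_sum; apply: eq_bigr => i _ /=; rewrite comp_mpolyZ.
apply/mpolyP => a; rewrite mcoeff0 raddf_sum /=.
have [/forallP small|] := boolP [forall k, (a k <= M)%N].
  pose j : J := [ffun k => inord (a k)].
  have -> : a = mon' j by apply/mnmP => k; rewrite mnmE ffunE inordK ?ltnS.
  have := congr1 (fun B : 'M_(_, _) => B 0 (enum_rank j)) uA.
  rewrite !mxE => h; rewrite -[RHS]h; apply: eq_bigr => i _.
  by rewrite mxE enum_rankK mcoeffZ.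
rewrite negb_forall => /existsP[k]; rewrite -ltnNge => big.
rewrite big1 // => i _; rewrite mcoeffZ comp_mpolyX.
rewrite [X in _ * X]memN_msupp_eq0 ?mulr0 //; apply/negP => /msize_mdeg_lt h.
have : (mdeg a < (e * N * d).+1)%N.
  apply: leq_trans h _; apply: mdeg_msupp_exp => // l.
  by rewrite mnmE -ltnS ltn_ord.
rewrite ltnS leqNgt; case/negP; apply: leq_trans big _.
by rewrite mdegE (bigD1 k) //= leq_addr.
Qed.

End AlgDep.

Section Upper.
Local Open Scope classical_set_scope.
Variables (K : fieldType) (p : nat).
Local Notation V := (affine_space K p).
Implicit Types (v : V) (q : {mpoly K[p]}) (Z : set V).

Definition in_image m (pi : 'I_p -> {mpoly K[m]}) (D : {mpoly K[m]}) (v : V) :=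
  exists t : 'I_m -> K, D.@[t] != 0 /\ forall j, (v : 'rV[K]_p) 0 j = (pi j).@[t].

Definition pval q (v : V) : K := q.@[(v : 'rV[K]_p) 0].

Lemma closed_pval q : closed [set v | pval q v = 0].
Proof.
apply/zariski_closedP; exists [set q]; apply/seteqP; split=> v /=; first by move=> h _ ->.
exact.
Qed.

Lemma closure_min (A C : set V) : closed C -> A `<=` C -> closure A `<=` C.
Proof. by move=> cC AC; rewrite closureE; apply: smallest_sub. Qed.

Lemma closed_sep Z v : closed Z -> ~ Z v ->
  exists q, (forall u, Z u -> pval q u = 0) /\ pval q v != 0.
Proof.
move=> /zariski_closedP[S ->] /existsNP[q /not_implyP[Sq /eqP qv]].
by exists q; split=> // u; apply.
Qed.

Lemma irreducible_mul Z q r : irreducible Z -> (exists2 u, Z u & pval q u != 0) ->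
  (exists2 u, Z u & pval r u != 0) -> exists2 u, Z u & pval (q * r) u != 0.
Proof.
move=> [_ irr] [u Zu qu] [w Zw rw]; apply: contrapT => no.
have [] := irr _ _ (@closed_pval q) (@closed_pval r).
- move=> z Zz; have : pval (q * r) z = 0.
    by apply/eqP; apply: contrapT => /negP h; apply: no; exists z.
  by rewrite /pval mevalM => /eqP; rewrite mulf_eq0 => /orP[/eqP|/eqP]; [left|right].
- by move=> /(_ u Zu) /eqP; apply/negP.
- by move=> /(_ w Zw) /eqP; apply/negP.
Qed.

Lemma irreducible_fin Z (I : finType) (C : I -> set V) : irreducible Z ->
  (forall i, closed (C i)) -> (forall v, Z v -> exists i, C i v) -> exists i, Z `<=` C i.
Proof.
move=> [[v0 Zv0] irr] hC hZ.
have main (s : seq I) : (forall v, Z v -> exists2 i, i \in s & C i v) -> exists i, Z `<=` C i.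
  elim: s => [|i s IH] h; first by have [] := h v0 Zv0.
  pose B := [set v | exists2 j, j \in s & C j v].
  have cB : closed B.
    have -> : B = \bigcup_(j in [set` s]) C j.
      by apply/seteqP; split=> v /= [j js Cj]; exists j.
    by apply: closed_bigcup => //; exact: finite_seq.
  have [|h1|h2] := irr (C i) B (hC i) cB.
  - move=> v /h[j]; rewrite inE => /orP[/eqP->|js Cj]; first by left.
    by right; exists j.
  - by exists i.
  - by apply: IH => v /h2.
by apply: (main (enum I)) => v /hZ[i Ci]; exists i => //; rewrite mem_enum.
Qed.

(** [Q] is expanded in its last variable, to be replaced by the last [h]. A nonzero constant term is
    handled by induction one step lower in the chain, where that [h] vanishes. Otherwise the
    variable is factored out, and irreducibility of the top set keeps the product from vanishing on
    it. *)
Lemma chain_indep e (F : nat -> set V) (h : nat -> {mpoly K[p]}) :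
  (forall j, (j <= e)%N -> irreducible (F j)) ->
  (forall j, (j < e)%N -> [/\ forall v, F j v -> pval (h j) v = 0,
      exists2 v, F j.+1 v & pval (h j) v != 0 & F j `<=` F j.+1]) ->
  forall Q : {mpoly K[e]}, Q != 0 ->
  exists2 v, F e v & pval (Q \mPo [tuple h i | i < e]) v != 0.
Proof.
elim: e => [|e IH] irr hh Q Q0.
  have [[v Fv] _] := irr 0%N isT; exists v => //.
  have -> : Q = (Q@_0%MM)%:MP.
    apply/mpolyP => m; rewrite mcoeffC; have -> : m = 0%MM by apply/mnmP => -[].
    by rewrite eqxx mulr1.
  rewrite /pval comp_mpolyC mevalC; apply: contraNneq Q0 => z.
  apply/eqP/mpolyP => m; rewrite mcoeff0 -z; congr mcoeff; apply/mnmP => -[].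
  by [].
pose H := [tuple h i | i < e.+1].
have He : tnth H ord_max = h e by rewrite tnth_mktuple.
have [h0 h1 h2] := hh e (ltnSn e).
have low (s : {mpoly K[e]}) : incl s \mPo H = s \mPo [tuple h i | i < e].
  rewrite /incl comp_mpolyA; congr (_ \mPo _); apply: eq_from_tnth => i.
  rewrite !tnth_mktuple comp_mpolyXU -tnth_nth tnth_mktuple; congr (h _).
  by rewrite lift_max.
have [N] := ubnP (msize Q); elim: N Q Q0 => // N IHN Q Q0 sQ.
have [r [QE _]] := tau_split Q.
have QH : Q \mPo H = (sig Q \mPo [tuple h i | i < e]) + h e * (r \mPo H).
  by rewrite {1}QE rmorphD rmorphM /= low comp_mpolyXU -tnth_nth He.
have [s0|s0] := eqVneq (sig Q) 0; last first.
  have [||v Fv hv] := IH _ _ (sig Q) s0.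
  - by move=> j je; apply: irr; apply: leqW.
  - by move=> j je; apply: hh; apply: leqW.
  exists v; first exact: h2.
  by rewrite -/H QH /pval mevalD mevalM -/(pval (h e) v) (h0 _ Fv) mul0r addr0.
have r0 : r != 0 by apply: contraNneq Q0 => r0; rewrite QE s0 r0 mulr0 rmorph0 addr0.
have QE' : Q = 'X_ord_max * r by rewrite QE s0 rmorph0 add0r.
have X0 : 'X_ord_max != 0 :> {mpoly K[e.+1]} by rewrite -msize_poly_eq0 msizeX.
have sr : (msize r < N)%N.
  by move: sQ; rewrite QE' msizeM // msizeX mdeg1 add2n /= ltnS.
have hr := IHN r r0 sr.
have [v Fv hv] := irreducible_mul (irr e.+1 (leqnn _)) h1 hr.
by exists v => //; rewrite -/H QH s0 comp_mpoly0 add0r.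
Qed.

(** The irreducible top of the chain lies in the closure of a single image, these being finitely
    many. If [m i < e], the polynomials separating the members of the chain become algebraically
    dependent when pulled back to the [m i] parameters. *)
Lemma dim_upper (I : finType) (m : I -> nat) (pi : forall i, 'I_p -> {mpoly K[m i]})
  (D : forall i, {mpoly K[m i]}) (X : set V) N :
  (forall i, (m i <= N)%N) -> (forall v, X v -> exists i, in_image (pi i) (D i) v) ->
  forall e F, irreducible_chain (closure X) e F -> (e <= N)%N.
Proof.
move=> mN hX e F [hF1 hF2].
pose C i := closure [set v | in_image (pi i) (D i) v].
have hC i : closed (C i) by apply: closed_closure.
have XC : closure X `<=` [set v | exists i, C i v].
  have -> : [set v | exists i, C i v] = \bigcup_(i in [set` enum I]) C i.
    apply/seteqP; split=> v /=; first by move=> [i Ci]; exists i => //=; rewrite mem_enum.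
    by move=> [i _ Ci]; exists i.
  apply: closure_min.
    by apply: closed_bigcup => //; exact: finite_seq.
  by move=> v /hX[i hi]; exists i; [rewrite /= mem_enum|apply: subset_closure].
have [cFe iFe FeX] := hF1 e (leqnn e).
have [i Fi] := irreducible_fin iFe hC (fun v h => XC v (FeX v h)).
have sel : forall j, exists q, (j < e)%N ->
    (forall v, F j v -> pval q v = 0) /\ exists2 v, F j.+1 v & pval q v != 0.
  move=> j; have [je|_] := ltnP j e; last by exists 0.
  have [cF _ _] := hF1 j (ltnW je); have [sub nsub] := hF2 j je.
  have /existsNP[v /not_implyP[F1 F0]] := nsub.
  by have [q [hq qv]] := closed_sep cF F0; exists q => _; split=> //; exists v.
have [h hh] := choice sel.
rewrite leqNgt; apply/negP => Ne.
have mie : (m i < e)%N by apply: leq_ltn_trans Ne.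
pose g := [tuple h j \mPo [tuple pi i k | k < p] | j < e].
have [Q Q0 Qg] := alg_dep g mie.
have [||v Fv hv] := @chain_indep e F h _ _ Q Q0.
- by move=> j je; case: (hF1 j je).
- move=> j je; have [hj1 hj2] := hh j je; split=> //; exact: (hF2 j je).1.
case/eqP: hv; have : C i v by apply: Fi.
apply: (closure_min (@closed_pval (Q \mPo [tuple h i | i < e]))).
move=> u [t [_ ut]] /=; rewrite /pval.
have -> : ((Q \mPo [tuple h i | i < e]).@[(u : 'rV[K]_p) 0]) = (Q \mPo g).@[t].
  have -> : (Q \mPo g) = (Q \mPo [tuple h i | i < e]) \mPo [tuple pi i k | k < p].
    rewrite comp_mpolyA; congr (_ \mPo _); apply: eq_from_tnth => j.
    by rewrite !tnth_mktuple.
  rewrite [RHS]comp_mpoly_meval; apply: meval_eq => k.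
  by rewrite tnth_mktuple ut.
by rewrite Qg meval0.
Qed.

End Upper.

(** * Constructible sets *)

Section ConstrTop.
Local Open Scope classical_set_scope.
Variable T : topologicalType.
Implicit Types A B : set T.

Lemma constructible_fin (I : finType) (U C : I -> set T) :
  (forall i, open (U i)) -> (forall i, closed (C i)) ->
  constructible (\bigcup_i (U i `&` C i)).
Proof.
move=> hU hC; exists #|I|, (fun j => U (enum_val j)), (fun j => C (enum_val j)).
split=> [j|j|]; [exact: hU|exact: hC|].
apply/seteqP; split=> x [i _ h]; last by exists (enum_val i).
by exists (enum_rank i) => //; rewrite enum_rankK.
Qed.

Lemma constructible_bigcup (I : finType) (A : I -> set T) :
  (forall i, constructible (A i)) -> constructible (\bigcup_i A i).
Proof.
move=> hA; have {hA} : forall i, exists x : {m : nat & (('I_m -> set T) * ('I_m -> set T))%type},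
    [/\ forall j, open ((tagged x).1 j), forall j, closed ((tagged x).2 j)
      & A i = \bigcup_j ((tagged x).1 j `&` (tagged x).2 j)].
  by move=> i; have [m [U [C h]]] := hA i; exists (existT _ m (U, C)).
move/choice => [F hF].
pose J := {i : I & 'I_(tag (F i))}.
pose U (j : J) := (tagged (F (tag j))).1 (tagged j).
pose C (j : J) := (tagged (F (tag j))).2 (tagged j).
have -> : \bigcup_i A i = \bigcup_(j : J) (U j `&` C j).
  apply/seteqP; split=> x.
    move=> [i _]; have [_ _ ->] := hF i; move=> [j _ h].
    by exists (existT _ i j).
  move=> [[i j] _ h]; exists i => //; have [_ _ ->] := hF i.
  by exists j.
by apply: constructible_fin => -[i j]; have [h1 h2 _] := hF i; [apply: h1|apply: h2].
Qed.

Lemma constructible_lc A B : open A -> closed B -> constructible (A `&` B).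
Proof.
move=> oA cB; have -> : A `&` B = \bigcup_(i : 'I_1) (A `&` B).
  by apply/seteqP; split=> x; [move=> h; exists ord0|case].
exact: constructible_fin.
Qed.

Lemma constructible_open A : open A -> constructible A.
Proof. by move=> oA; rewrite -[A]setIT; apply: constructible_lc => //; exact: closedT. Qed.

Lemma constructible_closed A : closed A -> constructible A.
Proof. by move=> oA; rewrite -[A]setTI; apply: constructible_lc => //; exact: openT. Qed.

Lemma constructibleU A B : constructible A -> constructible B -> constructible (A `|` B).
Proof.
move=> cA cB; have -> : A `|` B = \bigcup_(b : bool) (if b then A else B).
  apply/seteqP; split=> x; first by move=> [h|h]; [exists true|exists false].
  by move=> [[] _ h]; [left|right].
by apply: constructible_bigcup => -[].
Qed.

Lemma constructibleI A B : constructible A -> constructible B -> constructible (A `&` B).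
Proof.
move=> [m [U [C [oU cC ->]]]] [m' [U' [C' [oU' cC' ->]]]].
have -> : (\bigcup_i (U i `&` C i)) `&` (\bigcup_i (U' i `&` C' i)) =
  \bigcup_(j : 'I_m * 'I_m') ((U j.1 `&` U' j.2) `&` (C j.1 `&` C' j.2)).
  apply/seteqP; split=> x.
    by move=> [[i _ [h1 h2]] [i' _ [h3 h4]]]; exists (i, i').
  by move=> [[i i'] _ [[h1 h2] [h3 h4]]]; split; [exists i|exists i'].
apply: constructible_fin => -[i i'] /=; [exact: openI|exact: closedI].
Qed.

Lemma constructibleC A : constructible A -> constructible (~` A).
Proof.
move=> [m [U [C [oU cC ->]]]].
have hs (s : seq 'I_m) : constructible (~` (\bigcup_(i in [set` s]) (U i `&` C i))).
  elim: s => [|i s IH].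
    have -> : \bigcup_(i in [set` [::]]) (U i `&` C i) = set0.
      by apply/seteqP; split=> x // [].
    by rewrite setC0; apply: constructible_open; exact: openT.
  have -> : ~` (\bigcup_(j in [set` i :: s]) (U j `&` C j)) =
     (~` U i `|` ~` C i) `&` ~` (\bigcup_(j in [set` s]) (U j `&` C j)).
    rewrite -setCI -setCU; congr (~` _); apply/seteqP; split=> x.
      move=> [j /=]; rewrite inE => /orP[/eqP->|js] h; first by left.
      by right; exists j.
    by move=> [h|[j js h]]; [exists i|exists j] => //=; rewrite inE ?eqxx // [_ \in _]js orbT.
  apply: constructibleI => //; apply: constructibleU.
    by apply: constructible_closed; rewrite closedC.
  by apply: constructible_open; rewrite openC.
have -> : \bigcup_i (U i `&` C i) = \bigcup_(i in [set` enum 'I_m]) (U i `&` C i).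
  by apply/seteqP; split=> x [i _ h]; exists i => //=; rewrite mem_enum.
exact: hs.
Qed.

End ConstrTop.

(** * Images of polynomial maps are constructible *)

Section Chevalley.
Local Open Scope classical_set_scope.
Variables (K : closedFieldType) (p : nat).
Local Notation V := (affine_space K p).
Implicit Types v : V.

Definition env (v : V) : seq K := [seq (v : 'rV[K]_p) 0 j | j <- enum 'I_p].

Lemma env_nth v (j : 'I_p) : (env v)`_j = (v : 'rV[K]_p) 0 j.
Proof. by rewrite (nth_map j) ?size_enum_ord // nth_ord_enum. Qed.

Lemma size_env v : size (env v) = p.
Proof. by rewrite size_map size_enum_ord. Qed.

Lemma rterm_pval (t : GRing.term K) : GRing.rterm t ->
  exists q : {mpoly K[p]}, forall v, GRing.eval (env v) t = pval q v.
Proof.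
elim: t => //=.
- move=> i _; have [ip|pi] := ltnP i p.
    exists 'X_(Ordinal ip) => v; rewrite /pval mevalXU.
    exact: (env_nth v (Ordinal ip)).
  (* Variables outside the environment evaluate to the default 0. *)
  by exists 0 => v; rewrite /pval meval0 nth_default // size_env.
- by move=> c _; exists c%:MP => v; rewrite /pval mevalC.
- by move=> k _; exists (k%:R) => v; rewrite /pval rmorph_nat.
- by move=> t IHt s IHs /andP[/IHt[q hq] /IHs[r hr]]; exists (q + r) => v; rewrite /pval mevalD hq hr.
- by move=> t IHt /IHt[q hq]; exists (- q) => v; rewrite /pval mevalN hq.
- by move=> t IHt k /IHt[q hq]; exists (q *+ k) => v; rewrite /pval mevalMn hq.
- by move=> t IHt s IHs /andP[/IHt[q hq] /IHs[r hr]]; exists (q * r) => v; rewrite /pval mevalM hq hr.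
- by move=> t IHt k /IHt[q hq]; exists (q ^+ k) => v; rewrite /pval rmorphXn /= hq.
Qed.

Lemma constructible_qf (f : GRing.formula K) : GRing.qf_form f && GRing.rformula f ->
  constructible [set v | GRing.qf_eval (env v) f].
Proof.
elim: f => //=.
- move=> b _; case: b; last first.
    have -> : [set v : V | false] = set0 by apply/seteqP; split=> v.
    by apply: constructible_closed; exact: closed0.
  have -> : [set v : V | true] = setT by apply/seteqP.
  by apply: constructible_open; exact: openT.
- move=> t s /andP[/rterm_pval[q hq] /rterm_pval[r hr]].
  have -> : [set v | GRing.eval (env v) t == GRing.eval (env v) s] = [set v | pval (q - r) v = 0].
    apply/seteqP; split=> v /=; rewrite hq hr /pval mevalB.
      by move/eqP->; rewrite subrr.
    by move/eqP; rewrite subr_eq0.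
  by apply: constructible_closed; exact: closed_pval.
- move=> f IHf g IHg /andP[/andP[qf qg] /andP[rf rg]].
  have -> : [set v | GRing.qf_eval (env v) f && GRing.qf_eval (env v) g] =
     [set v | GRing.qf_eval (env v) f] `&` [set v | GRing.qf_eval (env v) g].
    by apply/seteqP; split=> v /=; [move/andP|move=> [-> ->]].
  by apply: constructibleI; [apply: IHf|apply: IHg]; apply/andP.
- move=> f IHf g IHg /andP[/andP[qf qg] /andP[rf rg]].
  have -> : [set v | GRing.qf_eval (env v) f || GRing.qf_eval (env v) g] =
     [set v | GRing.qf_eval (env v) f] `|` [set v | GRing.qf_eval (env v) g].
    by apply/seteqP; split=> v /=; [move/orP|move=> [->|->] //; rewrite orbT].
  by apply: constructibleU; [apply: IHf|apply: IHg]; apply/andP.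
- move=> f IHf g IHg /andP[/andP[qf qg] /andP[rf rg]].
  have -> : [set v | GRing.qf_eval (env v) f ==> GRing.qf_eval (env v) g] =
     ~` [set v | GRing.qf_eval (env v) f] `|` [set v | GRing.qf_eval (env v) g].
    apply/seteqP; split=> v /=.
      move/implyP => h; case: (boolP (GRing.qf_eval (env v) f)) => [/h|/negP]; first by right.
      by left.
    by move=> [nf|->]; [apply/implyP => /nf|rewrite implybT].
  by apply: constructibleU; [apply: constructibleC; apply: IHf|apply: IHg]; apply/andP.
- move=> f IHf h.
  have -> : [set v | ~~ GRing.qf_eval (env v) f] = ~` [set v | GRing.qf_eval (env v) f].
    by apply/seteqP; split=> v /=; move/negP.
  by apply: constructibleC; apply: IHf.
Qed.

(** In formulas, the variables below [p] are the coordinates of the point and those from [p] on are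
    the parameters, hence the shift. *)
Definition mterm m (q : {mpoly K[m]}) : GRing.term K :=
  foldr (fun a t => GRing.Add (GRing.Mul (GRing.Const q@_a)
     (foldr (fun i s => GRing.Mul (GRing.Exp (GRing.Var K (p + (i : 'I_m))) ((a : 'X_{1..m}) i)) s)
        (GRing.Const 1) (enum 'I_m))) t)
    (GRing.Const 0) (msupp q).

Lemma rterm_mterm m (q : {mpoly K[m]}) : GRing.rterm (mterm q).
Proof.
rewrite /mterm; elim: (msupp q) => //= a s ->; rewrite andbT.
by elim: (enum 'I_m).
Qed.

Lemma eval_mterm m (q : {mpoly K[m]}) (e : seq K) :
  GRing.eval e (mterm q) = q.@[fun i : 'I_m => e`_(p + i)].
Proof.
rewrite mevalE /mterm; elim: (msupp q) => [|a s IH] /=; first by rewrite big_nil.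
rewrite big_cons IH; congr (_ * _ + _).
rewrite -big_enum /=; elim: (enum 'I_m) => [|i r IHr] /=; first by rewrite big_nil.
by rewrite big_cons IHr.
Qed.

Definition image_body m (pi : 'I_p -> {mpoly K[m]}) (D : {mpoly K[m]}) : GRing.formula K :=
  foldr (fun j f => GRing.And (GRing.Equal (GRing.Var K (j : 'I_p)) (mterm (pi j))) f)
    (GRing.Not (GRing.Equal (mterm D) (GRing.Const 0))) (enum 'I_p).

Lemma image_bodyP m (pi : 'I_p -> {mpoly K[m]}) D (e : seq K) :
  GRing.holds e (image_body pi D) <->
  D.@[fun i : 'I_m => e`_(p + i)] != 0 /\ forall j : 'I_p, e`_j = (pi j).@[fun i : 'I_m => e`_(p + i)].
Proof.
have gen (s : seq 'I_p) : GRing.holds e (foldr (fun j f => GRing.And (GRing.Equal (GRing.Var K (j : 'I_p)) (mterm (pi j))) f)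
    (GRing.Not (GRing.Equal (mterm D) (GRing.Const 0))) s) <->
   D.@[fun i : 'I_m => e`_(p + i)] != 0 /\ forall j : 'I_p, j \in s -> e`_j = (pi j).@[fun i : 'I_m => e`_(p + i)].
  elim: s => [|j s IH] /=; first by rewrite eval_mterm; split=> [/eqP|[/eqP]].
  rewrite IH eval_mterm; split=> [[h1 [h2 h3]]|[h1 h2]]; split=> //.
  - by move=> k; rewrite inE => /orP[/eqP->|/h3].
  - by apply: h2; rewrite inE eqxx.
  - by split=> // k ks; apply: h2; rewrite inE ks orbT.
rewrite /image_body gen; split=> -[h1 h2]; split=> // j; first by apply: h2; rewrite mem_enum.
Qed.

Lemma constructible_image m (pi : 'I_p -> {mpoly K[m]}) (D : {mpoly K[m]}) :
  constructible [set v | in_image pi D v].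
Proof.
pose f := foldr GRing.Exists (image_body pi D) (iota p m).
have rf : GRing.rformula f.
  have : GRing.rformula (image_body pi D).
    rewrite /image_body; elim: (enum 'I_p) => [|j s IH] /=; first by rewrite rterm_mterm.
    by rewrite rterm_mterm.
  by rewrite /f; elim: (iota p m).
pose g := GRing.quantifier_elim (@ClosedFieldQE.ex_elim K) f.
have wf := @GRing.quantifier_elim_wf K _ (@ClosedFieldQE.wf_ex_elim K) f rf.
suff -> : [set v | in_image pi D v] = [set v | GRing.qf_eval (env v) g] by apply: constructible_qf.
have QE v := @GRing.quantifier_elim_rformP K _ (@ClosedFieldQE.wf_ex_elim K)
  (@ClosedFieldQE.holds_ex_elim K (@GRing.solve_monicpoly K)) (env v) f rf.
apply/seteqP; split=> v /=.
  move=> [t [Dt vt]]; apply/QE/GRing.foldExistsP.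
  pose e := env v ++ [seq t i | i <- enum 'I_m].
  have et (i : 'I_m) : e`_(p + i) = t i.
    rewrite nth_cat size_env ltnNge leq_addr /= addKn (nth_map i) ?size_enum_ord //.
    by rewrite nth_ord_enum.
  exists e.
    move=> i; rewrite inE mem_iota negb_and -ltnNge -leqNgt => h.
    rewrite nth_cat size_env; case: ltnP => // pi'.
    rewrite nth_default ?size_env // nth_default // size_map size_enum_ord.
    by move: h; rewrite ltnNge pi' /= leq_subRL.
  apply/image_bodyP; rewrite (meval_eq _ et); split=> // j; rewrite (meval_eq _ et) -vt -env_nth.
  by rewrite nth_cat size_env ltn_ord.
move/QE/GRing.foldExistsP => [e he /image_bodyP[De hj]].
exists (fun i : 'I_m => e`_(p + i)); split=> // j; rewrite -hj -env_nth he //.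
by rewrite inE mem_iota negb_and -ltnNge ltn_ord.
Qed.

Lemma constructible_images (I : finType) (m : I -> nat) (pi : forall i, 'I_p -> {mpoly K[m i]})
  (D : forall i, {mpoly K[m i]}) (X : set V) :
  (forall v, X v <-> exists i, in_image (pi i) (D i) v) -> constructible X.
Proof.
move=> hX; have -> : X = \bigcup_i [set v | in_image (pi i) (D i) v].
  by apply/seteqP; split=> v; [move/hX => [i h]; exists i|move=> [i _ h]; apply/hX; exists i].
by apply: constructible_bigcup => i; apply: constructible_image.
Qed.

End Chevalley.

(** * Chains of irreducible closed sets *)

Section Lower.
Local Open Scope classical_set_scope.
Variables (K : closedFieldType) (p N : nat).
Local Notation V := (affine_space K p).
Variables (pi : 'I_p -> {mpoly K[N]}) (D : {mpoly K[N]}).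

Lemma nonroot_exists (P : {poly K}) : P != 0 -> exists s, P.[s] != 0.
Proof. by move/closed_nonrootP => [s]; exists s. Qed.

Definition seg (t1 t2 : 'I_N -> K) (s : K) (i : 'I_N) := t1 i + s * (t2 i - t1 i).

Lemma line_poly (q : {mpoly K[N]}) (t1 t2 : 'I_N -> K) :
  exists P : {poly K}, forall s, P.[s] = q.@[seg t1 t2 s].
Proof.
exists (\sum_(m <- msupp q) q@_m *: \prod_i ((t1 i)%:P + 'X * (t2 i - t1 i)%:P) ^+ m i) => s.
rewrite mevalE horner_sum; apply: eq_bigr => m _; rewrite hornerZ horner_prod.
by congr (_ * _); apply: eq_bigr => i _; rewrite horner_exp !hornerE.
Qed.

Definition ppt (t : 'I_N -> K) : V := \row_k (pi k).@[t].

Lemma pval_ppt q t : pval q (ppt t) = (q \mPo [tuple pi k | k < p]).@[t].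
Proof.
rewrite /pval comp_mpoly_meval; apply: meval_eq => k.
by rewrite tnth_mktuple mxE.
Qed.

(** If neither closed set contains the closure, two parameter points witness it by polynomials.
    These and [D] restrict to nonzero polynomials in one variable on the line through the two
    points, which lies in [W]; a common nonroot contradicts the covering. *)
Lemma irreducible_linear_image (W : set ('I_N -> K)) :
  (forall t1 t2 s, W t1 -> W t2 -> W (seg t1 t2 s)) ->
  (exists2 t, W t & D.@[t] != 0) ->
  irreducible (closure [set v | exists t, [/\ W t, D.@[t] != 0 & v = ppt t]]).
Proof.
move=> hW [t0 Wt0 D0]; set S := [set v | _]; split.
  by exists (ppt t0); apply: subset_closure; exists t0.
move=> A B cA cB hAB; apply: contrapT => /not_orP[nA nB].
have sep C : closed C -> ~ closure S `<=` C ->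
    exists q t, [/\ W t, D.@[t] != 0, forall u, C u -> pval q u = 0 & pval q (ppt t) != 0].
  move=> cC nC; have /existsNP[v /not_implyP[[t [Wt Dt ->]] nv]] : ~ S `<=` C.
    by move=> SC; apply: nC; apply: closure_min.
  by have [q [hq qv]] := closed_sep cC nv; exists q, t.
have [qA [t1 [W1 D1 zA hA]]] := sep A cA nA.
have [qB [t2 [W2 D2 zB hB]]] := sep B cB nB.
have [PD hPD] := line_poly D t1 t2.
have [PA hPA] := line_poly (qA \mPo [tuple pi k | k < p]) t1 t2.
have [PB hPB] := line_poly (qB \mPo [tuple pi k | k < p]) t1 t2.
have seg0 : seg t1 t2 0 =1 t1 by move=> i; rewrite /seg mul0r addr0.
have seg1 : seg t1 t2 1 =1 t2 by move=> i; rewrite /seg mul1r addrC subrK.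
have nz (P : {poly K}) s : P.[s] != 0 -> P != 0 by apply: contraNneq => ->; rewrite horner0.
have PD0 : PD != 0 by apply: (nz _ 0); rewrite hPD (meval_eq _ seg0).
have PA0 : PA != 0 by apply: (nz _ 0); rewrite hPA (meval_eq _ seg0) -pval_ppt.
have PB0 : PB != 0 by apply: (nz _ 1); rewrite hPB (meval_eq _ seg1) -pval_ppt.
have [|s] := @nonroot_exists (PD * (PA * PB)); first by rewrite !mulf_neq0.
rewrite !hornerM hPD hPA hPB !mulf_eq0 !negb_or -!pval_ppt => /and3P[Ds As Bs].
have /hAB : closure S (ppt (seg t1 t2 s)).
  by apply: subset_closure; exists (seg t1 t2 s); split=> //; apply: hW.
by move=> [/zA|/zB] /eqP; apply/negP.
Qed.

Variables (base : 'I_N -> K) (X : set V).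
Definition upd (j : 'I_N) (s : K) (i : 'I_N) := if i == j then s else base i.
Hypothesis D_base : D.@[base] != 0.
Hypothesis detect : forall j : 'I_N, exists (k : 'I_p) (d : K),
  (forall t : 'I_N -> K, t j = base j -> (pi k).@[t] = d) /\
  exists s, D.@[upd j s] != 0 /\ (pi k).@[upd j s] != d.
Hypothesis imX : forall t, D.@[t] != 0 -> X (ppt t).

(** [F j] leaves the parameters below [j] free and freezes the others at [base]. By [detect], some
    coordinate is constant while parameter [j] is frozen and takes another value when that parameter
    alone moves, so the inclusions are strict. *)
Lemma dim_lower : exists F, irreducible_chain (closure X) N F.
Proof.
pose W (j : nat) : set ('I_N -> K) := [set t | forall i : 'I_N, (j <= i)%N -> t i = base i].
pose F j : set V := closure [set v | exists t, [/\ W j t, D.@[t] != 0 & v = ppt t]].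
exists F; split=> [j _|j jN].
  split; first exact: closed_closure.
    apply: irreducible_linear_image.
      by move=> t1 t2 s W1 W2 i ji; rewrite /seg W1 // W2 // subrr mulr0 addr0.
    by exists base.
  by apply: closureS => v [t [_ Dt ->]]; apply: imX.
split.
  apply: closureS => v [t [Wt Dt ->]]; exists t; split=> // i ji.
  by apply: Wt; apply: ltnW.
have [k [d [h1 [s [Ds ks]]]]] := detect (Ordinal jN).
have sub : F j `<=` [set v | pval ('X_k - d%:MP) v = 0].
  apply: closure_min; first exact: closed_pval.
  move=> v [t [Wt _ ->]] /=; rewrite /pval mevalB mevalXU mevalC mxE h1 ?subrr //.
  by apply: Wt.
move=> /(_ (ppt (upd (Ordinal jN) s))) h.
have /h/sub /= : F j.+1 (ppt (upd (Ordinal jN) s)).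
  apply: subset_closure; exists (upd (Ordinal jN) s); split=> // i ji.
  by rewrite /upd; case: eqP => // e; move: ji; rewrite e ltnn.
rewrite /pval mevalB mevalXU mevalC mxE => /eqP.
by rewrite subr_eq0 (negPf ks).
Qed.

End Lower.

(** * Towers *)

(* The library equips malg over a noncommutative monoid with an lalgType
   structure only, so that centrality of scalars is carried as a hypothesis. *)
Definition central_scalars (K : pzRingType) (S : lalgType K) :=
  forall (c : K) (u v : S), c *: (u * v) = u * (c *: v).

Section Tower.
Variables (K : fieldType) (S : lalgType K).
Hypothesis sAr : central_scalars S.
Variables x y : S.
Implicit Types (f g h : S) (p q : {poly K}) (ds : seq nat).

Lemma comm_in_alg g : commr_rmorph (in_alg S) g.
Proof. by move=> c; rewrite /GRing.comm /= mulr_algl -sAr mulr1. Qed.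

(** Evaluation of a one-variable polynomial at a noncommutative element; centrality of the scalars
    makes it a ring morphism. *)
Definition pev g : {poly K} -> S := horner_morph (comm_in_alg g).

Lemma pevE g p : pev g p = \sum_(i < size p) p`_i *: g ^+ i.
Proof.
rewrite /pev /horner_morph horner_coef (size_map_poly (in_alg S)).
by apply: eq_bigr => i _; rewrite coef_map /= mulr_algl.
Qed.

Lemma pevD g p q : pev g (p + q) = pev g p + pev g q. Proof. exact: rmorphD. Qed.
Lemma pevM g p q : pev g (p * q) = pev g p * pev g q. Proof. exact: rmorphM. Qed.
Lemma pevXn g p n : pev g (p ^+ n) = pev g p ^+ n. Proof. exact: rmorphXn. Qed.
Lemma pevC g c : pev g c%:P = c *: 1. Proof. exact: horner_morphC. Qed.
Lemma pevX g : pev g 'X = g. Proof. exact: horner_morphX. Qed.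
Lemma pevZ g c p : pev g (c *: p) = c *: pev g p.
Proof. by rewrite -mul_polyC pevM pevC -scalerAl mul1r. Qed.

Lemma pev_sum g (I : Type) (r : seq I) (F : I -> {poly K}) :
  pev g (\sum_(i <- r) F i) = \sum_(i <- r) pev g (F i).
Proof.
elim: r => [|i r IH]; first by rewrite !big_nil; exact: rmorph0.
by rewrite !big_cons pevD IH.
Qed.

Lemma pev_comp g p q : pev g (p \Po q) = pev (pev g q) p.
Proof.
rewrite [RHS]pevE comp_polyE pev_sum.
by apply: eq_bigr => i _; rewrite pevZ pevXn.
Qed.

Definition affine_pair f g := exists a b c a' b' c' : K,
  [/\ a * b' - a' * b != 0, f = a *: x + b *: y + c *: 1 & g = a' *: x + b' *: y + c' *: 1].

(** The head of [ds] is the degree of the outermost step, and [f] is the component built last.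
    Degrees above 1 ensure that [h] never reaches the degree of [pev g p]. *)
Fixpoint tower ds f g := match ds with
  | [::] => affine_pair f g
  | d :: ds' => exists p h, [/\ (1 < d)%N, size p = d.+1, f = pev g p + h & tower ds' g h]
  end.

Lemma affineC f g : affine_pair f g -> affine_pair g f.
Proof.
move=> [a [b [c [a' [b' [c' [D -> ->]]]]]]]; exists a', b', c', a, b, c; split=> //.
by apply: contraNneq D => e; apply/eqP; rewrite -[LHS]opprK opprB e oppr0.
Qed.

Lemma scale3 (l a b c : K) :
  l *: (a *: x + b *: y + c *: 1) = (l * a) *: x + (l * b) *: y + (l * c) *: 1 :> S.
Proof. by rewrite !scalerDr !scalerA. Qed.

Lemma add3 (a b c a' b' c' : K) : (a *: x + b *: y + c *: 1) + (a' *: x + b' *: y + c' *: 1)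
  = (a + a') *: x + (b + b') *: y + (c + c') *: 1 :> S.
Proof. by rewrite !scalerDl addrACA [X in X + _]addrACA. Qed.

Lemma const3 (c : K) : c *: 1 = 0 *: x + 0 *: y + c *: 1 :> S.
Proof. by rewrite !scale0r !add0r. Qed.

Lemma affine_mix f g m l b e : m != 0 -> b != 0 -> affine_pair f g ->
  affine_pair (m *: f + l *: g + e *: 1) (b *: g).
Proof.
move=> m0 b0 [a1 [b1 [c1 [a2 [b2 [c2 [D -> ->]]]]]]].
rewrite !scale3 add3 [e *: 1]const3 add3.
do 6!eexists; split; [|reflexivity|reflexivity].
have -> : (m * a1 + l * a2 + 0) * (b * b2) - b * a2 * (m * b1 + l * b2 + 0)
   = m * b * (a1 * b2 - a2 * b1) by ring.
by rewrite !mulf_neq0.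
Qed.

Lemma size_addC p c : (1 < size p)%N -> size (p + c%:P) = size p.
Proof. by move=> sp; rewrite size_polyDl // size_polyC; case: (c != 0) => //=; exact: ltn_trans sp. Qed.

Lemma tower_addl ds f g c : tower ds f g -> tower ds (f + c *: 1) g.
Proof.
case: ds => [|d ds] /=.
  by move=> /(@affine_mix _ _ 1 0 1 c (oner_neq0 _) (oner_neq0 _)); rewrite !scale1r scale0r addr0.
move=> [p [h [d1 sp -> th]]]; exists (p + c%:P), h; split=> //.
  by rewrite size_addC // sp ltnS ltnW.
by rewrite pevD pevC addrAC.
Qed.

Lemma comp_sub_size p (b c : K) : b != 0 -> size (p \Po (b *: 'X + c%:P)) = size p.
Proof.
move=> b0; have sq : size (b *: 'X + c%:P) = 2.
  rewrite size_polyDl size_scale ?size_polyX // size_polyC.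
  by case: (c != 0).
by rewrite size_comp_poly2.
Qed.

Lemma tower_addr ds f g c : tower ds f g -> tower ds f (g + c *: 1).
Proof.
case: ds => [|d ds] /=.
  move=> /affineC /(@affine_mix _ _ 1 0 1 c (oner_neq0 _) (oner_neq0 _)).
  by rewrite !scale1r scale0r addr0 => /affineC.
move=> [p [h [d1 sp -> th]]].
exists (p \Po (1 *: 'X + (- c)%:P)), h; split=> //; last exact: tower_addl.
  by rewrite comp_sub_size ?oner_eq0.
by rewrite pev_comp pevD pevZ pevX pevC scale1r scaleNr addrK.
Qed.

(** The change is absorbed by the outermost polynomial, which becomes [m p(X / b) + (l / b) X], of
    the same degree since [d > 1]; the scalars then pass to the pair [(g, h)]. *)
Lemma tower_mix ds : forall f g m l b, m != 0 -> b != 0 -> tower ds f g ->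
  tower ds (m *: f + l *: g) (b *: g).
Proof.
elim: ds => [|d ds IH] f g m l b m0 b0 /=.
  by move/(@affine_mix _ _ m l b 0 m0 b0); rewrite scale0r addr0.
move=> [p [h [d1 sp -> th]]].
exists (m *: (p \Po (b^-1 *: 'X + 0%:P)) + (l / b) *: 'X), (m *: h).
have sq : size (m *: (p \Po (b^-1 *: 'X + 0%:P))) = d.+1.
  by rewrite size_scale // comp_sub_size ?invr_eq0.
split=> //.
- rewrite size_polyDl sq //; apply: leq_ltn_trans (size_scale_leq _ _) _.
  by rewrite size_polyX ltnS.
- rewrite pevD !pevZ pev_comp pevD pevZ pevX pevC scale0r addr0 scalerA mulVf // scale1r.
  by rewrite scalerA divfK // scalerDr addrAC.
have := IH g h b 0 m b0 m0 th; by rewrite scale0r addr0.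
Qed.

Lemma tower_scalel ds f g m : m != 0 -> tower ds f g -> tower ds (m *: f) g.
Proof.
by move=> m0 /(@tower_mix _ _ _ m 0 1 m0 (oner_neq0 _)); rewrite scale0r addr0 scale1r.
Qed.

Lemma tower_scaler ds f g b : b != 0 -> tower ds f g -> tower ds f (b *: g).
Proof.
by move=> b0 /(@tower_mix _ _ _ 1 0 b (oner_neq0 _) b0); rewrite scale0r addr0 scale1r.
Qed.

(** A shear is allowed only with [f] on top: for a nonzero shear with [g] on top, [tower_mix]
    exchanges the roles and gives back the first case. *)
Definition good f g := exists ds, (exists m, tower ds f (g - m *: f)) \/ tower ds g f.

Lemma good_id : good x y.
Proof.
exists [::]; left; exists 0, 1, 0, 0, 0, 1, 0; split.
- by rewrite mul0r subr0 mulr1 oner_eq0.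
- by rewrite scale1r !scale0r !addr0.
- by rewrite scale1r !scale0r subr0 add0r addr0.
Qed.

Lemma good_swap f g : good f g -> good g f.
Proof.
move=> [ds [[m h]|h]]; exists ds; last by left; exists 0; rewrite scale0r subr0.
have [m0|m0] := eqVneq m 0; first by right; move: h; rewrite m0 scale0r subr0.
left; exists m^-1.
have mm : - m^-1 != 0 by rewrite oppr_eq0 invr_eq0.
have := tower_mix 1 m0 mm h; rewrite scale1r addrC subrK.
by rewrite scaleNr scalerBr scalerA mulVf // scale1r opprB.
Qed.

Lemma good_scale c f g : c != 0 -> good f g -> good (c *: f) g.
Proof.
move=> c0 [ds [[m h]|h]]; exists ds; [left|by right; apply: tower_scaler].
by exists (m / c); rewrite scalerA divfK //; apply: tower_scalel.
Qed.

(** If [f] is on top, adding [c f^k] with [k >= 2] and [c] nonzero starts a new step, and smaller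
    [k] are absorbed. If [g = p(f) + h] is on top, [p] becomes [p + c X^k]; should its degree fall
    below 2, the step collapses and [f] tops the shorter tower. *)
Lemma good_elem c k f g : good f g -> good f (g + c *: f ^+ k).
Proof.
have caseA ds m : tower ds f (g - m *: f) -> good f (g + c *: f ^+ k).
  move=> h; case: k => [|[|k]].
  - exists ds; left; exists m; rewrite expr0 addrAC; exact: tower_addr.
  - exists ds; left; exists (m + c); rewrite expr1 scalerDl [m *: f + _]addrC opprD addrA addrK.
    exact: h.
  have [->|c0] := eqVneq c 0; first by exists ds; left; exists m; rewrite scale0r addr0.
  exists (k.+2 :: ds); right; exists (c *: 'X^(k.+2) + m *: 'X), (g - m *: f); split=> //.
    have s2 : size (c *: 'X^(k.+2)) = k.+3 by rewrite size_scale ?size_polyXn.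
    by rewrite size_polyDl s2 // (leq_ltn_trans (size_scale_leq _ _)) // size_polyX.
  rewrite pevD !pevZ pevXn pevX -addrA [m *: f + _]addrC subrK addrC.
  by [].
move=> [ds [[m h]|h]]; first exact: caseA h.
case: ds h => [|d ds] h; first by apply: (caseA [::] 0); rewrite scale0r subr0; apply: affineC.
case: h => [p [h [d1 sp -> th]]].
have e : pev f p + h + c *: f ^+ k = pev f (p + c *: 'X^k) + h.
  by rewrite pevD pevZ pevXn pevX addrAC.
rewrite e; set q := p + _; clearbody q; have [sq|sq] := ltnP 2 (size q).
  exists ((size q).-1 :: ds); right; exists q, h; split=> //; last by case: (size q) sq.
  by case: (size q) sq => [|[|[|]]].
exists ds; left; exists q`_1.
have qE : q = q`_1 *: 'X + (q`_0)%:P.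
  apply/polyP => i; rewrite coefD coefZ coefX coefC.
  case: i => [|[|i]] /=; rewrite ?mulr0 ?mulr1 ?add0r ?addr0 //.
  by rewrite nth_default // (leq_trans sq).
rewrite {1}qE pevD pevZ pevX pevC addrAC [q`_1 *: f + _]addrC addrK addrC.
exact: tower_addr.
Qed.

End Tower.

Section TowerRel.
Variables (K : fieldType) (S : lalgType K).
Hypothesis sAr : central_scalars S.
Variables x y : S.
Implicit Types (f g h : S) (p q : {poly K}) (ds : seq nat).
Variable P : S -> S -> Prop.
Hypotheses (P_id : P x y) (P_swap : forall f g, P f g -> P g f)
  (P_scale : forall (c : K) f g, c != 0 -> P f g -> P (c *: f) g)
  (P_elem : forall (c : K) k f g, P f g -> P f (g + c *: f ^+ k)).

Lemma rel_pev f g p : P f g -> P f (g + pev sAr f p).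
Proof.
rewrite pevE; elim: (index_enum _) g => [|i r IH] g h; first by rewrite big_nil addr0.
by rewrite big_cons addrA; apply/IH/P_elem.
Qed.

Lemma rel_affine f g : affine_pair x y f g -> P f g.
Proof.
have main a b c a' b' c' : a != 0 -> a * b' - a' * b != 0 ->
    P (a *: x + b *: y + c *: 1) (a' *: x + b' *: y + c' *: 1).
  move=> a0 D.
  have h1 : P y (a *: x + b *: y + c *: 1).
    rewrite -[1](expr0 y); apply: P_elem; rewrite -[X in _ + b *: X](expr1 y); apply: P_elem.
    by apply/P_swap/P_scale.
  set f0 := a *: x + _ + _ in h1 *.
  pose e := (a * b' - a' * b) / a.
  have e0 : e != 0 by rewrite mulf_neq0 ?invr_eq0.
  have h2 : P f0 (e *: y + (a' / a) *: f0 ^+ 1 + (c' - a' / a * c) *: f0 ^+ 0).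
    by do 2!apply: P_elem; apply/P_swap/P_scale.
  suff -> : a' *: x + b' *: y + c' *: 1 = e *: y + (a' / a) *: f0 ^+ 1 + (c' - a' / a * c) *: f0 ^+ 0 by [].
  have ey : e *: y = 0 *: x + e *: y + 0 *: 1 by rewrite !scale0r add0r addr0.
  rewrite expr1 expr0 /f0 scale3 ey (const3 x y (_ - _)) !add3.
  by congr (_ *: _ + _ *: _ + _ *: _); rewrite /e; field.
move=> [a [b [c [a' [b' [c' [D -> ->]]]]]]].
have [a0|a0] := eqVneq a 0; last exact: main.
apply/P_swap/main; first by apply: contraNneq D => ->; rewrite a0 !mul0r subr0.
by rewrite -oppr_eq0 opprB.
Qed.

(** Instantiated with tameness, this shows that the pair at the top of a tower comes from an
    automorphism. *)
Lemma tower_rel ds : forall f g, tower sAr x y ds f g -> P f g.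
Proof.
elim: ds => [|d ds IH] f g /=; first exact: rel_affine.
by move=> [p [h [_ _ -> /IH th]]]; apply: P_swap; rewrite addrC; apply: rel_pev.
Qed.

End TowerRel.

Section TowerMorph.
Variables (K : fieldType) (S S' : lalgType K).
Hypothesis sAr : central_scalars S.
Hypothesis sAr' : central_scalars S'.
Variables (phi : {lrmorphism S -> S'}).

Lemma pev_morph g p : phi (pev sAr g p) = pev sAr' (phi g) p.
Proof.
rewrite !pevE linear_sum; apply: eq_bigr => i _.
by rewrite linearZ /= rmorphXn.
Qed.

Lemma tower_morph x y ds : forall f g, tower sAr x y ds f g ->
  tower sAr' (phi x) (phi y) ds (phi f) (phi g).
Proof.
elim: ds => [|d ds IH] f g /=.
  move=> [a [b [c [a' [b' [c' [D -> ->]]]]]]]; exists a, b, c, a', b', c'; split=> //.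
    by rewrite !linearD !linearZ /= rmorph1.
  by rewrite !linearD !linearZ /= rmorph1.
move=> [p [h [d1 sp -> /IH th]]]; exists p, (phi h); split=> //.
by rewrite linearD /= pev_morph.
Qed.

End TowerMorph.

(** * Polynomially parametrized sets of pairs *)

Section PolyMaps.
Variables (K : fieldType) (S : lalgType K).
Hypothesis sAr : central_scalars S.

Definition polyf m (F : ('I_m -> K) -> K) := exists q : {mpoly K[m]}, forall t, F t = q.@[t].
Definition polyS m (U : ('I_m -> K) -> S) := exists L : seq (S * {mpoly K[m]}),
  forall t, U t = \sum_(z <- L) z.2.@[t] *: z.1.

Section Closure.
Variable m : nat.
Implicit Types (F G : ('I_m -> K) -> K) (U V : ('I_m -> K) -> S).

Lemma polyf_var (i : 'I_m) : polyf (fun t => t i).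
Proof. by exists 'X_i => t; rewrite mevalXU. Qed.

Lemma polyf_const c : polyf (fun _ : 'I_m -> K => c).
Proof. by exists c%:MP => t; rewrite mevalC. Qed.

Lemma polyfM F G : polyf F -> polyf G -> polyf (fun t => F t * G t).
Proof. by move=> [q hq] [r hr]; exists (q * r) => t; rewrite mevalM hq hr. Qed.

Lemma polyfB F G : polyf F -> polyf G -> polyf (fun t => F t - G t).
Proof. by move=> [q hq] [r hr]; exists (q - r) => t; rewrite mevalB hq hr. Qed.

Lemma polyS_const u : polyS (fun _ : 'I_m -> K => u).
Proof. by exists [:: (u, 1)] => t; rewrite big_seq1 /= meval1 scale1r. Qed.

Lemma polySD U V : polyS U -> polyS V -> polyS (fun t => U t + V t).
Proof. by move=> [L hL] [L' hL']; exists (L ++ L') => t; rewrite big_cat hL hL'. Qed.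

Lemma polySZ F U : polyf F -> polyS U -> polyS (fun t => F t *: U t).
Proof.
move=> [q hq] [L hL]; exists [seq (z.1, q * z.2) | z <- L] => t.
rewrite hq hL scaler_sumr big_map; apply: eq_bigr => z _ /=.
by rewrite mevalM scalerA.
Qed.

Lemma polySM U V : polyS U -> polyS V -> polyS (fun t => U t * V t).
Proof.
move=> [L hL] [L' hL']; exists [seq (z.1 * z'.1, z.2 * z'.2) | z <- L, z' <- L'] => t.
rewrite hL hL' big_distrlr big_allpairs_dep; apply: eq_bigr => z _; apply: eq_bigr => z' _ /=.
by rewrite -scalerAl -sAr scalerA mevalM.
Qed.

Lemma polySX U k : polyS U -> polyS (fun t => U t ^+ k).
Proof.
move=> hU; elim: k => [|k IH]; first exact: (polyS_const 1).
have [L hL] := polySM hU IH; exists L => t; rewrite exprS hL.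
by [].
Qed.

Lemma polyS_sum I (r : seq I) (W : I -> ('I_m -> K) -> S) :
  (forall i, polyS (W i)) -> polyS (fun t => \sum_(i <- r) W i t).
Proof.
move=> hW; elim: r => [|i r IH].
  by have [L hL] := polyS_const 0; exists L => t; rewrite big_nil; exact: (hL t).
by have [L hL] := polySD (hW i) IH; exists L => t; rewrite big_cons; exact: (hL t).
Qed.

End Closure.

Lemma polyf_reindex m k (s : 'I_m -> 'I_k) F : polyf F -> polyf (fun t => F (t \o s)).
Proof.
move=> [q hq]; exists (q \mPo [tuple 'X_(s i) | i < m]) => t; rewrite hq comp_mpoly_meval.
by apply: meval_eq => i; rewrite tnth_mktuple mevalXU.
Qed.

Lemma polyS_reindex m k (s : 'I_m -> 'I_k) U : polyS U -> polyS (fun t => U (t \o s)).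
Proof.
move=> [L hL]; exists [seq (z.1, z.2 \mPo [tuple 'X_(s i) | i < m]) | z <- L] => t.
rewrite hL big_map; apply: eq_bigr => z _ /=; rewrite comp_mpoly_meval; congr (_ *: _).
by apply: meval_eq => i; rewrite tnth_mktuple mevalXU.
Qed.

Definition param m (P : S -> S -> Prop) := exists U V (D : ('I_m -> K) -> K),
  [/\ polyS U, polyS V, polyf D &
      forall f g, P f g <-> exists t, [/\ D t != 0, f = U t & g = V t]].

Lemma param_ext m P Q : (forall f g, P f g <-> Q f g) -> param m P -> param m Q.
Proof.
move=> PQ [U [V [D [hU hV hD h]]]]; exists U, V, D; split=> // f g.
by rewrite -PQ.
Qed.

Lemma param_swap m P : param m P -> param m (fun f g => P g f).
Proof.
move=> [U [V [D [hU hV hD h]]]]; exists V, U, D; split=> // f g.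
by rewrite h; split=> -[t [? ? ?]]; exists t; split.
Qed.

Definition glue m e (t0 : 'I_m -> K) (c : 'I_e -> K) (i : 'I_(m + e)) :=
  match split i with inl j => t0 j | inr k => c k end.

Lemma glue_l m e t0 c : @glue m e t0 c \o @lshift m e =1 t0.
Proof. by move=> j; rewrite /glue /= (unsplitK (inl j)). Qed.

Lemma glue_r m e t0 c : @glue m e t0 c \o @rshift m e =1 c.
Proof. by move=> j; rewrite /glue /= (unsplitK (inr j)). Qed.

Lemma polyS_ext m (U : ('I_m -> K) -> S) t t' : polyS U -> t =1 t' -> U t = U t'.
Proof.
by move=> [L hL] tt; rewrite !hL; apply: eq_bigr => z _; rewrite (meval_eq _ tt).
Qed.

Lemma polyf_ext m (F : ('I_m -> K) -> K) t t' : polyf F -> t =1 t' -> F t = F t'.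
Proof. by move=> [q hq] tt; rewrite !hq; apply: meval_eq. Qed.

Lemma param_step m P lo e : param m P ->
  param (m + e.+1) (fun f g => exists h (c : 'I_e.+1 -> K),
    [/\ P g h, c ord_max != 0 & f = \sum_(i < e.+1) c i *: g ^+ (lo + i) + h]).
Proof.
move=> [U [V [D [hU hV hD H]]]].
pose L (t : 'I_(m + e.+1) -> K) := t \o @lshift m e.+1.
pose Rr (t : 'I_(m + e.+1) -> K) := t \o @rshift m e.+1.
exists (fun t => \sum_(i < e.+1) Rr t i *: U (L t) ^+ (lo + i) + V (L t)).
(* The extra factor of the denominator keeps the leading coefficient of the new step nonzero. *)
exists (fun t => U (L t)), (fun t => D (L t) * Rr t ord_max).
have hUL := polyS_reindex (@lshift m e.+1) hU.
split.
- apply: polySD; last exact: polyS_reindex.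
  apply: polyS_sum => i; apply: polySZ; first exact: polyf_var.
  exact: (polySX _ hUL).
- exact: hUL.
- by apply: polyfM; [exact: polyf_reindex|exact: polyf_var].
move=> f g; split=> [[h [c [/H[t [Dt -> ->]] c0 ->]]]|[t [Dt -> ->]]].
  exists (glue t c); rewrite /L /Rr; split.
  - by rewrite (polyf_ext hD (glue_l t c)) glue_r mulf_neq0.
  - rewrite (polyS_ext hV (glue_l t c)) (polyS_ext hU (glue_l t c)); congr (_ + _).
    by apply: eq_bigr => i _; rewrite glue_r.
  - by rewrite (polyS_ext hU (glue_l t c)).
exists (V (L t)), (Rr t); move: Dt; rewrite mulf_eq0 negb_or => /andP[D0 R0]; split=> //.
by apply/H; exists (L t).
Qed.

Lemma param_twist m P : param m P ->
  param (m + 1) (fun f g => exists h mu, P f h /\ g = h + mu *: f).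
Proof.
move=> [U [V [D [hU hV hD H]]]].
pose L (t : 'I_(m + 1) -> K) := t \o @lshift m 1.
pose Rr (t : 'I_(m + 1) -> K) := t \o @rshift m 1.
exists (fun t => U (L t)), (fun t => V (L t) + Rr t ord0 *: U (L t)), (fun t => D (L t)).
have hUL := polyS_reindex (@lshift m 1) hU.
split.
- exact: hUL.
- by apply: polySD; [exact: polyS_reindex|apply: polySZ => //; exact: polyf_var].
- exact: polyf_reindex.
move=> f g; split=> [[h [mu [/H[t [Dt -> ->]] ->]]]|[t [Dt -> ->]]].
  exists (glue t (fun=> mu)); rewrite /L /Rr (polyf_ext hD (glue_l t _)).
  by rewrite (polyS_ext hU (glue_l t _)) (polyS_ext hV (glue_l t _)) glue_r.
by exists (V (L t)), (Rr t ord0); split=> //; apply/H; exists (L t).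
Qed.

Variables x y : S.

Lemma param_affine : param 6 (affine_pair x y).
Proof.
pose v (t : 'I_6 -> K) k := t (inord k).
exists (fun t => v t 0%N *: x + v t 1%N *: y + v t 2%N *: 1).
exists (fun t => v t 3%N *: x + v t 4%N *: y + v t 5%N *: 1).
exists (fun t => v t 0%N * v t 4%N - v t 3%N * v t 1%N).
have hv k : polyf (fun t => v t k) by apply: polyf_var.
split.
- by do !apply: polySD; apply: polySZ => //; apply: polyS_const.
- by do !apply: polySD; apply: polySZ => //; apply: polyS_const.
- by apply: polyfB; apply: polyfM.
move=> f g; split=> [[a [b [c [a' [b' [c' [D -> ->]]]]]]]|[t [D -> ->]]]; last by do 6!eexists; split; [exact: D|..].
by exists (fun i => nth 0 [:: a; b; c; a'; b'; c'] i); rewrite /v !inordK.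
Qed.

(** A step counts its coefficients in degrees [lo] to [d], where [lo] is 2 next to the affine pair
    and 1 elsewhere. *)
Fixpoint cnt (ds : seq nat) := match ds with
  | [::] => 6
  | d :: ds' => (cnt ds' + (d - (if ds' is [::] then 2 else 1)).+1)%N
  end.

(** The terms of [p] of degree below [lo] are moved into [h]: any tower absorbs a constant added to
    its second component, and an affine pair [(g, h)] also absorbs a multiple of [g]. *)
Lemma tower_norm d ds f g : (1 < d)%N ->
  let lo := if ds is [::] then 2 else 1 in
  tower sAr x y (d :: ds) f g <-> exists h (c : 'I_(d - lo).+1 -> K),
    [/\ tower sAr x y ds g h, c ord_max != 0 & f = \sum_(i < (d - lo).+1) c i *: g ^+ (lo + i) + h].
Proof.
move=> d1 lo; have lod : (lo <= d)%N by rewrite /lo; case: (ds) => [|? ?]; lia.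
split=> [[p [h [_ sp -> th]]]|[h [c [th c0 ->]]]].
  exists (\sum_(i < lo) p`_i *: g ^+ i + h), (fun i => p`_(lo + i)%N); split.
  - rewrite /lo; case: ds th @lo lod => [|d' ds] th lo lod.
      rewrite big_ord_recl big_ord1 expr0 expr1 addrC addrA.
      have := affine_mix p`_1 p`_0 (oner_neq0 K) (oner_neq0 K) (affineC th).
      by rewrite !scale1r addrAC => /affineC; rewrite addrAC.
    by rewrite big_ord1 expr0 addrC; apply: tower_addr.
  - by rewrite /= subnKC //; have := lead_coef_eq0 p; rewrite lead_coefE sp /= -size_poly_eq0 sp => ->.
  - rewrite addrA; congr (_ + _); rewrite pevE sp addrC.
    have -> : d.+1 = (lo + (d - lo).+1)%N by lia.
    by rewrite big_split_ord.
pose p := \sum_(i < (d - lo).+1) c i *: 'X^(lo + i).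
have pd j : p`_j = \sum_(i < (d - lo).+1) c i * (j == lo + i)%N%:R.
  by rewrite coef_sum; apply: eq_bigr => i _; rewrite coefZ coefXn.
exists p, h; split=> //; last first.
  congr (_ + _); rewrite pev_sum; apply: eq_bigr => i _.
  by rewrite pevZ pevXn pevX.
apply/eqP; rewrite eqn_leq; apply/andP; split.
  apply/leq_sizeP => j dj; rewrite pd big1 // => i _.
  by case: eqP => [e|_]; [have := ltn_ord i; lia|rewrite mulr0].
rewrite ltnNge; apply/negP => /leq_sizeP /(_ d (leqnn _)); rewrite pd (bigD1 ord_max) //= big1 => [|i ne].
  by rewrite subnKC // eqxx mulr1 addr0 => /eqP; rewrite (negPf c0).
case: eqP => [e|_]; last by rewrite mulr0.
by case/eqP: ne; apply: val_inj => /=; lia.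
Qed.

Lemma param_tower ds : all (fun d => 1 < d)%N ds -> param (cnt ds) (tower sAr x y ds).
Proof.
elim: ds => [|d ds IH] /=; first by move=> _; apply: param_affine.
move=> /andP[d1 /IH h]; have := param_step (if ds is [::] then 2 else 1) (d - (if ds is [::] then 2 else 1)) h.
apply: param_ext => f g; apply: iff_sym; exact: (tower_norm ds f g d1).
Qed.

(** A single step has [6 + (d - 1)] parameters. A further step adds [d] to the count and multiplies
    the product [e] by [d], with [d + e <= d e] as both exceed 1. *)
Lemma cnt_le ds : ds != [::] -> all (fun d => 1 < d)%N ds ->
  (cnt ds <= (\prod_(d <- ds) d)%N + 5)%N /\ (1 < \prod_(d <- ds) d)%N.
Proof.
elim: ds => // d [|d' ds] IH _; first by rewrite /= andbT big_seq1 => d1; split; lia.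
move=> H; have /andP[d1 h] : (1 < d)%N && all (fun d => 1 < d)%N (d' :: ds) := H.
have cE : cnt [:: d, d' & ds] = (cnt (d' :: ds) + (d - 1).+1)%N by [].
have [//|] := IH _ h.
have pE : (\prod_(k <- [:: d, d' & ds]) k = d * \prod_(k <- d' :: ds) k)%N by rewrite big_cons.
rewrite pE cE; move: (cnt (d' :: ds)) (\prod_(k <- d' :: ds) k)%N => z e le e1.
split; nia.
Qed.

End PolyMaps.

Import monalg.

(** * Evaluation of noncommutative polynomials *)

Lemma monalgUZ (K : nzRingType) (M : choiceType) (c : K) (k : M) : << c *g k >> = c *: << k >> :> {malg K[M]}.
Proof. by apply/malgP => v; rewrite mcoeffZ mcoeffU mcoeffU mulrnAr mulr1. Qed.

Section Meval.
Variables (K : comNzRingType) (M : monomType) (S : lalgType K).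
Variables (sAr : central_scalars S) (h : M -> S).
Variables (h1 : h mone = 1) (hM : {morph h : x y / mmul x y >-> x * y}).
Local Notation R := {malg K[M]}.

Definition mevf (g : R) : S := \sum_(k <- monalg.msupp g) monalg.mcoeff k g *: h k.

Lemma mevfEw (d : {fset M}) (g : R) : fsubset (monalg.msupp g) d ->
  mevf g = \sum_(k <- d) monalg.mcoeff k g *: h k.
Proof.
move=> le; rewrite /mevf (finmap.big_fset_incl _ le) // => k _.
by move/monalg.mcoeff_outdom ->; rewrite scale0r.
Qed.

Lemma mevfU c k : mevf << c *g k >> = c *: h k.
Proof. by rewrite (mevfEw (monalg.msuppU_le)) finmap.big_seq_fset1 monalg.mcoeffUU. Qed.

Lemma mevf_zmod : zmod_morphism mevf.
Proof.
move=> u v; set d := finmap.fsetU (monalg.msupp u) (monalg.msupp v).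
rewrite (mevfEw (finmap.fsubsetUl (monalg.msupp u) (monalg.msupp v))).
rewrite (mevfEw (finmap.fsubsetUr (monalg.msupp u) (monalg.msupp v))) (mevfEw (monalg.msuppB_le u v)).
by rewrite -sumrB; apply: eq_bigr => k _; rewrite monalg.mcoeffB scalerBl.
Qed.

Lemma mevf_scale : scalable mevf.
Proof.
move=> c u; rewrite (mevfEw (monalg.msuppZ_le c u)) /mevf scaler_sumr.
by apply: eq_bigr => k _; rewrite monalg.mcoeffZ scalerA.
Qed.

Lemma mevf_sum I (r : seq I) (F : I -> R) : mevf (\sum_(i <- r) F i) = \sum_(i <- r) mevf (F i).
Proof.
apply: (big_morph mevf) => [u v|]; last by have := mevf_zmod 0 0; rewrite !subrr.
have e0 : mevf 0 = 0 by have := mevf_zmod 0 0; rewrite !subrr.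
have eN w : mevf (- w) = - mevf w by have := mevf_zmod 0 w; rewrite e0 !add0r.
by rewrite -[v]opprK mevf_zmod !eN opprK.
Qed.

Lemma mevf_mul : monoid_morphism mevf.
Proof.
split=> [|u v]; first by rewrite mevfU scale1r h1.
rewrite monalg.malgME mevf_sum [mevf u]/mevf mulr_suml; apply: eq_bigr => i _.
rewrite mevf_sum [mevf v]/mevf mulr_sumr; apply: eq_bigr => j _.
by rewrite mevfU hM -scalerAl -sAr scalerA.
Qed.

(* Sealed, so that comparing two evaluations never unfolds the packed structures. *)
Lemma mev_sig : {phi : {lrmorphism R -> S} | phi =1 mevf}.
Proof.
by exists (HB.pack_for {lrmorphism R -> S} mevf
   (GRing.isZmodMorphism.Build R S mevf mevf_zmod)
   (GRing.isMonoidMorphism.Build R S mevf mevf_mul)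
   (GRing.isScalable.Build K R S *:%R mevf mevf_scale)).
Qed.

Definition mev : {lrmorphism R -> S} := sval mev_sig.

Lemma mevE u : mev u = \sum_(k <- monalg.msupp u) monalg.mcoeff k u *: h k.
Proof. exact: (svalP mev_sig u). Qed.

Lemma mevU c k : mev << c *g k >> = c *: h k.
Proof. by rewrite -mevfU mevE. Qed.

End Meval.

Definition wordev (S : pzSemiRingType) (F : 'I_2 -> S) (w : {fmonom 'I_2}) : S :=
  \prod_(a <- (w : seq 'I_2)) F a.

Section FreeEval.
Variables (K : fieldType).
Local Notation R := (free_alg2 K).

Lemma central_malg (M : monomType) : central_scalars {malg K[M]}.
Proof.
move=> c u v; rewrite [u * v]malgME scaler_sumr [RHS](monalg.malgMEw (finmap.fsubset_refl _) (monalg.msuppZ_le c v)).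
apply: eq_bigr => i _; rewrite scaler_sumr; apply: eq_bigr => j _.
apply/malgP => k; rewrite mcoeffZ !mcoeffU mcoeffZ.
by rewrite mcoeffU mulrnAr [X in X *+ _]mulrCA.
Qed.

Lemma central_alg (A : algType K) : central_scalars A.
Proof. by move=> c u v; rewrite scalerAr. Qed.

Lemma word_letters (w : {fmonom 'I_2}) : << w >> = wordev (@letter K) w.
Proof.
rewrite /wordev -[w]fmK; case: w => s /=; elim: s => [|a s IH].
  by rewrite big_nil -fmoneE.
rewrite big_cons -IH /letter; have -> : FMonom (a :: s) = mmul (fmu a) (FMonom s).
  by apply: val_inj; rewrite /= fmM fmU.
by rewrite malgM_def fgmulUU mul1r.
Qed.

Variables (S : lalgType K) (sAr : central_scalars S).
Implicit Types (F : 'I_2 -> S).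

Lemma wordev1 F : wordev F mone = 1.
Proof. by rewrite /wordev fm1 big_nil. Qed.

Lemma wordevM F : {morph wordev F : x y / mmul x y >-> x * y}.
Proof. by move=> x y; rewrite /wordev fmM big_cat. Qed.

Definition ev F : {lrmorphism R -> S} := mev sAr (wordev1 F) (wordevM F).

Lemma evD F u v : ev F (u + v) = ev F u + ev F v. Proof. exact: linearD. Qed.
Lemma evBr F u v : ev F (u - v) = ev F u - ev F v. Proof. exact: linearB. Qed.
Lemma evZ F c u : ev F (c *: u) = c *: ev F u. Proof. exact: linearZ. Qed.

Lemma ev1 F : ev F 1 = 1. Proof. exact: rmorph1. Qed.
Lemma evX F u n : ev F (u ^+ n) = ev F u ^+ n. Proof. exact: rmorphXn. Qed.
Lemma ev_sum F I (r : seq I) (U : I -> R) :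
  ev F (\sum_(i <- r) U i) = \sum_(i <- r) ev F (U i).
Proof. exact: rmorph_sum. Qed.

Lemma ev_word F w : ev F << w >> = wordev F w.
Proof. by rewrite mevU scale1r. Qed.

Lemma ev_letter F a : ev F (letter K a) = F a.
Proof. by rewrite ev_word /wordev fmU big_seq1. Qed.

Lemma lrmorph_ext (phi psi : {lrmorphism R -> S}) :
  (forall a, phi (letter K a) = psi (letter K a)) -> phi =1 psi.
Proof.
move=> h u; rewrite (monalgE u) !rmorph_sum /=; apply: eq_bigr => w _.
rewrite monalgUZ !linearZ /=; congr (_ *: _); rewrite word_letters /wordev !rmorph_prod.
by apply: eq_bigr => a _; apply: h.
Qed.

Lemma ev_unique (phi : {lrmorphism R -> S}) u : phi u = ev (fun a => phi (letter K a)) u.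
Proof. by apply: lrmorph_ext => a; rewrite ev_letter. Qed.

End FreeEval.

Section FreeEnd.
Variable K : fieldType.
Local Notation R := (free_alg2 K).
Local Notation evR := (ev (@central_malg K _)).

Lemma ev_id u : evR (@letter K) u = u.
Proof. by apply: (@lrmorph_ext K R (evR (@letter K)) idfun) => a; rewrite ev_letter. Qed.

Lemma ev_ext (S : lalgType K) (sAr : central_scalars S) (F G : 'I_2 -> S) u :
  F =1 G -> ev sAr F u = ev sAr G u.
Proof. by move=> FG; apply: lrmorph_ext => a; rewrite ev_letter ev_letter. Qed.

Lemma ev_post (S S' : lalgType K) (sAr : central_scalars S) (sAr' : central_scalars S')
  (psi : {lrmorphism S -> S'}) (F : 'I_2 -> S) u :
  psi (ev sAr F u) = ev sAr' (fun a => psi (F a)) u.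
Proof.
apply: (@lrmorph_ext K S' (psi \o ev sAr F) (ev sAr' (fun a => psi (F a)))) => a.
by rewrite [RHS]ev_letter; apply: (congr1 psi (ev_letter sAr F a)).
Qed.

Lemma ev_comp (S : lalgType K) (sAr : central_scalars S) (F : 'I_2 -> R) (G : 'I_2 -> S) u :
  ev sAr G (evR F u) = ev sAr (fun a => ev sAr G (F a)) u.
Proof. exact: ev_post. Qed.

End FreeEnd.

(** * The free product of N^2 and a free letter *)

(* The pair (w, s) stands for the product a_0 N a_1 N ... N a_p of commuting
   a_i and a free letter N: w is the sum of the a_i, and s lists the partial
   sums a_0 + ... + a_i for i < p. *)
Definition bmon (T : Type) : Type := (T * seq T)%type.

Section Bmon.
Variable T : nmodType.
Implicit Types (a b c : bmon T) (x : T).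

Definition bone : bmon T := (0, [::]).
(** In a product, the partial sums of the second factor start from the total [a.1] of the first. *)
Definition bmul a b : bmon T := (a.1 + b.1, a.2 ++ map (+%R a.1) b.2).
Definition bcnt a := size a.2.
Definition bcomm a b := bmul a b = bmul b a.
Definition bpow a n := iter n (bmul a) bone.
Definition bgen (a : 'I_2 -> bmon T) (u : seq 'I_2) := foldr (fun i => bmul (a i)) bone u.

Lemma bmulA : associative bmul.
Proof.
move=> a b c; rewrite /bmul /= addrA map_cat -map_comp catA.
by congr (_, _ ++ _); apply: eq_map => x /=; rewrite addrA.
Qed.

Lemma bmul1b : left_id bone bmul.
Proof.
move=> [w s]; rewrite /bmul /= add0r; congr (_, _).
by rewrite -[RHS]map_id; apply: eq_map => x; rewrite add0r.
Qed.

Lemma bmulb1 : right_id bone bmul.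
Proof. by move=> [w s]; rewrite /bmul /= addr0 cats0. Qed.

Lemma bcntM a b : bcnt (bmul a b) = (bcnt a + bcnt b)%N.
Proof. by rewrite /bcnt size_cat size_map. Qed.

Lemma bcnt_pow a n : bcnt (bpow a n) = (n * bcnt a)%N.
Proof. by elim: n => // n IH; rewrite /bpow iterS bcntM -/(bpow a n) IH mulSn. Qed.

Lemma bcomm_pow a b n : bcomm a b -> bcomm (bpow a n) b.
Proof.
move=> h; elim: n => [|n IH]; first by rewrite /bcomm bmul1b bmulb1.
by rewrite /bpow /bcomm iterS -/(bpow a n) -bmulA IH !bmulA h.
Qed.

Hypothesis canc : forall x y z : T, x + z = y + z -> x = y.

Lemma bmulI a : injective (bmul a).
Proof.
move=> [w s] [v t] [] /=; rewrite ![a.1 + _]addrC => /canc-> /eqP.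
rewrite eqseq_cat // => /andP[_ /eqP] /inj_map-> // x y.
by rewrite ![a.1 + _]addrC => /canc.
Qed.

Lemma bcomm_eq a b : bcomm a b -> bcnt a = bcnt b -> (0 < bcnt a)%N -> a = b.
Proof.
case: a b => [w s] [v t]; rewrite /bcomm /bcnt /bmul /= => -[_ /eqP h] e.
move: h; rewrite eqseq_cat // => /andP[/eqP st]; subst t; case: s {e} => // y t /eqP[h _ _].
by rewrite (canc h).
Qed.

Lemma bcomm0 a b : bcomm a b -> bcnt a = 0%N -> (0 < bcnt b)%N -> a = bone.
Proof.
case: a b => [w s] [v [|y t]]; rewrite /bcomm /bcnt /bmul //= => -[_ h] /size0nil e _.
by move: h; rewrite e cats0 /= => -[h _]; rewrite -[y]add0r addrA addr0 in h; rewrite (canc h).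
Qed.

(** Both powers contain [bcnt a * bcnt b] letters N and still commute. By [bcomm_eq] they coincide:
    their lists have the same length, hence agree, and the next entries compare the totals. *)
Lemma bcomm_powE a b : bcomm a b -> (0 < bcnt a)%N -> (0 < bcnt b)%N ->
  bpow a (bcnt b) = bpow b (bcnt a).
Proof.
move=> h a0 b0; apply: bcomm_eq; rewrite ?bcnt_pow ?muln_gt0 ?a0 ?b0 //; last by rewrite mulnC.
by apply: bcomm_pow; apply/esym/bcomm_pow.
Qed.

End Bmon.

Section Free.
Variable T : zmodType.
Hypothesis tf : forall (x : T) n, x *+ n.+1 = 0 -> x = 0.
Implicit Types (a : 'I_2 -> bmon T).

Lemma bcanc (x y z : T) : x + z = y + z -> x = y.
Proof. exact: addIr. Qed.

Lemma bgen_head a (i j : 'I_2) x s : i != j -> (a i).2 = [::] -> (a j).2 = x :: s ->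
  forall u, (bgen a u).2 = [::] \/ exists n t, (bgen a u).2 = ((a i).1 *+ n + x) :: t.
Proof.
move=> ij ai aj; elim=> [|k u IH] /=; first by left.
have [->|->] := I2_cases k ij; rewrite ?ai ?aj /=.
  case: IH => [->|[n [t ->]]]; first by left.
  by right; exists n.+1; eexists; rewrite /= addrA -mulrS.
by right; exists 0%N; eexists; rewrite mulr0n add0r.
Qed.

Lemma bgen_head_eq a (i j : 'I_2) x s : i != j -> (a i).2 = x :: s -> (a j).2 = x :: s ->
  forall u, u = [::] \/ exists t, (bgen a u).2 = x :: t.
Proof.
move=> ij ai aj; case=> [|k u]; [by left|right] => /=.
by have [->|->] := I2_cases k ij; rewrite ?ai ?aj /=; eexists.
Qed.

Lemma bgen_sub a (i j : 'I_2) (c : bmon T) : i != j -> a j = bmul (a i) c ->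
  forall u, exists u', bgen a u = bgen (fun k => if k == i then a i else c) u' /\
    (u = [::] \/ exists v, u' = i :: v).
Proof.
move=> ij aj; elim=> [|k u [u' [IH _]]]; first by exists [::]; split; [|left].
have [->|->] := I2_cases k ij.
  by exists (i :: u'); split; [rewrite /= eqxx IH|right; exists u'].
exists (i :: j :: u'); split; last by right; exists (j :: u').
by rewrite /= eqxx eq_sym (negPf ij) IH aj bmulA.
Qed.

(** A Euclidean descent on the number of N: if [a_i X = a_j Y] and [a_i] has fewer N, but at least
    one, then [a_j = a_i c], the pair [(a_i, c)] still does not commute, and the clash passes to
    it. *)
Lemma bgen_clash N : forall a (i j : 'I_2), i != j -> (bcnt (a i) + bcnt (a j) <= N)%N ->
  ~ bcomm (a i) (a j) -> forall u v, bmul (a i) (bgen a u) <> bmul (a j) (bgen a v).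
Proof.
elim: N => [|N IH] a i j ij.
  rewrite leqn0 addn_eq0 /bcnt !size_eq0 => /andP[/eqP ei /eqP ej] [].
  by rewrite /bcomm /bmul ei ej addrC.
wlog le : i j ij / (bcnt (a i) <= bcnt (a j))%N => [wl|].
  case/orP: (leq_total (bcnt (a i)) (bcnt (a j))) => le; first exact: wl.
  move=> hN nc u v /esym; apply: (wl j i) => //; first by rewrite eq_sym.
    by rewrite addnC.
  by move=> h; apply: nc.
move=> hN nc u v E.
have [i0|ipos] := posnP (bcnt (a i)).
  have ai : (a i).2 = [::] by apply: size0nil.
  case aj : (a j).2 => [|x s]; first by apply: nc; rewrite /bcomm /bmul ai aj addrC.
  case: E => _; rewrite ai aj /=.
  case: (bgen_head ij ai aj u) => [->//|[n [t ->]]] /= [h _].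
  (* With no N in [a_i], the first entries of the two sides differ by a positive multiple of its
     total, which torsion-freeness makes 0; then [a_i] is the unit and commutes. *)
  apply: nc; have w0 : (a i).1 = 0.
    by apply: (@tf _ n); apply: (@addIr _ x); rewrite add0r -[RHS]h mulrS addrA.
  have -> : a i = bone T by rewrite (surjective_pairing (a i)) ai w0.
  by rewrite /bcomm bmul1b bmulb1.
have [eq|ne] := eqVneq (bcnt (a i)) (bcnt (a j)).
  case: E => E1 /eqP; rewrite eqseq_cat // => /andP[/eqP e2 /eqP E2].
  case ai : (a i).2 ipos => [|x s] ipos; first by rewrite /bcnt ai in ipos.
  have aj : (a j).2 = x :: s by rewrite -e2.
  suff e1 : (a i).1 = (a j).1.
    by apply: nc; rewrite /bcomm /bmul ai aj e1.
  case: (bgen_head_eq ij ai aj u) E1 E2 => [->|[t ->]] E1 E2.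
    case: (bgen_head_eq ij ai aj v) E1 E2 => [->|[t' ->]] //=.
    by rewrite !addr0.
  by case: (bgen_head_eq ij ai aj v) E1 E2 => [->|[t' ->]] //= _ [/addIr].
have lt : (bcnt (a i) < bcnt (a j))%N by rewrite ltn_neqAle ne.
pose X := bgen a u; pose Y := bgen a v.
have [_ E2] : bmul (a i) X = bmul (a j) Y by [].
(* This subtraction of totals is why [T] is a group: starting from N^2, coordinates may become
   negative. *)
pose c : bmon T := ((a j).1 - (a i).1, take (bcnt (a j) - bcnt (a i)) X.2).
have aj : a j = bmul (a i) c.
  rewrite (surjective_pairing (a j)) /bmul /c /= addrC subrK; congr (_, _).
  have := congr1 (take (bcnt (a j))) E2; rewrite [in RHS]take_size_cat // => <-.
  by rewrite take_cat ltnNge le /= map_take.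
have cc : bcnt (a j) = (bcnt (a i) + bcnt c)%N by rewrite aj bcntM.
have ncc : ~ bcomm (a i) c.
  by move=> h; apply: nc; rewrite /bcomm aj -bmulA -h.
have Ec : X = bmul c Y.
  by apply: (@bmulI _ bcanc (a i)); rewrite bmulA -aj.
pose a' k := if k == i then a i else c.
have a'i : a' i = a i by rewrite /a' eqxx.
have a'j : a' j = c by rewrite /a' eq_sym (negPf ij).
have [u' [Eu hu]] := bgen_sub ij aj u; have [v' [Ev _]] := bgen_sub ij aj v.
case: hu => [u0|[w u'E]].
  by move: Ec; rewrite /X u0 => /(congr1 (@bcnt T)); rewrite bcntM -[X in X = _]/0%N; move: lt cc; clear; lia.
move: Ec; rewrite /X /Y Eu Ev u'E [bgen _ _]/= -/a' -/(a' i) a'i -a'j -a'i.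
apply: (IH a' i j ij); rewrite a'i a'j //.
lia.
Qed.

Lemma bgen_inj a (i j : 'I_2) : i != j -> ~ bcomm (a i) (a j) -> injective (bgen a).
Proof.
move=> ij nc.
have step : forall k l u v, bgen a (k :: u) = bgen a (l :: v) -> k = l.
  move=> k l u v h; apply/eqP; apply: contraT => kl; exfalso.
  apply: (bgen_clash kl (leqnn _)) h => c; apply: nc.
  have [ki|kj] := I2_cases k ij; have [li|lj] := I2_cases l ij; subst => //.
  - by rewrite eqxx in kl.
  - by rewrite eqxx in kl.
have unit k : a k <> bone T.
  move=> h; apply: nc; rewrite /bcomm.
  by have [ki|kj] := I2_cases k ij; subst k; rewrite h bmul1b bmulb1.
have nil : forall k u, bgen a (k :: u) <> bone T.
  move=> k u h; apply: (@unit k); have [l kl] : exists l : 'I_2, l != k.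
    by have [ki|kj] := I2_cases k ij; [exists j|exists i]; subst k; rewrite // eq_sym.
  have bgen_cat s t : bgen a (s ++ t) = bmul (bgen a s) (bgen a t).
    by elim: s => [|x s IHs] /=; rewrite ?bmul1b // IHs bmulA.
  have e : k = l.
    apply: (step k l (u ++ [:: l]) (k :: u)).
    rewrite -[LHS]/(bgen a ((k :: u) ++ [:: l])) -[RHS]/(bgen a ([:: l] ++ (k :: u))).
    by rewrite !bgen_cat h bmul1b bmulb1.
  by rewrite e eqxx in kl.
elim=> [|k u IH] [|l v] //.
- by move=> /esym/nil.
- by move/nil.
move=> h; have kl := step _ _ _ _ h; subst l.
by congr (_ :: _); apply: IH; apply: (bmulI bcanc h).
Qed.

End Free.

(** * Leading monomials for a compatible total order *)

Section Lead.
Variables (K : fieldType) (M : monomType) (lt : rel M).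
Hypotheses (lt_irr : irreflexive lt) (lt_trans : transitive lt)
  (lt_total : forall a b, a != b -> lt a b || lt b a)
  (lt_mull : forall c a b, lt a b -> lt (mmul c a) (mmul c b))
  (lt_mulr : forall c a b, lt a b -> lt (mmul a c) (mmul b c)).
Implicit Types (u v : {malg K[M]}).

Definition lead a u := mcoeff a u != 0 /\ forall m, m \in msupp u -> m = a \/ lt m a.

Lemma seq_lt_max (I : eqType) (f : I -> M) (s : seq I) : s != [::] ->
  exists2 x, x \in s & forall y, y \in s -> f y = f x \/ lt (f y) (f x).
Proof.
elim: s => // x [|y s] IH _.
  by exists x; rewrite ?inE // => z; rewrite inE => /eqP->; left.
have [//|z zs hz] := IH.
have [e|ne] := eqVneq (f x) (f z).
  exists z; first by rewrite inE zs orbT.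
  by move=> t; rewrite inE => /orP[/eqP->|/hz] //; left.
case/orP: (lt_total ne) => h.
  exists z; first by rewrite inE zs orbT.
  by move=> t; rewrite inE => /orP[/eqP->|/hz] //; right.
exists x; first by rewrite inE eqxx.
move=> t; rewrite inE => /orP[/eqP->|/hz [->|ht]]; [by left|by right|right].
exact: lt_trans h.
Qed.

Lemma lead_exists u : u != 0 -> exists a, lead a u.
Proof.
move=> u0; have s0 : (msupp u : seq M) != [::].
  apply: contraNneq u0 => e; rewrite -msupp_eq0; apply/eqP/fsetP => x.
  by rewrite in_fset0; move: (congr1 (fun s : seq M => x \in s) e).
have [a au ha] := seq_lt_max id s0.
by exists a; split=> //; rewrite mcoeff_neq0.
Qed.

Lemma lead1 : lead mone 1.
Proof.
split; first by rewrite mcoeff1 eqxx oner_eq0.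
by move=> m; rewrite -mcoeff_neq0 mcoeff1; have [->|_] := eqVneq m mone; [left|rewrite eqxx].
Qed.

Lemma mul_lt a b x y : x = a \/ lt x a -> y = b \/ lt y b ->
  (x = a /\ y = b) \/ lt (mmul x y) (mmul a b).
Proof.
move=> [->|xa] [->|yb]; [by left|right|right|right].
- exact: lt_mull.
- exact: lt_mulr.
- exact: lt_trans (lt_mulr _ xa) (lt_mull _ yb).
Qed.

Lemma leadM a b u v : lead a u -> lead b v -> lead (mmul a b) (u * v).
Proof.
move=> [a0 ha] [b0 hb]; split.
  suff -> : mcoeff (mmul a b) (u * v) = mcoeff a u * mcoeff b v by rewrite mulf_neq0.
  rewrite mcoeffMl (bigD1_seq a) ?mcoeff_neq0 -?mcoeff_neq0 ?fset_uniq //=.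
  rewrite (bigD1_seq b) ?mcoeff_neq0 -?mcoeff_neq0 ?fset_uniq //= eqxx mulr1n.
  rewrite big_seq_cond big1 ?addr0 => [|y /andP[/hb hy yb]]; last first.
    by case: eqP => // e; case: hy => [h|/(lt_mull a)]; [rewrite h eqxx in yb|rewrite e lt_irr].
  rewrite big_seq_cond big1 ?addr0 // => x /andP[/ha hx xa].
  rewrite big_seq big1 // => y /hb hy.
  case: eqP => // e; case: (mul_lt hx hy) => [[h _]|]; first by rewrite h eqxx in xa.
  by rewrite e lt_irr.
move=> m /msuppM_le[x [y [/ha hx /hb hy ->]]].
by case: (mul_lt hx hy) => [[-> ->]|]; [left|right].
Qed.

Lemma lead_sum (I : eqType) (s : seq I) (c : I -> K) (mu : I -> M) (U : I -> {malg K[M]}) :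
  s != [::] -> uniq s -> injective mu -> (forall i, i \in s -> c i != 0) ->
  (forall i, lead (mu i) (U i)) ->
  exists2 i, lead (mu i) (\sum_(j <- s) c j *: U j) &
    forall j, j \in s -> mu j = mu i \/ lt (mu j) (mu i).
Proof.
move=> s0 us inj c0 hU; have [i si hi] := seq_lt_max mu s0; exists i => //.
split.
  rewrite raddf_sum (bigD1_seq i) //= mcoeffZ big_seq_cond big1 ?addr0 => [|j /andP[js ji]].
    by rewrite mulf_neq0 ?c0 //; case: (hU i).
  rewrite mcoeffZ; apply/eqP; rewrite mulf_eq0; apply/orP; right.
  rewrite mcoeff_eq0; apply/negP => /(hU j).2[e|h].
    by rewrite (inj _ _ e) eqxx in ji.
  by case: (hi j js) => [/inj e|/(lt_trans h)]; [rewrite e eqxx in ji|rewrite lt_irr].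
move=> m ms; have [j js mj] : exists2 j, j \in s & m \in msupp (U j).
  apply/hasP; apply: contraLR ms => /hasPn h; rewrite -mcoeff_eq0 raddf_sum /=.
  rewrite big_seq big1 // => j /h; rewrite -mcoeff_eq0 mcoeffZ => /eqP->.
  by rewrite mulr0.
case: ((hU j).2 _ mj) => [->|h]; first exact: hi.
by right; case: (hi j js) => [<-|/(lt_trans h)].
Qed.

End Lead.

(** * A weighted order on the free product *)

Notation slot := (nat * nat)%type.

Definition ltslot (a b : slot) := (a.1 < b.1)%N || (a.1 == b.1) && (a.2 < b.2)%N.

Fixpoint lexlt (s t : seq slot) := match s, t with
  | x :: s', y :: t' => ltslot x y || (x == y) && lexlt s' t'
  | _, _ => false
  end.

Lemma ltslotD x a b : ltslot a b -> ltslot (x + a) (x + b).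
Proof. by case: x a b => [x1 x2] [a1 a2] [b1 b2]; rewrite /ltslot /=; lia. Qed.

Lemma ltslotDr x a b : ltslot a b -> ltslot (a + x) (b + x).
Proof. by rewrite ![_ + x]addrC; apply: ltslotD. Qed.

Lemma ltslot_irr : irreflexive ltslot.
Proof. by move=> a; rewrite /ltslot !ltnn andbF. Qed.

Lemma ltslot_trans : transitive ltslot.
Proof. by move=> [b1 b2] [a1 a2] [c1 c2]; rewrite /ltslot /=; lia. Qed.

Lemma ltslot_total a b : a != b -> ltslot a b || ltslot b a.
Proof. by case: a b => [a1 a2] [b1 b2]; rewrite /ltslot -pair_eqE /=; lia. Qed.

Lemma lexlt_irr : irreflexive lexlt.
Proof. by elim=> //= x s ->; rewrite ltslot_irr andbF. Qed.

Lemma lexlt_trans : transitive lexlt.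
Proof.
move=> t; elim: t => [|y t IH] [|x s] [|z u] //=.
case/orP=> [xy|/andP[/eqP-> st]]; case/orP=> [yz|/andP[/eqP<- tu]].
- by rewrite (ltslot_trans xy yz).
- by rewrite xy.
- by rewrite yz.
- by rewrite eqxx (IH _ _ st tu) orbT.
Qed.

Lemma lexlt_total s t : size s = size t -> s != t -> lexlt s t || lexlt t s.
Proof.
elim: s t => [|x s IH] [|y t] //= [e]; rewrite eqseq_cons negb_and.
have [->|ne _] := eqVneq x y; first by rewrite ltslot_irr ?eqxx /= => /(IH _ e).
by case/orP: (ltslot_total ne) => ->; rewrite ?orbT.
Qed.

Lemma lexlt_cat s u v : lexlt (s ++ u) (s ++ v) = lexlt u v.
Proof. by elim: s => //= x s ->; rewrite ltslot_irr eqxx. Qed.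

Lemma lexlt_catr s t u v : lexlt s t -> lexlt (s ++ u) (t ++ v).
Proof. by elim: s t => [|x s IH] [|y t] //= /orP[->//|/andP[-> /IH->]]; rewrite orbT. Qed.

Lemma lexlt_map x s t : lexlt s t -> lexlt (map (+%R x) s) (map (+%R x) t).
Proof.
elim: s t => [|y s IH] [|z t] //= /orP[h|/andP[/eqP-> /IH->]]; first by rewrite ltslotD.
by rewrite eqxx orbT.
Qed.

Section Bm.

Definition bm := bmon slot.
HB.instance Definition _ := Choice.on bm.

Lemma bm_unit (a b : bm) : bmul a b = bone _ -> a = bone _ /\ b = bone _.
Proof.
case: a b => [[a1 a2] [|x s]] [[b1 b2] [|y t]] //= [].
by rewrite /bone; case: a1 a2 b1 b2 => [|a1] [|a2] [|b1] [|b2].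
Qed.

HB.instance Definition _ := Choice_isMonomialDef.Build bm
  (@bmulA slot) (@bmul1b slot) (@bmulb1 slot) bm_unit.

Variables A B : int.
Implicit Types a b c : bm.

Definition bdeg a := (a.1.1 + a.1.2)%N.
Definition bwt a : int := A * (bdeg a)%:Z + B * (bcnt a)%:Z.
(** The total is the last of the partial sums; with it the key determines the element. *)
Definition bkey a := rcons a.2 a.1.
(** Ties in weight are broken by the number of N, so that a leading monomial contains N as soon as
    some monomial of top weight does. *)
Definition blt a b := (bwt a < bwt b) || (bwt a == bwt b) &&
  ((bcnt a < bcnt b)%N || (bcnt a == bcnt b) && lexlt (bkey a) (bkey b)).

Lemma bwtM a b : bwt (bmul a b) = bwt a + bwt b.
Proof. by rewrite /bwt bcntM /bdeg /bmul /= !PoszD; ring. Qed.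

Lemma blt_irr : irreflexive blt.
Proof. by move=> a; rewrite /blt ltxx ltnn lexlt_irr !andbF. Qed.

Lemma blt_trans : transitive blt.
Proof.
move=> b a c; rewrite /blt => /orP[h|/andP[/eqP-> h]] /orP[k|/andP[/eqP<- k]].
- by rewrite (lt_trans h k).
- by rewrite h.
- by rewrite k.
apply/orP; right; rewrite eqxx /=; move: h k => /orP[h|/andP[/eqP-> h]] /orP[k|/andP[/eqP<- k]].
- by rewrite (ltn_trans h k).
- by rewrite h.
- by rewrite k.
- by rewrite eqxx (lexlt_trans h k) orbT.
Qed.

Lemma blt_total a b : a != b -> blt a b || blt b a.
Proof.
move=> ab; rewrite /blt; case: (ltgtP (bwt a) (bwt b)) => //= _.
case: (ltngtP (bcnt a) (bcnt b)) => //= e.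
rewrite lexlt_total ?size_rcons ?[size _]e //.
apply: contraNneq ab; case: a b {e} => [w s] [v t] /rcons_inj[/= -> ->]; exact: eqxx.
Qed.

Lemma bkeyM a b : bkey (bmul a b) = a.2 ++ map (+%R a.1) (bkey b).
Proof. by rewrite /bkey /bmul /= map_rcons -rcons_cat. Qed.

Lemma blt_mull c a b : blt a b -> blt (bmul c a) (bmul c b).
Proof.
rewrite /blt !bwtM !bcntM ltrD2l ltn_add2l (inj_eq (addrI _)) eqn_add2l.
case/orP => [->//|/andP[-> /orP[->|/andP[-> h]]]]; rewrite ?orbT //=.
by rewrite !bkeyM lexlt_cat lexlt_map ?orbT.
Qed.

Lemma blt_mulr c a b : blt a b -> blt (bmul a c) (bmul b c).
Proof.
rewrite /blt !bwtM !bcntM ltrD2r ltn_add2r (inj_eq (addIr _)) eqn_add2r.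
case/orP => [->//|/andP[-> /orP[->|/andP[/eqP e h]]]]; rewrite ?orbT //= e eqxx.
suff -> : lexlt (bkey (bmul a c)) (bkey (bmul b c)) by rewrite !orbT.
rewrite !bkeyM; move: h e; rewrite /bkey /bcnt; case: a b => [w s] [v t] /= h e.
(* If the lists agree, the totals decide, and they shift the next entry of each product; otherwise
   the first difference already lies within the lists. *)
have [st|ne] := eqVneq s t.
  rewrite st lexlt_cat; move: h; rewrite st -!cats1 lexlt_cat /= andbF orbF => h.
  by rewrite !map_cat; case: c.2 => [|x s'] /=; rewrite ltslotDr.
case/orP: (lexlt_total e ne) => h'; first exact: lexlt_catr.
by rewrite -!cats1 in h; have := lexlt_trans h (lexlt_catr [:: v] [:: w] h'); rewrite lexlt_irr.
Qed.

(** Passing from N^2 to Z^2 provides the subtraction on which [bgen_clash] relies. *)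
Definition zslot (x : slot) : int * int := (x.1%:Z, x.2%:Z).
Definition zbm (a : bm) : bmon (int * int)%type := (zslot a.1, map zslot a.2).

Lemma zslot_inj : injective zslot.
Proof. by move=> [x y] [z t] [-> ->]. Qed.

Lemma zslotD x y : zslot (x + y) = zslot x + zslot y.
Proof. by rewrite /zslot /= !PoszD. Qed.

Lemma zbm_inj : injective zbm.
Proof. by move=> [[w1 w2] s] [[v1 v2] t] [-> ->] /(inj_map zslot_inj)->. Qed.

Lemma zbmM a b : zbm (bmul a b) = bmul (zbm a) (zbm b).
Proof.
by rewrite /zbm /bmul /= zslotD map_cat -!map_comp; congr (_, _ ++ _).
Qed.

Lemma bm_free (a : 'I_2 -> bm) (i j : 'I_2) : i != j -> ~ bcomm (a i) (a j) ->
  injective (bgen a).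
Proof.
move=> ij nc u v e.
have tf (x : int * int) n : x *+ n.+1 = 0 -> x = 0.
  case: x => [x y] h; have /eqP := congr1 fst h; have /eqP := congr1 snd h.
  by rewrite !raddfMn /= !mulrn_eq0 /= => /eqP-> /eqP->.
have zE w : zbm (bgen a w) = bgen (fun k => zbm (a k)) w.
  by elim: w => //= k w IH; rewrite zbmM IH.
apply: (@bgen_inj _ tf (fun k => zbm (a k)) i j ij) => [h|]; last by rewrite -!zE e.
by apply: nc; apply: zbm_inj; rewrite !zbmM.
Qed.

Lemma slot_canc (x y z : slot) : x + z = y + z -> x = y.
Proof. by case: x y z => [x1 x2] [y1 y2] [z1 z2] [/addIn-> /addIn->]. Qed.

Lemma bwt_pow a n : bwt (bpow a n) = bwt a *+ n.
Proof.
elim: n => [|n IH]; first by rewrite /bwt /bdeg /bcnt /= mulr0n !mulr0.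
by rewrite /bpow iterS bwtM -/(bpow a n) IH mulrS.
Qed.

(** Commuting elements that both contain N satisfy [bpow a (bcnt b) = bpow b (bcnt a)]; equal
    nonzero weights then force equal counts, hence [a = b]. If only one contains N, the other is the
    unit, of weight 0. *)
Lemma bm_ncomm a b : a != b -> bwt a = bwt b -> bwt a != 0 -> (0 < bcnt a + bcnt b)%N ->
  ~ bcomm a b.
Proof.
move=> ab e a0 ab0 h.
have bone0 : bwt (bone _) = 0 by rewrite /bwt /bdeg /bcnt /= !mulr0.
have [pa|pa] := posnP (bcnt a).
  by move: a0; rewrite (bcomm0 slot_canc h pa) ?bone0 ?eqxx //; move: ab0; rewrite pa.
have [pb|pb] := posnP (bcnt b).
  by move: a0; rewrite e (bcomm0 slot_canc (esym h) pb) ?bone0 ?eqxx.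
have ec : bcnt a = bcnt b.
  have := congr1 bwt (bcomm_powE slot_canc h pa pb); rewrite !bwt_pow -e.
  by move/(mulrIn a0).
by move/eqP: ab; apply; apply: (bcomm_eq slot_canc h ec pa).
Qed.
End Bm.

Definition i0 : 'I_2 := ord0.
Definition i1 : 'I_2 := ord_max.
Lemma i01 : i0 != i1. Proof. by []. Qed.

(** * Injectivity of abelianization *)

Section EvalSupport.
Variable K : fieldType.
Local Notation R := (free_alg2 K).
Local Notation BB := {malg K[bm]}.
Local Notation evB := (ev (@central_malg K bm)).

Lemma short_span (u : R) : (forall w, w \in msupp u -> (fdeg w <= 1)%N) ->
  u = mcoeff mone u *: 1 + mcoeff (fmu i0) u *: letter K i0 + mcoeff (fmu i1) u *: letter K i1.
Proof.
move=> h; pose d : {fset {fmonom 'I_2}} := (mone |` (fmu i0 |` [fset fmu i1]))%fset.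
have le : (msupp u `<=` d)%fset.
  apply/fsubsetP => w /h; rewrite !inE -[w]fmK; case: (w : seq _) => [|a [|b s]] // _.
    by rewrite -fmoneE eqxx.
  by rewrite -fmuE; have [->|->] := I2_cases a i01; rewrite eqxx ?orbT.
have n0 a : (mone : {fmonom 'I_2}) != fmu a by rewrite eq_sym fm1_eq1.
have n1 : fmu i0 != fmu i1 by rewrite fmP !fmU.
rewrite [LHS](monalgEw le).
have h1 : mone \notin (fmu i0 |` [fset fmu i1])%fset.
  by rewrite in_fset1U in_fset1 negb_or !n0.
have h2 : fmu i0 \notin [fset fmu i1]%fset by rewrite in_fset1.
rewrite [LHS](@big_fsetU1 _ _ +%R _ _ _ _ h1) /= (@big_fsetU1 _ _ +%R _ _ _ _ h2) /= big_seq_fset1.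
rewrite (monalgUZ (mcoeff _ u) mone).
rewrite (monalgUZ (mcoeff _ u) (fmu i0)).
rewrite (monalgUZ (mcoeff _ u) (fmu i1)).
by rewrite addrA.
Qed.

Lemma ev_short (S : lalgType K) (sAr : central_scalars S) (F : 'I_2 -> S) (u : R) :
  (forall w, w \in msupp u -> (fdeg w <= 1)%N) ->
  exists a b c, ev sAr F u = a *: 1 + b *: F i0 + c *: F i1.
Proof.
move=> h; exists (mcoeff mone u), (mcoeff (fmu i0) u), (mcoeff (fmu i1) u).
rewrite [in LHS](short_span h) evD; congr (_ + _); last by rewrite evZ ev_letter.
rewrite evD; congr (_ + _); last by rewrite evZ ev_letter.
by rewrite evZ ev1.
Qed.

Variables (A B : int) (f : 'I_2 -> BB).
Local Notation bltAB := (blt A B).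
Local Notation bwt := (bwt A B).

Lemma bgen_lead (m : 'I_2 -> bm) : (forall a, lead bltAB (m a) (f a)) ->
  forall w : {fmonom 'I_2}, lead bltAB (bgen m w) (wordev f w).
Proof.
move=> h w; rewrite /wordev; case: w => /= w.
elim: w => [|a w IH]; first by rewrite big_nil; apply: lead1.
rewrite big_cons; apply: (leadM (@blt_irr A B) (@blt_trans A B) (@blt_mull A B) (@blt_mulr A B)) => //.
Qed.

Lemma bwt_gen (m : 'I_2 -> bm) W : (forall a, bwt (m a) = W) ->
  forall w, bwt (bgen m w) = W *+ size w.
Proof.
move=> h; elim=> [|a w IH] /=; first by rewrite /bwt /bdeg /bcnt /= !mulr0.
by rewrite bwtM h IH mulrS.
Qed.

(** Noncommuting leading monomials generate a free monoid, so distinct words of [u] have distinct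
    leading monomials [bgen m w], of weight [W] times the length. The largest survives in the value,
    which bounds all lengths by 1. *)
Lemma ev_lead_short (m : 'I_2 -> bm) W (u : R) :
  (forall a, lead bltAB (m a) (f a)) -> (forall a, bwt (m a) = W) -> 0 < W ->
  m i0 != m i1 -> (0 < bcnt (m i0) + bcnt (m i1))%N ->
  (forall x, x \in msupp (evB f u) -> bwt x <= W) ->
  forall w, w \in msupp u -> (fdeg w <= 1)%N.
Proof.
move=> hl hW W0 ne c0 hx w wu.
have nc : ~ bcomm (m i0) (m i1).
  by apply: (@bm_ncomm A B) => //; rewrite !hW // lt0r_neq0.
have s0 : (msupp u : seq {fmonom 'I_2}) != [::] by apply: contraTneq wu => e; rewrite -[_ \in _]/(w \in (msupp u : seq _)) e.
have inj : injective (fun w : {fmonom 'I_2} => bgen m w).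
  by move=> x y /(bm_free i01 nc) /val_inj.
have c_neq0 x : x \in (msupp u : seq _) -> mcoeff x u != 0 by rewrite mcoeff_neq0.
have [v [v0 _] hv] := lead_sum (@blt_irr A B) (@blt_trans A B) (@blt_total A B)
  s0 (fset_uniq _) inj c_neq0 (bgen_lead hl).
have := hx (bgen m v); rewrite -mcoeff_neq0 mevE v0 => /(_ isT).
rewrite (bwt_gen hW) => lv.
have : bwt (bgen m w) <= W.
  apply: le_trans lv; rewrite -(bwt_gen hW); case: (hv w wu) => [->//|].
  by rewrite /blt => /orP[/ltW//|/andP[/eqP->]].
rewrite (bwt_gen hW) -[X in _ <= X]mulr1n ler_pMn2l //.
Qed.

Lemma ev_supp (P : pred bm) : P mone -> (forall x y, P x -> P y -> P (mmul x y)) ->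
  (forall a x, x \in msupp (f a) -> P x) ->
  forall u x, x \in msupp (evB f u) -> P x.
Proof.
move=> P1 PM Pf u x.
have Pw (w : {fmonom 'I_2}) y : y \in msupp (wordev f w) -> P y.
  rewrite /wordev; elim: (w : seq _) y => [|a s IH] y.
    rewrite big_nil -mcoeff_neq0 mcoeff1; have [->//|_] := eqVneq y mone; by rewrite eqxx.
  rewrite big_cons => /msuppM_le[k1 [k2 [h1 h2 ->]]]; apply: PM; first exact: Pf h1.
  exact: IH.
rewrite -mcoeff_neq0 mevE raddf_sum /= => h.
have [w wu hw] : exists2 w, w \in (msupp u : seq _) & x \in msupp (wordev f w).
  apply/hasP; apply: contraNT h => /hasPn h; rewrite big_seq big1 // => w /h.
  by rewrite -mcoeff_eq0 mcoeffZ => /eqP->; rewrite mulr0.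
exact: Pw hw.
Qed.

End EvalSupport.

Section Injectivity.
Variable K : fieldType.
Local Notation R := (free_alg2 K).
Local Notation A2 := (mpoly 2 K).
Local Notation BB := {malg K[bm]}.
Local Notation evB := (ev (@central_malg K bm)).
Local Notation evR := (ev (@central_malg K {fmonom 'I_2})).

Definition ab : {lrmorphism R -> A2} := ev (@central_alg K A2) (fun a => 'X_a%R).

Definition ex (a : 'I_2) : slot := if a == i0 then (1%N, 0%N) else (0%N, 1%N).
Definition bx (s : slot) : bm := (s, [::]).
Definition bN : bm := (0, [:: 0]).
Definition th (a : 'I_2) : BB := << bx (ex a) >> + (if a == i0 then 0 else << bN >>).
Definition Theta : {lrmorphism R -> BB} := evB th.

(** Extended linearly, this kills N, so that [bpi] after [Theta] is abelianization. *)
Definition hpi (m : bm) : A2 :=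
  if m.2 is [::] then mpoly.mpolyX _ (mon2 i0 i1 m.1.1 m.1.2) else 0.

Lemma hpi1 : hpi mone = 1.
Proof. by rewrite /hpi /= /mon2 !mulm0n addm0 mpoly.mpolyX0. Qed.

Lemma hpiM : {morph hpi : x y / mmul x y >-> x * y}.
Proof.
move=> [[w1 w2] [|x s]] [[v1 v2] [|y t]]; rewrite /hpi /= ?mulr0 ?mul0r //.
rewrite -mpolyXD; congr mpolyX; apply/mnmP => k.
rewrite mnmDE /mon2 !mnmDE !mulmnE.
have E (c w v : nat) : (c * (w + v)%R = c * w + c * v)%N by apply: mulnDr.
by rewrite !E addnACA.
Qed.

Definition bpi : {lrmorphism BB -> A2} := mev (@central_alg K A2) hpi1 hpiM.

Lemma bpi_Theta u : bpi (Theta u) = ab u.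
Proof.
rewrite /Theta (ev_post _ (@central_alg K A2)) /ab; apply: ev_ext => a.
rewrite /th; transitivity (bpi << bx (ex a) >> + bpi (if a == i0 then 0 else << bN >>)).
  exact: (linearD bpi).
have -> : bpi (if a == i0 then 0 else << bN >>) = 0.
  by case: (a == i0); [exact: (linear0 bpi)|rewrite mevU scale1r].
rewrite addr0 mevU scale1r /hpi /= /ex; have [->|->] := I2_cases a i01.
  by rewrite eqxx /= /mon2 mulm1n mulm0n addm0.
by rewrite /= /mon2 mulm1n mulm0n add0m.
Qed.

Lemma coef_bpi p q (u : BB) : mpoly.mcoeff (mon2 i0 i1 p q) (bpi u) = mcoeff (bx (p, q)) u.
Proof.
rewrite mevE raddf_sum /= (eq_bigr (fun k => mcoeff k u * (k == bx (p, q))%:R)).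
  have [ku|ku] := boolP (bx (p, q) \in msupp u); last first.
    rewrite (mcoeff_outdom ku) big_seq big1 // => k; case: eqP => [->|_]; last by rewrite mulr0.
    by rewrite (negPf ku).
  rewrite (bigD1_seq _ ku) ?fset_uniq //= eqxx mulr1 big1 ?addr0 // => k /negPf->.
  by rewrite mulr0.
move=> [[k1 k2] s] _; rewrite mpoly.mcoeffZ; congr (_ * _).
case: s => [|x s]; rewrite /hpi /= ?mpoly.mcoeff0 //; last first.
  by case: eqP => // -[].
rewrite mpoly.mcoeffX; congr ((_ : bool)%:R); apply/eqP/eqP => [e|[-> ->] //].
have [e1 e2] := mon2i k1 k2 i01; have [e3 e4] := mon2i p q i01.
have := congr1 (fun m : multinom 2 => (m i0, m i1)) e; rewrite /= e1 e2 e3 e4 => h.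
by rewrite /bx h.
Qed.

Variables (F G : 'I_2 -> R).
Hypothesis FG : forall a, evR F (G a) = letter K a.
Hypothesis abF : forall a, ab (F a) = 'X_a%R.

Let f a := Theta (F a).

(** Killing N turns [f a] into [ab (F a) = 'X_a], which determines all its monomials without N. *)
Lemma f_count0 a w : mcoeff (bx w) (f a) = (w == ex a)%:R.
Proof.
case: w => p q; rewrite -coef_bpi /f bpi_Theta abF mpoly.mcoeffX.
congr ((_ : bool)%:R); apply/eqP/eqP => [e|].
  have [e1 e2] := mon2i p q i01; rewrite -e in e1 e2; rewrite -[p]e1 -[q]e2.
  by rewrite !mnm1E /ex; have [->|->] := I2_cases a i01.
rewrite /ex; have [->|->] := I2_cases a i01 => /= -[-> ->].
  by rewrite /mon2 mulm1n mulm0n addm0.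
by rewrite /mon2 mulm1n mulm0n add0m.
Qed.

Lemma ev_f u : evB f u = Theta (evR F u).
Proof. exact: esym (ev_comp _ F th u). Qed.

Lemma letter_span_eq (a : 'I_2) x b c :
  letter K a = x *: 1 + b *: F i0 + c *: F i1 -> F a = letter K a.
Proof.
move=> e; have h : 'X_a = x *: 1 + b *: 'X_i0 + c *: 'X_i1 :> A2.
  have := congr1 ab e; rewrite [in LHS]/ab ev_letter => ->.
  rewrite /ab evD; congr (_ + _); last by rewrite evZ; congr (_ *: _); exact: abF.
  rewrite evD; congr (_ + _); last by rewrite evZ; congr (_ *: _); exact: abF.
  by rewrite evZ ev1.
have C m : mpoly.mcoeff m ('X_a : A2) = x * (m == 0%MM)%:R + b * (U_(i0)%MM == m)%:R + c * (U_(i1)%MM == m)%:R.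
  by rewrite h !mpoly.mcoeffD !mpoly.mcoeffZ !mpoly.mcoeffX mpoly.mcoeff1.
have u0 i : (U_(i) == 0 :> multinom 2)%MM = false by apply/negP => /eqP/mnmP/(_ i); rewrite mnm1E mnm0E eqxx.
have u0' i : (0 == U_(i) :> multinom 2)%MM = false by rewrite eq_sym u0.
have u1 : (U_(i0) == U_(i1) :> multinom 2)%MM = false by apply/negP => /eqP/mnmP/(_ i0); rewrite !mnm1E.
have u1' : (U_(i1) == U_(i0) :> multinom 2)%MM = false by rewrite eq_sym u1.
have x0 : x = 0.
  by have := C 0%MM; rewrite mpoly.mcoeffX !u0 eqxx !mulr0 !addr0 mulr1.
have b0 : b = (a == i0)%:R.
  have := C U_(i0)%MM; rewrite mpoly.mcoeffX u0 u1' eqxx !mulr0 ?(addr0, add0r, mulr1) => <-.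
  by have [->|->] := I2_cases a i01; rewrite ?eqxx ?u1'.
have c0 : c = (a == i1)%:R.
  have := C U_(i1)%MM; rewrite mpoly.mcoeffX u0 u1 eqxx !mulr0 ?(addr0, add0r, mulr1) => <-.
  by have [->|->] := I2_cases a i01; rewrite ?eqxx ?u1.
rewrite e x0 b0 c0 scale0r add0r.
by have [->|->] := I2_cases a i01; rewrite ?eqxx /= scale0r scale1r ?addr0 ?add0r.
Qed.

Lemma bwt_bx A B a : bwt A B (bx (ex a)) = A.
Proof. by rewrite /bwt /bdeg /bcnt /= mulr0 addr0 /ex; case: ifP; rewrite mulr1. Qed.

Lemma ThetaZD c u v : Theta (u - c *: v) = Theta u - c *: Theta v.
Proof. by rewrite /Theta evBr; congr (_ - _); rewrite evZ. Qed.

Lemma lead_above A B (u : BB) m x : lead (blt A B) m u -> x \in msupp u ->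
  bwt A B x <= bwt A B m /\ (bwt A B x = bwt A B m -> (bcnt x <= bcnt m)%N).
Proof.
move=> [_ h] /h[->//|]; rewrite /blt => /orP[lt|/andP[/eqP-> /orP[lt|/andP[/eqP-> _]]]] //.
  by split; [exact: ltW|move=> e; rewrite e ltxx in lt].
by split=> // _; apply: ltnW.
Qed.

(** Otherwise every value [evB f u] would be free of N, including [Theta (letter K i1)], which
    contains [bN]. *)
Lemma some_count : exists a x, x \in msupp (f a) /\ (0 < bcnt x)%N.
Proof.
apply: contrapT => no.
have : bN \in msupp (evB f (G i1)).
  rewrite ev_f FG /Theta ev_letter -mcoeff_neq0 /th /= mcoeffD !mcoeffU1 eqxx.
  by rewrite add0r oner_eq0.
move=> hN; suff : bcnt bN == 0%N by [].
apply: (@ev_supp K f (fun m : bm => bcnt m == 0%N) _ _ _ (G i1)) => //.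
- by move=> x y /eqP ex0 /eqP ey; rewrite bcntM ex0 ey.
- move=> a x xa; apply: contraT => x0; case: no; exists a, x; split=> //.
  by rewrite lt0n.
Qed.

(** In the plane of degree and number of N, a line through the point [(1, 0)] of the letters is
    turned until it supports the monomials with N: [m] maximizes [(bdeg m - 1) / bcnt m], and
    [A = bcnt m], [B = 1 - bdeg m] are the coefficients of that line. *)
Lemma slope : exists A B : int, [/\ 0 < A,
  forall a x, x \in msupp (f a) -> bwt A B x <= A,
  forall a x, x \in msupp (Theta (letter K a)) -> bwt A B x <= A &
  exists a x, [/\ x \in msupp (f a), (0 < bcnt x)%N & bwt A B x = A]].
Proof.
pose S := [seq m <- (msupp (f i0) : seq bm) ++ (msupp (f i1) : seq bm) | (0 < bcnt m)%N].
have memS a x : x \in msupp (f a) -> (0 < bcnt x)%N -> x \in S.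
  move=> xa x0; rewrite mem_filter x0 mem_cat; apply/orP.
  by have [e|e] := I2_cases a i01; [left|right]; rewrite e in xa; exact: xa.
have S0 : S != [::].
  by have [a [x [xa x0]]] := some_count; apply: contraTneq (memS a x xa x0) => ->.
have [m mS hm] := seq_argmax (fun m => ((bdeg m)%:~R - 1) / (bcnt m)%:~R : rat) S0.
have m0 : (0 < bcnt m)%N by move: mS; rewrite mem_filter => /andP[].
have bm : bwt (bcnt m) (1 - (bdeg m)%:Z) m = bcnt m by rewrite /bwt; ring.
exists (bcnt m), (1 - (bdeg m)%:Z); split.
- by [].
- move=> a x xa; have [x0|x0] := posnP (bcnt x).
    have xE : x = bx x.1 by case: x x0 {xa} => [w [|]].
    move: xa; rewrite xE -mcoeff_neq0 f_count0; have [->|_] := eqVneq x.1 (ex a); last by rewrite eqxx.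
    by rewrite bwt_bx.
  have := hm x (memS a x xa x0); rewrite ler_pdivrMr ?ltr0z // mulrAC ler_pdivlMr ?ltr0z //.
  rewrite -[1]/(1%:~R) -!intrB -!intrM ler_int /bwt; move: (bcnt x) (bcnt m) (bdeg x) (bdeg m).
  by clear => *; lia.
- move=> a x; rewrite /Theta ev_letter /th => /(fsubsetP (msuppD_le _ _)).
  rewrite in_fsetU => /orP[].
    by move/(fsubsetP msuppU_le); rewrite in_fset1 => /eqP->; rewrite bwt_bx.
  case: (a == i0); first by rewrite msupp0.
  move/(fsubsetP msuppU_le); rewrite in_fset1 => /eqP->.
  (* N itself has weight [1 - bdeg m <= 1 <= bcnt m]. *)
  by move: m0; rewrite /bwt /bdeg /bcnt /= mulr0 add0r mulr1; clear; lia.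
- move: mS; rewrite mem_filter mem_cat => /andP[_ /orP[h|h]].
    by exists i0, m.
  by exists i1, m.
Qed.

(** [f i0] and [f i1] both lead in weight [A], one of them with N. If their leading monomials
    differ, [ev_lead_short] makes [G a] affine, since [evB f (G a) = Theta (letter K a)] has weight
    at most [A]; abelianization then fixes the coefficients. If they coincide, [F i1] is first
    replaced by [F i1 - c *: F i0]. *)
Lemma aut_letter a : F a = letter K a.
Proof.
have [A [B [A0 hf hT [a0 [x0 [xa x0c x0w]]]]]] := slope.
have exf b : bx (ex b) \in msupp (f b) by rewrite -mcoeff_neq0 f_count0 eqxx oner_eq0.
have lead_f b : exists m, lead (blt A B) m (f b).
  apply: (lead_exists (@blt_trans A B) (@blt_total A B)).
  by apply: contraTneq (exf b) => ->; rewrite msupp0.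
have wtl b m : lead (blt A B) m (f b) -> bwt A B m = A.
  move=> l; have lo := (lead_above l (exf b)).1; rewrite bwt_bx in lo.
  apply/eqP; rewrite eq_le lo andbT.
  by apply: (hf b); case: l => h _; rewrite -mcoeff_neq0.
have [m0 l0] := lead_f i0; have [m1 l1] := lead_f i1.
have cpos : (0 < bcnt m0 + bcnt m1)%N.
  rewrite addn_gt0; apply/orP; have [e|e] := I2_cases a0 i01; rewrite e in xa; [left|right].
    by apply: leq_trans x0c _; apply: (lead_above l0 xa).2; rewrite x0w (wtl _ _ l0).
  by apply: leq_trans x0c _; apply: (lead_above l1 xa).2; rewrite x0w (wtl _ _ l1).
have [m01|m01] := eqVneq m0 m1; last first.
  pose m (b : 'I_2) := if b == i0 then m0 else m1.
  have [] := @ev_short K _ (@central_malg K _) F (G a).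
  - apply: (@ev_lead_short K A B f m A (G a)); [| |exact: A0|exact: m01|exact: cpos|].
    + by move=> b; case: (I2_cases b i01) => ->; [exact: l0|exact: l1].
    + by move=> b; case: (I2_cases b i01) => ->; [exact: wtl l0|exact: wtl l1].
    + by rewrite ev_f FG; apply: hT.
  by move=> x [b [c]]; rewrite FG; apply: letter_span_eq.
rewrite -m01 in l1 cpos; clear m01 m1.
have m0c : (0 < bcnt m0)%N by move: cpos; rewrite addn_gt0 orbb.
pose c := mcoeff m0 (f i1) / mcoeff m0 (f i0).
pose F' (b : 'I_2) := if b == i0 then F i0 else F i1 - c *: F i0.
pose sb (b : 'I_2) := if b == i0 then letter K i0 else letter K i1 + c *: letter K i0.
pose f' b := Theta (F' b).
have f'1 : f' i1 = f i1 - c *: f i0 by exact: ThetaZD.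
have F'sb b : evR F' (sb b) = F b.
  have [->|->] := I2_cases b i01; first exact: ev_letter.
  rewrite -[sb i1]/(letter K i1 + c *: letter K i0) evD [X in _ + X]evZ.
  by rewrite ev_letter ev_letter; exact: subrK.
have F'u : evR F' (evR sb (G a)) = letter K a.
  by rewrite ev_comp -(FG a); apply: ev_ext.
(* The subtraction does not affect the letter of [f i1], so the new leading monomial still has
   weight [A]; it differs from [m0], whose coefficient is cancelled. *)
have exf' : bx (ex i1) \in msupp (f' i1).
  have c1 := f_count0 i1 (ex i1); have c0 := f_count0 i0 (ex i1).
  rewrite -mcoeff_neq0 f'1 mcoeffB mcoeffZ c1 c0 eqxx.
  by rewrite mulr0 subr0 oner_eq0.
have sf' x : x \in msupp (f' i1) -> x \in msupp (f i0) \/ x \in msupp (f i1).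
  rewrite f'1 => /(fsubsetP (msuppB_le _ _)); rewrite in_fsetU => /orP[h|/(fsubsetP (msuppZ_le _ _)) h].
    by right; exact: h.
  by left; exact: h.
have [m1 l1'] : exists m, lead (blt A B) m (f' i1).
  apply: (lead_exists (@blt_trans A B) (@blt_total A B)).
  by apply: contraTneq exf' => ->; rewrite msupp0.
have m1s : m1 \in msupp (f' i1) by case: l1' => h _; rewrite -mcoeff_neq0.
have m1w : bwt A B m1 = A.
  have lo := (lead_above l1' exf').1; rewrite bwt_bx in lo.
  apply/eqP; rewrite eq_le lo andbT.
  by case: (sf' _ m1s); apply: hf.
have m01 : m0 != m1.
  apply: contraTneq m1s => <-; rewrite -mcoeff_eq0 f'1 mcoeffB mcoeffZ /c.
  by rewrite divfK ?subrr //; case: l0.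
pose m (b : 'I_2) := if b == i0 then m0 else m1.
have [] := @ev_short K _ (@central_malg K _) F' (evR sb (G a)).
- apply: (@ev_lead_short K A B f' m A (evR sb (G a))); [| |exact: A0|exact: m01| |].
  + by move=> b; case: (I2_cases b i01) => ->; [exact: l0|exact: l1'].
  + by move=> b; case: (I2_cases b i01) => ->; [exact: wtl l0|exact: m1w].
  + by rewrite addn_gt0 m0c.
  + have -> : evB f' (evR sb (G a)) = Theta (letter K a) by rewrite -F'u /f' /Theta [in RHS]ev_comp.
    exact: hT.
move=> x [b [d]]; rewrite F'u /F' /= => e.
apply: (@letter_span_eq a x (b - d * c) d); rewrite e scalerBr scalerBl scalerA.
by rewrite -!addrA; congr (_ + (_ + _)); rewrite addrC.
Qed.

End Injectivity.

(** * Tameness *)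

Section Tame.
Variable K : closedFieldType.
Local Notation R := (free_alg2 K).
Local Notation A2 := (mpoly 2 K).
Local Notation evR := (ev (@central_malg K {fmonom 'I_2})).
Local Notation x0 := (letter K i0).
Local Notation x1 := (letter K i1).
Implicit Types (f g : R) (E F G : 'I_2 -> R).

Inductive tame : R -> R -> Prop :=
| tame_id : tame x0 x1
| tame_swap f g : tame f g -> tame g f
| tame_scale (c : K) f g : c != 0 -> tame f g -> tame (c *: f) g
| tame_elem (c : K) k f g : tame f g -> tame f (g + c *: f ^+ k).

Definition pr (f g : R) (a : 'I_2) := if a == i0 then f else g.

Lemma tame_scaler (c : K) f g : c != 0 -> tame f g -> tame f (c *: g).
Proof. by move=> c0 h; apply/tame_swap/tame_scale => //; apply: tame_swap. Qed.

Lemma tame_ev f g E : tame f g -> tame (E i0) (E i1) -> tame (evR E f) (evR E g).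
Proof.
elim=> {f g} [|f g _ IH|c f g c0 _ IH|c k f g _ IH] h.
- by rewrite ev_letter ev_letter.
- by apply: tame_swap; apply: IH.
- by rewrite evZ; apply: tame_scale => //; apply: IH.
- by rewrite evD [X in _ + X]evZ evX; apply: tame_elem; apply: IH.
Qed.

Definition inv2 F G := (forall a, evR F (G a) = letter K a) /\ (forall a, evR G (F a) = letter K a).

Lemma inv2C F G : inv2 F G -> inv2 G F. Proof. by case. Qed.

Lemma inv2_ev F G u : inv2 F G -> evR F (evR G u) = u.
Proof. by move=> [h _]; rewrite ev_comp -[RHS]ev_id; apply: ev_ext. Qed.

Lemma inv2_comp F G E E' : inv2 F G -> inv2 E E' ->
  inv2 (fun a => evR E (F a)) (fun a => evR G (E' a)).
Proof.
move=> FG EE; split=> a.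
  exact: etrans (esym (ev_comp _ F E (evR G (E' a)))) (etrans (congr1 (evR E) (inv2_ev (E' a) FG)) (EE.1 a)).
exact: etrans (esym (ev_comp _ E' G (evR E (F a)))) (etrans (congr1 (evR G) (inv2_ev (F a) (inv2C EE))) (FG.2 a)).
Qed.

Lemma ab_ev F u (S : 2.-tuple A2) : (forall a, ab K (F a) = tnth S a) ->
  ab K (evR F u) = comp_mpoly S (ab K u).
Proof.
move=> h; rewrite /ab ev_comp [RHS](@ev_post K _ _ _ (@central_alg K A2) (comp_mpoly S)).
by apply: ev_ext => a; rewrite [RHS](comp_mpolyXt S a); apply: h.
Qed.

Definition abt F : 2.-tuple A2 := [tuple ab K (F a) | a < 2].

Lemma tnth_abt F a : tnth (abt F) a = ab K (F a).
Proof. exact: tnth_mktuple. Qed.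

Lemma ab_letter a : ab K (letter K a) = 'X_a%R.
Proof. exact: ev_letter. Qed.

Lemma inv2_abt F G : inv2 F G -> inverse2 (abt F) (abt G).
Proof.
move=> [FG GF]; split=> a; rewrite tnth_abt.
  by rewrite -(ab_ev (F := G)) => [|b]; rewrite ?GF ?ab_letter ?tnth_abt.
by rewrite -(ab_ev (F := F)) => [|b]; rewrite ?FG ?ab_letter ?tnth_abt.
Qed.

Definition elem_subst (i j : 'I_2) b (r : K) (a : 'I_2) : R :=
  if a == j then letter K j + r *: letter K i ^+ b else letter K a.

Lemma elem_subst_inv i j b r : i != j -> inv2 (elem_subst i j b r) (elem_subst i j b (- r)).
Proof.
move=> ij.
have h r' a : evR (elem_subst i j b r') (elem_subst i j b (- r') a) = letter K a.
  have Ei r'' : elem_subst i j b r'' i = letter K i by rewrite /elem_subst (negPf ij).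
  have Ej r'' : elem_subst i j b r'' j = letter K j + r'' *: letter K i ^+ b by rewrite /elem_subst eqxx.
  have [->|->] := I2_cases a ij; first by rewrite Ei ev_letter Ei.
  rewrite Ej evD [X in _ + X]evZ evX ev_letter ev_letter Ei Ej.
  by rewrite scaleNr addrK.
by split=> a; [exact: h|have := h (- r) a; rewrite opprK].
Qed.

Lemma tame_elem_subst i j b r : i != j -> tame (elem_subst i j b r i0) (elem_subst i j b r i1).
Proof.
move=> ij; have hx r' : elem_subst i j b r' i = letter K i by rewrite /elem_subst (negPf ij).
have hy r' : elem_subst i j b r' j = letter K j + r' *: letter K i ^+ b by rewrite /elem_subst eqxx.
have [e|e] := I2_cases j i01; have [e'|e'] := I2_cases i i01; rewrite e e' in ij hx hy *.
- by rewrite eqxx in ij.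
- by apply: tame_swap; rewrite hx hy; apply: tame_elem; apply: tame_swap; apply: tame_id.
- by rewrite hx hy; apply: tame_elem; apply: tame_id.
- by rewrite eqxx in ij.
Qed.

(** By [jung_end2], [F i1] abelianizes to [c x_1 + u] with [u] in [x_0] alone. Lifting [u] to [q]
    and composing with the elementary [t] gives an automorphism trivial on K[x,y], hence the
    identity by [aut_letter]. *)
Lemma tame_end F G : inv2 F G -> ab K (F i0) = 'X_i0%R -> tame (F i0) (F i1).
Proof.
move=> FG h0.
have [c [u [c0 hu du]]] : exists c u, [/\ c != 0, tnth (abt F) i1 = c *: 'X_i1 + u & degv i1 u = 0%N].
  by apply: (jung_end2 i01 (inv2_abt FG)); rewrite tnth_abt.
rewrite tnth_abt in hu.
pose s := (mpoly.msupp u).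
pose q (f : R) : R := \sum_(m <- s) mpoly.mcoeff m u *: f ^+ (m : multinom 2) i0.
have abq : u = \sum_(m <- s) mpoly.mcoeff m u *: 'X_i0 ^+ (m : multinom 2) i0.
  rewrite {1}(mpolyE u); apply: eq_big_seq => m ms; congr (_ *: _).
  rewrite (X2E K m i01); have := degv_ge i1 ms; rewrite du leqn0 => /eqP->.
  by rewrite expr0 mulr1.
have evq E f : evR E (q f) = q (evR E f).
  rewrite /q ev_sum; apply: eq_bigr => m _; by rewrite evZ evX.
pose t := pr x0 (c^-1 *: (x1 - q x0)).
pose t' := pr x0 (c *: x1 + q x0).
have tt' : inv2 t t'.
  split=> a; have [->|->] := I2_cases a i01; try exact: ev_letter.
    rewrite -[t' i1]/(c *: x1 + q x0) evD evq ev_letter evZ ev_letter.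
    by rewrite -[t i1]/(c^-1 *: (x1 - q x0)) scalerA divff // scale1r subrK.
  rewrite -[t i1]/(c^-1 *: (x1 - q x0)) evZ evBr evq ev_letter ev_letter.
  by rewrite -[t' i1]/(c *: x1 + q x0) addrK scalerA mulVf // scale1r.
pose H a := evR F (t a).
have HG := inv2_comp tt' FG.
have Hl : forall a, H a = letter K a.
  apply: (@aut_letter K H _ HG.1) => a; have [->|->] := I2_cases a i01.
    by rewrite /H -[t i0]/x0 ev_letter h0.
  rewrite /H (@ab_ev F _ (abt F)) => [|b]; last by rewrite tnth_abt.
  rewrite -[t i1]/(c^-1 *: (x1 - q x0)) /ab evZ evBr ev_letter -/(ab K).
  have -> : ab K (q x0) = u.
    rewrite [RHS]abq /q /ab ev_sum; apply: eq_bigr => m _; by rewrite evZ evX ev_letter.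
  rewrite comp_mpolyZ comp_mpolyB comp_mpolyXt tnth_abt hu.
  have -> : comp_mpoly (abt F) u = u.
    rewrite {1}abq raddf_sum /= [RHS]abq; apply: eq_bigr => m _.
    by rewrite comp_mpolyZ rmorphXn /= comp_mpolyXt tnth_abt h0.
  by rewrite addrK scalerA mulVf // scale1r.
have F0 : F i0 = x0 by rewrite -(Hl i0) /H -[t i0]/x0 ev_letter.
have F1 : F i1 = c *: x1 + q x0.
  have := Hl i1; rewrite /H -[t i1]/(c^-1 *: (x1 - q x0)) evZ evBr evq ev_letter ev_letter F0 => <-.
  by rewrite scalerA divff // scale1r subrK.
rewrite F0 F1 /q -(big_map (fun m => ((m : multinom 2) i0, mpoly.mcoeff m u)) xpredT (fun kc => kc.2 *: x0 ^+ kc.1)).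
elim: [seq _ | m <- s] (c *: x1) (tame_scaler c0 tame_id) => [|kc l IH] g hg.
  by rewrite big_nil addr0.
by rewrite big_cons addrA; apply/IH/tame_elem.
Qed.

Lemma tame_eq f f' g g' : f = f' -> g = g' -> tame f g -> tame f' g'.
Proof. by move=> -> ->. Qed.

Lemma ev_aff E c d (u : R) : evR E (c *: u + d *: 1) = c *: evR E u + d *: 1.
Proof. by rewrite evD; congr (_ + _); [exact: evZ|rewrite evZ ev1]. Qed.

Lemma ev_affV (S : lalgType K) (sAr : central_scalars S) (E : 'I_2 -> S) c d (u : R) :
  ev sAr E (c *: (u - d *: 1)) = c *: (ev sAr E u - d *: 1).
Proof. by rewrite evZ evBr; congr (_ *: (_ - _)); rewrite evZ ev1. Qed.

Lemma tame_pre F E E' : inv2 E E' -> tame (E' i0) (E' i1) ->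
  tame (evR E (F i0)) (evR E (F i1)) -> tame (F i0) (F i1).
Proof.
move=> EE hE h.
exact: (tame_eq (inv2_ev (F i0) (inv2C EE)) (inv2_ev (F i1) (inv2C EE)) (tame_ev h hE)).
Qed.

Lemma tame_letters (i j : 'I_2) : i != j -> tame (letter K i) (letter K j).
Proof.
have [->|->] := I2_cases i i01; have [->|->] := I2_cases j i01 => // _.
  exact: tame_id.
exact/tame_swap/tame_id.
Qed.

(** Elementary substitutions lower [deg2] of the abelianized first component until one variable is
    left. That component is then affine by [jung_end1], an affine change of letters makes it [x_0],
    and [tame_end] concludes. *)
Lemma tame_of_inv2 F G : inv2 F G -> tame (F i0) (F i1).
Proof.
have [N] := ubnP (deg2 (ab K (F i0))); elim: N F G => // N IH F G hN FG.
have S0 : tnth (abt F) i0 = ab K (F i0) by apply: tnth_abt.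
have step E E' : inv2 E E' -> tame (E' i0) (E' i1) ->
    tame (evR E (F i0)) (evR E (F i1)) -> tame (F i0) (F i1) by apply: tame_pre.
have [|] := boolP ((0 < degv i0 (ab K (F i0)))%N && (0 < degv i1 (ab K (F i0)))%N).
  case/andP; rewrite -S0 => d0 d1.
  have [i [j [b [r [ij lt]]]]] := jung_step i01 (inv2_abt FG) d0 d1.
  have EE := elem_subst_inv b r ij.
  apply: (step _ _ EE); first exact: tame_elem_subst.
  apply: (IH (fun a => evR (elem_subst i j b r) (F a)) _ _ (inv2_comp FG EE)).
  rewrite (@ab_ev _ _ (subst2 j (r *: 'X_i ^+ b))).
    by rewrite S0 in lt; apply: leq_trans lt _.
  move=> a; rewrite tnth_subst2 /elem_subst; case: (a == j); last exact: ab_letter.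
  rewrite /ab evD; congr (_ + _); first exact: ev_letter.
  by rewrite evZ evX; congr (_ *: _ ^+ _); apply: ev_letter.
rewrite negb_and -!eqn0Ngt => h.
have [i [j [ij dj]]] : exists i j : 'I_2, i != j /\ degv j (tnth (abt F) i0) = 0%N.
  by rewrite S0; case/orP: h => /eqP h; [exists i1, i0|exists i0, i1].
have [al [be [al0 hal]]] := jung_end1 ij (inv2_abt FG) dj; rewrite S0 in hal.
have [E [Ei Ej]] : exists E, E i = al^-1 *: (x0 - be *: 1) /\ E j = x1.
  exists (fun a => if a == i then al^-1 *: (x0 - be *: 1) else x1).
  by rewrite eqxx eq_sym (negPf ij).
have [E' [E'0 E'1]] : exists E', E' i0 = al *: letter K i + be *: 1 /\ E' i1 = letter K j.
  by exists (pr (al *: letter K i + be *: 1) (letter K j)).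
have EE : inv2 E E'.
  split=> a.
    have [->|->] := I2_cases a i01; last by rewrite E'1 ev_letter Ej.
    rewrite E'0 ev_aff ev_letter Ei.
    rewrite scalerA (divff al0) scale1r.
    exact: subrK.
  have [->|->] := I2_cases a ij; last by rewrite Ej ev_letter E'1.
  rewrite Ei ev_affV ev_letter E'0.
  rewrite addrK scalerA (mulVf al0).
  exact: scale1r.
apply: (step _ _ EE).
  rewrite E'0 E'1; apply: tame_swap; rewrite -[1](expr0 (letter K j)); apply: tame_elem.
  by apply/tame_swap/tame_scale => //; apply: tame_letters.
apply: (tame_end (inv2_comp FG EE)).
rewrite (@ab_ev _ _ (abt E)) => [|a]; last by rewrite tnth_abt.
rewrite hal comp_mpolyD comp_mpolyZ comp_mpolyXt comp_mpolyC tnth_abt Ei.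
rewrite /ab ev_affV ev_letter scalerA (divff al0) scale1r.
by rewrite -mul_mpolyC mulr1 subrK.
Qed.

Theorem aut_tame (phi : {lrmorphism R -> R}) : bijective phi -> tame (phi x0) (phi x1).
Proof.
move=> [psi phiK psiK].
have [F FE] : exists F, forall a, F a = phi (letter K a) by exists (fun a => phi (letter K a)).
have [G GE] : exists G, forall a, G a = psi (letter K a) by exists (fun a => psi (letter K a)).
have phiE u : phi u = evR F u.
  by rewrite (ev_unique (@central_malg K _) phi u); apply: ev_ext => a; rewrite FE.
have FG a : evR F (G a) = letter K a by rewrite -phiE GE psiK.
suff FG' : inv2 F G by apply: (tame_eq (FE i0) (FE i1) (tame_of_inv2 FG')).
split; first exact: FG.
move=> a; apply: (can_inj phiK); rewrite phiE -FE.
transitivity (evR (@letter K) (F a)); last exact: ev_id.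
transitivity (evR (fun b => evR F (G b)) (F a)); first exact: ev_comp.
exact: ev_ext.
Qed.

Lemma inv2_ext F F' G : F =1 F' -> inv2 F G -> inv2 F' G.
Proof.
move=> FF [h1 h2]; split=> a; first by rewrite -(h1 a); apply: ev_ext => b; rewrite FF.
by rewrite -FF; exact: h2.
Qed.

Lemma tame_inv2 f g : tame f g -> exists G, inv2 (pr f g) G.
Proof.
have step s s' (h k f' g' : R) : inv2 s s' -> (exists G, inv2 (pr h k) G) ->
    evR (pr h k) (s i0) = f' -> evR (pr h k) (s i1) = g' -> exists G, inv2 (pr f' g') G.
  move=> ss [G hG] e0 e1; exists (fun a => evR s' (G a)).
  apply: (inv2_ext _ (inv2_comp ss hG)) => a.
  by have [->|->] := I2_cases a i01; [exact: e0|exact: e1].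
elim=> {f g} [|f g _ IH|c f g c0 _ IH|c k f g _ IH].
- exists (@letter K); apply: (@inv2_ext (@letter K)) => [a|].
    by case: (I2_cases a i01) => ->.
  by split=> a; apply: ev_id.
- have [s [s0 s1]] : exists s, s i0 = x1 /\ s i1 = x0 by exists (pr x1 x0).
  apply: (step s s f g _ _ _ IH).
  + by split=> a; case: (I2_cases a i01) => ->; rewrite ?s0 ?s1 ev_letter.
  + by rewrite s0; apply: ev_letter.
  + by rewrite s1; apply: ev_letter.
- have [s [s0 s1]] : exists s, s i0 = c *: x0 /\ s i1 = x1 by exists (pr (c *: x0) x1).
  have [s' [s'0 s'1]] : exists s, s i0 = c^-1 *: x0 /\ s i1 = x1 by exists (pr (c^-1 *: x0) x1).
  apply: (step s s' f g _ _ _ IH).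
  + split=> a; case: (I2_cases a i01) => ->.
    * by rewrite s'0 evZ ev_letter s0 scalerA (mulVf c0) scale1r.
    * by rewrite s'1 ev_letter s1.
    * by rewrite s0 evZ ev_letter s'0 scalerA (divff c0) scale1r.
    * by rewrite s1 ev_letter s'1.
  + by rewrite s0 evZ; congr (_ *: _); apply: ev_letter.
  + by rewrite s1; apply: ev_letter.
apply: (step _ _ f g _ _ (elem_subst_inv k c i01) IH); first exact: ev_letter.
transitivity (evR (pr f g) (x1 + c *: x0 ^+ k)); first by congr (evR _ _).
rewrite evD; congr (_ + _); first exact: ev_letter.
rewrite evZ evX; exact: (congr1 (fun u => c *: u ^+ k) (ev_letter _ (pr f g) i0)).
Qed.

Lemma tame_aut f g : tame f g -> exists phi : {lrmorphism R -> R},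
  [/\ bijective phi, phi x0 = f & phi x1 = g].
Proof.
move=> /tame_inv2[G h]; exists (evR (pr f g)); split; [|exact: ev_letter|exact: ev_letter].
by exists (evR G) => u; apply: inv2_ev => //; apply: inv2C.
Qed.

End Tame.

(** * Degrees *)

Section CommDegree.
Variables (K : fieldType) (n : nat).
Local Notation A := (mpoly n K).
Implicit Types (u v : A).

Lemma msize_lt_add u v : (mpoly.msize u < mpoly.msize v)%N -> mpoly.msize (u + v) = mpoly.msize v.
Proof.
move=> h; apply/eqP; rewrite eqn_leq; apply/andP; split.
  by apply: leq_trans (mpoly.msizeD_le _ _) _; rewrite geq_max (ltnW h) /=.
have : (mpoly.msize ((u + v) - u) <= maxn (mpoly.msize (u + v)) (mpoly.msize (- u)))%N by apply: mpoly.msizeD_le.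
by rewrite addrC addrA addNr add0r mpoly.msizeN leq_max leqNgt => /orP[//|]; rewrite leqNgt h.
Qed.

Lemma msize_exp u e k : mpoly.msize u = e.+1 -> mpoly.msize (u ^+ k) = (k * e).+1.
Proof.
move=> h; have u0 : u != 0 by rewrite -mpoly.msize_poly_eq0 h.
elim: k => [|k IH]; first by rewrite expr0 mpoly.msize1.
by rewrite exprS mpoly.msizeM ?expf_neq0 // h IH mulSn; lia.
Qed.

Lemma msize_scale (c : K) u : c != 0 -> mpoly.msize (c *: u) = mpoly.msize u.
Proof.
move=> c0; apply/eqP; rewrite eqn_leq mpoly.msizeZ_le.
have := mpoly.msizeZ_le (c *: u) c^-1; by rewrite scalerA mulVf // scale1r.
Qed.

Lemma msize_pev (sAr : central_scalars A) u e (p : {poly K}) d : (0 < e)%N -> size p = d.+1 ->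
  mpoly.msize u = e.+1 -> mpoly.msize (pev sAr u p) = (d * e).+1.
Proof.
move=> e0 sp su; have pd : p`_d != 0.
  by have := lead_coef_eq0 p; rewrite lead_coefE sp /= -size_poly_eq0 sp => ->.
rewrite pevE sp big_ord_recr /=.
have top : mpoly.msize (p`_d *: u ^+ d) = (d * e).+1 by rewrite msize_scale ?(msize_exp d su).
rewrite -top; apply: msize_lt_add; rewrite top.
elim/big_ind: _ => [|a b ha hb|i _]; first by rewrite mpoly.msize0.
  by apply: leq_ltn_trans (mpoly.msizeD_le _ _) _; rewrite gtn_max ha hb.
apply: leq_ltn_trans (mpoly.msizeZ_le _ _) _; rewrite (msize_exp i su) ltnS ltn_mul2r e0.
exact: ltn_ord.
Qed.

End CommDegree.

Section TowerDegree.
Variables (K : fieldType).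
Local Notation A := (mpoly 2 K).

Lemma tower_all (S : lalgType K) (sAr : central_scalars S) (x y : S) ds : forall f g,
  tower sAr x y ds f g -> all (fun d => 1 < d)%N ds.
Proof. by elim: ds => //= d ds IH f g [p [h [-> _ _ /IH]]]. Qed.

Lemma prod_pos ds : all (fun d => 1 < d)%N ds -> (0 < \prod_(d <- ds) d)%N.
Proof.
elim: ds => [|d ds IH] /=; first by rewrite big_nil.
by move=> /andP[d1 /IH h]; rewrite big_cons muln_gt0 h ltnW.
Qed.

Lemma msize_affine (a b c : K) : (mpoly.msize (a *: 'X_i0 + b *: 'X_i1 + c *: 1 : A) <= 2)%N.
Proof.
have le1 i (k : K) : (mpoly.msize (k *: 'X_i : A) <= 2)%N.
  by apply: leq_trans (mpoly.msizeZ_le _ _) _; rewrite mpoly.msizeX mpoly.mdeg1.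
apply: leq_trans (mpoly.msizeD_le _ _) _; rewrite geq_max; apply/andP; split.
  by apply: leq_trans (mpoly.msizeD_le _ _) _; rewrite geq_max !le1.
by apply: leq_trans (mpoly.msizeZ_le _ _) _; rewrite mpoly.msize1.
Qed.

Lemma mcoeff_affine (a b c : K) i : mpoly.mcoeff U_(i)%MM (a *: 'X_i0 + b *: 'X_i1 + c *: 1 : A)
  = a * (i == i0)%:R + b * (i == i1)%:R.
Proof.
have u0 : (U_(i) == 0 :> multinom 2)%MM = false.
  by apply/negP => /eqP/mnmP/(_ i); rewrite mnm1E mnm0E eqxx.
have uu j : (U_(j) == U_(i) :> multinom 2)%MM = (i == j).
  apply/eqP/eqP => [/mnmP/(_ j)|->//]; rewrite !mnm1E eqxx.
  by case: (eqVneq i j).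
by rewrite !mpoly.mcoeffD !mpoly.mcoeffZ !mpoly.mcoeffX mpoly.mcoeff1 u0 !uu mulr0 addr0.
Qed.

(** At each step the polynomial part has degree [d * e > e], which [h], of degree at most [e],
    cannot cancel. *)
Lemma tower_msize (sAr : central_scalars A) ds : forall u v, tower sAr 'X_i0 'X_i1 ds u v ->
  mpoly.msize u = (\prod_(d <- ds) d).+1 /\ (mpoly.msize v <= (\prod_(d <- ds) d).+1)%N.
Proof.
elim: ds => [|d ds IH] u v /=.
  rewrite big_nil => -[a [b [c [a' [b' [c' [D -> ->]]]]]]]; split; last exact: msize_affine.
  apply/eqP; rewrite eqn_leq msize_affine /=.
  have [i hi] : exists i, mpoly.mcoeff U_(i)%MM (a *: 'X_i0 + b *: 'X_i1 + c *: 1 : A) != 0.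
    have [a0|a0] := eqVneq a 0; last first.
      by exists i0; rewrite mcoeff_affine /= mulr1 mulr0 addr0.
    exists i1; rewrite mcoeff_affine /= mulr1 mulr0 add0r.
    by apply: contraNneq D => ->; rewrite a0 mulr0 mul0r subr0.
  by rewrite -mpoly.mcoeff_msupp in hi; have := mpoly.msize_mdeg_lt hi; rewrite mpoly.mdeg1.
move=> [p [h [d1 sp -> th]]]; rewrite big_cons; have [su sh] := IH _ _ th.
set e := (\prod_(_ <- _) _)%N in su sh *.
have e0 : (0 < e)%N := prod_pos (tower_all th).
have sp' := msize_pev sAr e0 sp su.
split; last by rewrite su ltnS leq_pmull // ltnW.
rewrite addrC -sp'; apply: msize_lt_add; rewrite sp'; apply: leq_ltn_trans sh _.
by rewrite ltnS -[X in (X < _)%N]mul1n ltn_mul2r e0.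
Qed.

End TowerDegree.

Section FreeDegree.
Variables (K : closedFieldType).
Local Notation R := (free_alg2 K).
Implicit Types (f g : R).

Definition dle N f := forall w, w \in msupp f -> (fdeg w <= N)%N.

Lemma dleW N M f : (N <= M)%N -> dle N f -> dle M f.
Proof. by move=> NM h w /h le; apply: leq_trans NM. Qed.

Lemma dleD N f g : dle N f -> dle N g -> dle N (f + g).
Proof.
by move=> hf hg w /(fsubsetP (msuppD_le _ _)); rewrite in_fsetU => /orP[/hf|/hg].
Qed.

Lemma dleZ N c f : dle N f -> dle N (c *: f).
Proof. by move=> hf w /(fsubsetP (msuppZ_le _ _)) /hf. Qed.

Lemma dleM N M f g : dle N f -> dle M g -> dle (N + M) (f * g).
Proof.
by move=> hf hg w /msuppM_le[u [v [/hf hu /hg hv ->]]]; rewrite fdegM leq_add.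
Qed.

Lemma dleU N (w : {fmonom 'I_2}) : (fdeg w <= N)%N -> dle N << w >>.
Proof. by move=> h v; rewrite msuppU1 in_fset1 => /eqP->. Qed.

Lemma dle1 N : dle N 1.
Proof. by apply: dleU; rewrite fdeg1. Qed.

Lemma dle_letter a : dle 1 (letter K a).
Proof. by apply: dleU; rewrite fdegU. Qed.

Lemma dleX N f k : dle N f -> dle (k * N) (f ^+ k).
Proof.
move=> hf; elim: k => [|k IH]; first by rewrite expr0; apply: dle1.
by rewrite exprS mulSn; apply: dleM.
Qed.

Lemma dle_deg N f : dle N f -> (deg f <= N)%N.
Proof.
move=> h; rewrite /deg -subn1 leq_subLR add1n mmeasureE.
by apply/bigmax_leqP_seq => w wf _; rewrite ltnS; apply: h.
Qed.

Lemma deg_dle f : dle (deg f) f.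
Proof.
move=> w wf; rewrite /deg; have := mmeasure_mnm_lt (@fdeg 'I_2) wf.
by case: (mmeasure _ f).
Qed.

Lemma dle_ab N f : dle N f -> (mpoly.msize (ab K f) <= N.+1)%N.
Proof.
move=> h; rewrite /ab mevE big_seq; elim/big_ind: _ => [|a b ha hb|w wf].
- by rewrite mpoly.msize0.
- by apply: leq_trans (mpoly.msizeD_le _ _) _; rewrite geq_max ha hb.
apply: leq_trans (mpoly.msizeZ_le _ _) _; apply: leq_trans (_ : (fdeg w).+1 <= _)%N; last exact: h.
rewrite /wordev /fdeg.
suff [m -> <-] : exists2 m, \prod_(a <- (w : seq 'I_2)) 'X_a = mpolyX K m & mpoly.mdeg m = size w.
  by rewrite mpoly.msizeX.
elim: (w : seq _) => [|a s [m IH hm]]; first by exists 0%MM; rewrite ?big_nil ?mpolyX0 ?mpoly.mdeg0.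
by exists (U_(a) + m)%MM; rewrite ?big_cons ?IH ?mpolyXD // mdegD mpoly.mdeg1 /= -hm.
Qed.

Local Notation sAR := (@central_malg K {fmonom 'I_2}).
Local Notation x0 := (letter K i0).
Local Notation x1 := (letter K i1).
Local Notation towerR := (tower sAR x0 x1).

Lemma tower_dle ds : forall f g, towerR ds f g ->
  dle (\prod_(d <- ds) d) f /\ dle (\prod_(d <- ds) d) g.
Proof.
elim: ds => [|d ds IH] f g /=.
  rewrite big_nil => -[a [b [c [a' [b' [c' [D -> ->]]]]]]].
  have aff k l m : dle 1 (k *: x0 + l *: x1 + m *: 1).
    by do !apply: dleD; apply: dleZ; [exact: dle_letter|exact: dle_letter|exact: dle1].
  by split; apply: aff.
move=> [p [h [d1 sp -> /IH[hf hh]]]]; rewrite big_cons; set e := (\prod_(_ <- _) _)%N in hf hh *.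
have le : (e <= d * e)%N by rewrite leq_pmull // ltnW.
split; last exact: dleW le hf.
apply: dleD; last exact: dleW le hh.
rewrite pevE sp; elim/big_ind: _ => [|a b|i _]; [by move=> w; rewrite msupp0|exact: dleD|].
apply: dleZ; apply: (dleW _ (@dleX e g i hf)).
by rewrite leq_mul2r -ltnS ltn_ord orbT.
Qed.

(** The upper bound counts word lengths. The lower one comes from abelianization, which never raises
    degrees and where the degree of a tower is known exactly. *)
Lemma tower_deg ds f g : towerR ds f g -> deg f = (\prod_(d <- ds) d)%N.
Proof.
move=> h; have [hf _] := tower_dle h; apply/eqP; rewrite eqn_leq (dle_deg hf) /=.
have h' := tower_morph (@central_alg K _) (ab K) h.
rewrite !ab_letter in h'; have [s _] := tower_msize h'.
by have := dle_ab (@deg_dle f); rewrite s ltnS.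
Qed.

(** The flag tells which component is on top; as in [good], the shear [mu] occurs only for the first
    one. *)
Definition locus_pair ds (b : bool) f g :=
  if b then exists h mu, towerR ds f h /\ g = h + mu *: f else towerR ds g f.

Lemma locus_pair_deg ds b f g : locus_pair ds b f g -> maxn (deg f) (deg g) = (\prod_(d <- ds) d)%N.
Proof.
case: b => /= [[h [mu [th ->]]]|th].
  have [hf hh] := tower_dle th; rewrite (tower_deg th); apply/maxn_idPl.
  by apply: dle_deg; apply: dleD => //; apply: dleZ.
have [hg hf] := tower_dle th; rewrite (tower_deg th); apply/maxn_idPr.
exact: dle_deg.
Qed.

Lemma locus_pair_tame ds b f g : locus_pair ds b f g -> tame f g.
Proof.
have rel f' g' : towerR ds f' g' -> tame f' g'.
  apply: (@tower_rel K R sAR x0 x1 (@tame K)); [exact: tame_id|exact: tame_swap|exact: tame_scale|exact: tame_elem].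
case: b => /= [[h [mu [th ->]]]|th]; last by apply/tame_swap/rel.
by rewrite -[f in mu *: f]expr1; apply/tame_elem/rel.
Qed.

Lemma tame_good f g : tame f g -> good sAR x0 x1 f g.
Proof.
elim=> {f g} [|f g _ IH|c f g c0 _ IH|c k f g _ IH].
- exact: good_id.
- exact: good_swap.
- exact: good_scale.
- exact: good_elem.
Qed.

Lemma good_locus f g : good sAR x0 x1 f g -> exists ds b, locus_pair ds b f g.
Proof.
move=> [ds [[m h]|h]]; exists ds; last by exists false.
by exists true, (g - m *: f), m; split; [exact: h|exact: esym (subrK _ _)].
Qed.

Lemma locus_pair_all ds b f g : locus_pair ds b f g -> all (fun d => 1 < d)%N ds.
Proof. by case: b => /= [[h [mu [/tower_all]]]|/tower_all]. Qed.

End FreeDegree.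

(** * Parametrization of the automorphisms *)

Section Families.
Variables (K : closedFieldType) (n : nat).
Local Notation R := (free_alg2 K).
Local Notation sAR := (@central_malg K {fmonom 'I_2}).
Local Notation x0 := (letter K i0).
Local Notation x1 := (letter K i1).
Local Notation p := (2 ^ n.+2 - 2)%N.

Definition pt (f g : R) : affine_space K p :=
  \row_i let: (a, w) := @coord_of n i in mcoeff (FMonom (tagged w)) (pr f g a).

Lemma endo_point_pt (phi : {lrmorphism R -> R}) : endo_point n phi = pt (phi x0) (phi x1).
Proof.
apply/rowP => i; rewrite !mxE; case: (coord_of i) => a w; congr mcoeff.
by case: (I2_cases a i01) => ->.
Qed.

Lemma endo_degE (phi : {lrmorphism R -> R}) : endo_deg phi = maxn (deg (phi x0)) (deg (phi x1)).
Proof.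
have e0 : (0 : 'I_2) = i0 by apply: val_inj.
have e1 : (1 : 'I_2) = i1 by apply: val_inj.
by rewrite /endo_deg e0 e1.
Qed.

Lemma polyf_mcoeff m (U : ('I_m -> K) -> R) w : polyS U -> polyf (fun t => mcoeff w (U t)).
Proof.
move=> [L hL]; exists (\sum_(z <- L) mcoeff w z.1 *: z.2) => t.
rewrite hL raddf_sum raddf_sum /=; apply: eq_bigr => z _.
by rewrite mevalZ mcoeffZ mulrC.
Qed.

Lemma param_image m P : @param K R m P -> exists x : ('I_p -> mpoly m K) * mpoly m K,
  forall v, (exists f g, P f g /\ v = pt f g) <-> in_image x.1 x.2 v.
Proof.
move=> [U [V [D [hU hV [q hq] H]]]].
have : forall j : 'I_p, exists r : mpoly m K, forall t, (pt (U t) (V t) : 'rV[K]_p) 0 j = r.@[t].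
  move=> j; case E: (@coord_of n j) => [a w].
  have [r hr] : polyf (fun t => mcoeff (FMonom (tagged w)) (pr (U t) (V t) a)).
    by case: (I2_cases a i01) => ->; apply: polyf_mcoeff.
  by exists r => t; rewrite mxE E; apply: hr.
move/choice => [r hr]; exists (r, q) => v; split=> [[f [g [/H[t [Dt -> ->]] ->]]]|[t [Dt hv]]].
  by exists t; split; [rewrite -hq|move=> j; apply: hr].
exists (U t), (V t); split; first by apply/H; exists t; split=> //; rewrite hq.
by apply/rowP => j; rewrite hv -hr.
Qed.

Hypothesis hn : (2 <= n)%N.

Lemma aut_locusP v : aut_locus K n v <-> exists ds b,
  (\prod_(d <- ds) d = n)%N /\ exists f g, locus_pair ds b f g /\ v = pt f g.
Proof.
split=> [[phi [bij dg ->]]|[ds [b [pn [f [g [fg ->]]]]]]].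
  have [ds [b h]] := good_locus (tame_good (aut_tame bij)).
  exists ds, b; split; first by rewrite -(locus_pair_deg h) -endo_degE.
  by exists (phi x0), (phi x1); split; [exact: h|exact: endo_point_pt].
have [phi [bij e0 e1]] := tame_aut (locus_pair_tame fg).
exists phi; split; first exact: bij.
  by rewrite endo_degE e0 e1 (locus_pair_deg fg).
by rewrite endo_point_pt e0 e1.
Qed.

Local Notation idx := (bool * {k : 'I_n.+1 & k.-tuple 'I_n.+1})%type.
(** Lists of length at most [n] with entries at most [n] form a finite type that contains every
    factorization of [n] into factors above 1. *)
Definition degs (i : idx) : seq nat := map val (tagged i.2 : seq 'I_n.+1).

Lemma degs_surj ds b : all (fun d => 1 < d)%N ds -> (\prod_(d <- ds) d = n)%N ->
  exists i : idx, i.1 = b /\ degs i = ds.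
Proof.
move=> h pn.
have sz : (size ds < n.+1)%N.
  rewrite ltnS -pn; elim: ds h {pn} => [|d ds IH] //= /andP[d1 h]; rewrite big_cons.
  have := IH h; have := prod_pos h; move: (\prod_(_ <- _) _)%N => e; nia.
have le d : d \in ds -> (d < n.+1)%N.
  move=> dd; rewrite ltnS -pn (big_rem d) //= leq_pmulr //.
  have := prod_pos h; rewrite (big_rem d) //= muln_gt0 => /andP[_]; exact.
pose s := [seq inord d | d <- ds] : seq 'I_n.+1.
have ss : size s == Ordinal sz :> nat by rewrite size_map.
exists (b, Tagged (fun k : 'I_n.+1 => k.-tuple 'I_n.+1) (Tuple ss)); split=> //.
rewrite /degs /= -map_comp -[RHS]map_id; apply/eq_in_map => d /le dd.
exact: inordK.
Qed.

Theorem aut_families : exists (I : finType) (m : I -> nat)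
    (pi : forall i, 'I_p -> mpoly (m i) K) (D : forall i, mpoly (m i) K),
  (forall i, (m i <= n + 6)%N) /\
  (forall v, aut_locus K n v <-> exists i, in_image (pi i) (D i) v).
Proof.
pose T (i : idx) (x : {m : nat & (('I_p -> mpoly m K) * mpoly m K)%type}) :=
  (tag x <= n + 6)%N /\ forall v, in_image (tagged x).1 (tagged x).2 v <->
    (\prod_(d <- degs i) d = n)%N /\ exists f g, locus_pair (degs i) i.1 f g /\ v = pt f g.
have : forall i, exists x, T i x.
  move=> [b w]; set ds := degs (b, w); rewrite /T /= -/ds.
  have [/andP[h /eqP pn]|no] := boolP (all (fun d => 1 < d)%N ds && (\prod_(d <- ds) d == n)%N); last first.
    (* An index that does not encode a factorization gets the empty image: [D = 0] vanishes
       everywhere. *)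
    exists (existT _ 0%N (fun=> 0, 0)); split=> // v; split=> [[t []]|[pn [f [g [fg _]]]]].
      by rewrite /= meval0 eqxx.
    by case/negP: no; rewrite pn eqxx andbT; apply: locus_pair_all fg.
  have ds0 : ds != [::] by apply: contraTneq hn => e; rewrite -pn e big_nil.
  have [cl _] := cnt_le ds0 h; rewrite pn in cl.
  have pd := @param_tower K R sAR x0 x1 ds h.
  have [m [le hm]] : exists m, (m <= n + 6)%N /\ param m (@locus_pair K ds b).
    case: (b).
      exists (cnt ds + 1)%N; split; first by move: cl; clear; lia.
      exact: param_twist.
    exists (cnt ds); split; first by move: cl; clear; lia.
    exact: (param_swap pd).
  have [x hx] := param_image hm.
  by exists (existT _ m x); split=> // v; rewrite -hx; split=> [h'|[]].
move/choice => [F hF].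
exists idx, (fun i => tag (F i)), (fun i => (tagged (F i)).1), (fun i => (tagged (F i)).2).
split=> [i|v]; first by case: (hF i).
rewrite aut_locusP; split=> [[ds [b [pn [f [g [fg e]]]]]]|[i /(hF i).2[pn h]]].
  have [i [ib id]] := degs_surj b (locus_pair_all fg) pn.
  by exists i; apply/(hF i).2; rewrite id ib; split=> //; exists f, g.
by exists (degs i), i.1.
Qed.

End Families.

(** * A family with n + 6 parameters *)

Section FamilyTower.
Variables (K : fieldType) (S : lalgType K).
Hypothesis sAr : central_scalars S.
Variables x y : S.

(** The coefficient of [x] in the second component is chosen so that subtracting [mu *: f] leaves
    [de *: l + e *: 1], which lets [s] be rewritten as a polynomial in that element. The coefficient
    of [y] in [l] is set to 1 because the [q i] absorb a scaling. *)
Lemma family_tower n (a b c b' c' mu al : K) (q : nat -> K) :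
  (1 < n)%N -> q n != 0 -> b' - mu * b != 0 -> a - b * al != 0 ->
  let l := al *: x + y in
  let s := \sum_(i < n.+1) q i *: l ^+ i in
  let f := a *: x + b *: y + c *: 1 + s in
  exists h, tower sAr x y [:: n] f h /\
    (mu * a + al * (b' - mu * b)) *: x + b' *: y + c' *: 1 + mu *: s = h + mu *: f.
Proof.
move=> n1 qn de0 D l s f; set de := b' - mu * b in de0 *; pose e := c' - mu * c.
exists (de *: l + e *: 1); split; last first.
  rewrite [mu *: f]scalerDr (scale3 x y mu a b c) addrA; congr (_ + _).
  rewrite [de *: l]scalerDr scalerA add3; congr (_ *: _ + _ *: _ + _ *: _).
  - by rewrite addrC [al * _]mulrC.
  - by rewrite /de subrK.
  - by rewrite /e subrK.
pose Q := \poly_(i < n.+1) q i.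
have sQ : size Q = n.+1 by apply: size_poly_eq.
exists (Q \Po (de^-1 *: 'X + (- (e / de))%:P)), (a *: x + b *: y + c *: 1); split=> //.
- by rewrite comp_sub_size ?invr_eq0.
- rewrite pev_comp pevD pevZ pevX pevC scalerDr !scalerA mulVf // scale1r -addrA -scalerDl.
  rewrite [e / de]mulrC subrr scale0r addr0 pevE sQ /f addrC; congr (_ + _).
  by apply: eq_bigr => i _; rewrite coef_poly ltn_ord.
exists (de * al), de, e, a, b, c; split.
- have -> : de * al * b - a * de = - (de * (a - b * al)) by ring.
  by rewrite oppr_eq0 mulf_neq0.
- by rewrite /l scalerDr scalerA.
- by [].
Qed.

End FamilyTower.

(** * Coefficients of the family at words *)

Section WordCoef.
Variable K : closedFieldType.
Local Notation R := (free_alg2 K).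
Local Notation x0 := (letter K i0).
Local Notation x1 := (letter K i1).
Local Notation W s := (FMonom s : {fmonom 'I_2}).

Lemma mcoeff_cons a b s (u : R) : mcoeff (W (b :: s)) (letter K a * u) = (a == b)%:R * mcoeff (W s) u.
Proof.
rewrite /letter malgM_def fgmulUg raddf_sum /=.
rewrite (eq_bigr (fun k => (a == b)%:R * (mcoeff k u *+ (k == W s)))) => [|k _]; last first.
  rewrite mcoeffU mul1r.
  have -> : (mmul (fmu a) k == W (b :: s)) = (a == b) && (k == W s).
    by rewrite !fmP fmM fmU /= eqseq_cons.
  by case: (a == b); rewrite ?mul1r ?mul0r ?mulr0n.
rewrite -mulr_sumr; congr (_ * _).
have [ku|ku] := boolP (W s \in msupp u).
  by rewrite (bigD1_seq _ ku) ?fset_uniq //= eqxx big1 ?addr0 // => k /negPf->.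
rewrite (mcoeff_outdom ku) big_seq big1 // => k kk.
by case: eqP => // e; rewrite e (negPf ku) in kk.
Qed.

Lemma mcoeff_nil a (u : R) : mcoeff (W [::]) (letter K a * u) = 0.
Proof.
rewrite /letter malgM_def fgmulUg raddf_sum /= big1 // => k _; rewrite mcoeffU.
have -> : (mmul (fmu a) k == W [::]) = false by rewrite fmP fmM fmU.
by rewrite mulr0n.
Qed.

(** When the power is expanded without commuting letters, each word of length [i] arises once, with
    one factor [al] per letter [x0]. *)
Lemma mcoeff_pow al i s : mcoeff (W s) ((al *: x0 + x1) ^+ i)
  = (size s == i)%:R * al ^+ count_mem i0 s.
Proof.
elim: i s => [|i IH] s.
  rewrite expr0 mcoeff1; case: s => [|b s] /=; first by rewrite -fmoneE eqxx mulr1.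
  by rewrite fmP fm1 /= mul0r.
rewrite exprS mulrDl mcoeffD -scalerAl mcoeffZ; case: s => [|b s].
  transitivity (al * 0 + 0); last by rewrite mulr0 addr0 mul0r.
  by congr (al * _ + _); exact: mcoeff_nil.
transitivity (al * ((i0 == b)%:R * ((size s == i)%:R * al ^+ count_mem i0 s)) +
   (i1 == b)%:R * ((size s == i)%:R * al ^+ count_mem i0 s)).
  by congr (al * _ + _); rewrite -IH; exact: mcoeff_cons.
rewrite [size (b :: s)]/= [count_mem _ _]/= eqSS exprD.
case: (I2_cases b i01) => ->; rewrite ?eqxx /= ?mul1r ?mul0r ?addr0.
  by rewrite expr1 mulrCA.
by rewrite mulr0 add0r.
Qed.

Lemma mcoeff_affine_words (a b c : K) s : mcoeff (W s) (a *: x0 + b *: x1 + c *: 1)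
  = a * (s == [:: i0])%:R + b * (s == [:: i1])%:R + c * (s == [::])%:R.
Proof.
have hl i : mcoeff (W s) (letter K i) = (s == [:: i])%:R.
  by rewrite /letter mcoeffU1 fmP fmU eq_sym.
rewrite mcoeffD; congr (_ + _); last by rewrite mcoeffZ mcoeff1 fmP fm1.
rewrite mcoeffD; congr (_ + _); rewrite mcoeffZ; congr (_ * _); exact: hl.
Qed.

Lemma mcoeff_family (a b c k al : K) (q : nat -> K) n s : (size s <= n)%N ->
  mcoeff (W s) (a *: x0 + b *: x1 + c *: 1 + k *: \sum_(i < n.+1) q i *: (al *: x0 + x1) ^+ i)
  = a * (s == [:: i0])%:R + b * (s == [:: i1])%:R + c * (s == [::])%:R
    + k * (q (size s) * al ^+ count_mem i0 s).
Proof.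
rewrite -ltnS => sn; rewrite mcoeffD; congr (_ + _); first exact: mcoeff_affine_words.
rewrite mcoeffZ; congr (_ * _); rewrite raddf_sum /=.
rewrite (eq_bigr (fun i : 'I_n.+1 => q i * ((size s == i)%:R * al ^+ count_mem i0 s))) => [|i _]; last first.
  by rewrite mcoeffZ; congr (_ * _); apply: mcoeff_pow.
rewrite (bigD1 (Ordinal sn)) //= eqxx mul1r big1 ?addr0 // => i ne.
case: eqP => [e|_]; last by rewrite mul0r mulr0.
by case/eqP: ne; apply: val_inj.
Qed.

End WordCoef.

Section Family.
Variables (K : closedFieldType) (n : nat).
Hypothesis hn : (2 <= n)%N.
Local Notation R := (free_alg2 K).
Local Notation x0 := (letter K i0).
Local Notation x1 := (letter K i1).
Local Notation N := (6 + n)%N.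
Local Notation p := (2 ^ n.+2 - 2)%N.
Local Notation W s := (FMonom s : {fmonom 'I_2}).

Lemma coord_surj (c : endo_coord n) : exists i, @coord_of n i = c.
Proof.
exists (cast_ord (card_coord n) (enum_rank c)).
by rewrite /coord_of cast_ordK enum_rankK.
Qed.

Lemma pt_coord (a : 'I_2) (s : seq 'I_2) : (size s <= n)%N ->
  exists k : 'I_p, forall f g : R, (pt n f g : 'rV[K]_p) 0 k = mcoeff (W s) (pr f g a).
Proof.
rewrite -ltnS => sn.
have [k hk] := coord_surj (a, existT (fun k : 'I_n.+1 => (k : nat).-tuple 'I_2) (Ordinal sn) (in_tuple s)).
by exists k => f g; rewrite mxE hk.
Qed.

(* Parameters 0 to 6 are a, b, c, b', c', mu, alpha; parameter 5 + i is the
   coefficient of degree i of the polynomial in l. *)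
Definition tv (t : 'I_N -> K) (k : nat) : K := t (inord k).
Definition qv (t : 'I_N -> K) (i : nat) : K := if (2 <= i)%N then tv t (5 + i) else 0.
Definition sumv (t : 'I_N -> K) : R := \sum_(i < n.+1) qv t i *: (tv t 6 *: x0 + x1) ^+ i.
Definition fv (t : 'I_N -> K) : R := tv t 0 *: x0 + tv t 1 *: x1 + tv t 2 *: 1 + 1 *: sumv t.
Definition gv (t : 'I_N -> K) : R :=
  (tv t 5 * tv t 0 + tv t 6 * (tv t 3 - tv t 5 * tv t 1)) *: x0 + tv t 3 *: x1 + tv t 4 *: 1
   + tv t 5 *: sumv t.
Definition Dv (t : 'I_N -> K) : K :=
  tv t (5 + n) * ((tv t 3 - tv t 5 * tv t 1) * (tv t 0 - tv t 1 * tv t 6)).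

Lemma polyf_tv k : polyf (fun t => tv t k).
Proof. exact: polyf_var. Qed.

Lemma polyfD m F G : @polyf K m F -> polyf G -> polyf (fun t => F t + G t).
Proof. by move=> [q hq] [r hr]; exists (q + r) => t; rewrite mevalD hq hr. Qed.

Lemma polyS_sumv : polyS sumv.
Proof.
apply: (@polyS_sum K R N 'I_n.+1 _ (fun (i : 'I_n.+1) t => qv t i *: (tv t 6 *: x0 + x1) ^+ i)) => i.
apply: polySZ.
  rewrite /qv; case: (2 <= i)%N; [exact: polyf_tv|exact: polyf_const].
apply: (polySX (@central_malg K _)); apply: polySD; last exact: polyS_const.
by apply: polySZ; [exact: polyf_tv|exact: polyS_const].
Qed.

Lemma polyS_aff F G H k : polyf F -> polyf G -> polyf H -> polyf k ->
  polyS (fun t : 'I_N -> K => F t *: x0 + G t *: x1 + H t *: (1 : R) + k t *: sumv t).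
Proof.
move=> hF hG hH hk; apply: polySD; last by apply: polySZ => //; exact: polyS_sumv.
by do !apply: polySD; apply: polySZ => //; apply: polyS_const.
Qed.

Lemma polyS_fv : polyS fv.
Proof. by apply: polyS_aff; [exact: polyf_tv|exact: polyf_tv|exact: polyf_tv|exact: polyf_const]. Qed.

Lemma polyS_gv : polyS gv.
Proof.
apply: polyS_aff; [|exact: polyf_tv|exact: polyf_tv|exact: polyf_tv].
apply: polyfD; apply: polyfM; try exact: polyf_tv.
by apply: polyfB; [exact: polyf_tv|apply: polyfM; exact: polyf_tv].
Qed.

Lemma polyf_Dv : polyf Dv.
Proof.
apply: polyfM; first exact: polyf_tv.
apply: polyfM; apply: polyfB; try exact: polyf_tv; apply: polyfM; exact: polyf_tv.
Qed.

Lemma family_locus t : Dv t != 0 -> aut_locus K n (pt n (fv t) (gv t)).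
Proof.
rewrite /Dv !mulf_eq0 !negb_or => /and3P[qn de D].
apply/aut_locusP; exists [:: n], true; split; first by rewrite big_seq1.
exists (fv t), (gv t); split=> //.
have qn' : qv t n != 0 by rewrite /qv hn.
have [h [th e]] := family_tower (@central_malg K _) x0 x1 (tv t 2) (tv t 4) hn qn' de D.
by exists h, (tv t 5); rewrite /fv /gv scale1r; split.
Qed.

(** At the base point, [a], [b'] and the leading coefficient are 1 and all other parameters 0. [Dv]
    is then nonzero, and stays so when a single parameter moves to a nonzero value. *)
Definition bv (k : nat) : bool := [|| k == 0, k == 3 | k == 5 + n]%N.
Definition base (i : 'I_N) : K := (bv i)%:R.

Lemma tv_upd j (s : K) k : (k < N)%N -> tv (upd base j s) k = if k == j :> nat then s else (bv k)%:R.
Proof. by move=> kN; rewrite /tv /upd /base -val_eqE /= inordK. Qed.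

Lemma tv_base k : (k < N)%N -> tv base k = (bv k)%:R.
Proof. by move=> kN; rewrite /tv /base inordK. Qed.

(** Such a [z] differs from both base values 0 and 1, so that moving any parameter to it is a
    genuine change and keeps [Dv] nonzero. *)
Lemma two_values : exists z : K, z != 0 /\ z != 1.
Proof.
have [|z] := @nonroot_exists K ('X * ('X - 1)).
  by rewrite mulf_neq0 ?polyX_eq0 // -[1]/(1%:P) polyXsubC_eq0.
by rewrite !hornerE mulf_eq0 negb_or subr_eq0 => /andP[h1 h2]; exists z.
Qed.

Lemma Dv_gen (T : nat -> K) : T 5 * T 1 = 0 -> T 1 * T 6 = 0 -> T (5 + n)%N != 0 -> T 3 != 0 -> T 0 != 0 ->
  T (5 + n)%N * ((T 3 - T 5 * T 1) * (T 0 - T 1 * T 6)) != 0.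
Proof. by move=> -> -> h1 h2 h3; rewrite !subr0 !mulf_neq0. Qed.

Lemma Dv_upd j z : z != 0 -> Dv (upd base j z) != 0.
Proof.
move=> z0; have o0 : (1 : K) != 0 by apply: oner_neq0.
have one k : bv k -> (k < N)%N -> tv (upd base j z) k != 0.
  by move=> bk kN; rewrite tv_upd // bk; case: ifP.
have zero k l : ~~ bv k -> ~~ bv l -> k != l -> (k < N)%N -> (l < N)%N ->
    tv (upd base j z) k * tv (upd base j z) l = 0.
  move=> bk bl kl kN lN; rewrite !tv_upd // (negPf bk) (negPf bl).
  case: eqP => [kj|_]; last by rewrite mul0r.
  by rewrite -kj eq_sym (negPf kl) mulr0.
apply: Dv_gen; [apply: zero|apply: zero|apply: one|apply: one|apply: one]; rewrite /bv ?eqxx ?orbT //; lia.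
Qed.

Lemma Dv_base : Dv base != 0.
Proof.
apply: Dv_gen; rewrite !tv_base /bv ?eqxx ?orbT ?oner_eq0 //=; try lia.
  by rewrite mulr0.
by rewrite mul0r.
Qed.

Lemma coef_f t s : (size s <= n)%N -> mcoeff (W s) (fv t) =
  tv t 0 * (s == [:: i0])%:R + tv t 1 * (s == [:: i1])%:R + tv t 2 * (s == [::])%:R
    + 1 * (qv t (size s) * tv t 6 ^+ count_mem i0 s).
Proof. exact: mcoeff_family. Qed.

Lemma coef_g t s : (size s <= n)%N -> mcoeff (W s) (gv t) =
  (tv t 5 * tv t 0 + tv t 6 * (tv t 3 - tv t 5 * tv t 1)) * (s == [:: i0])%:R
  + tv t 3 * (s == [:: i1])%:R + tv t 4 * (s == [::])%:R
    + tv t 5 * (qv t (size s) * tv t 6 ^+ count_mem i0 s).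
Proof. exact: mcoeff_family. Qed.

(* [G] is 1, except for mu and alpha, which are only visible multiplied by the
   leading coefficient p_n. *)
Definition readable (j : 'I_N) := exists (a : 'I_2) (s : seq 'I_2) (G : ('I_N -> K) -> K),
  [/\ (size s <= n)%N, forall t, mcoeff (W s) (pr (fv t) (gv t) a) = t j * G t,
      base j = 1 \/ base j = 0, base j = 1 -> forall t, G t = 1 &
      forall z, z != 0 -> G (upd base j z) != 0].

(** Affine coefficients are read at words of length at most 1, where [qv] is 0, and the coefficient
    of degree [i] at [x1^i] in the first component. The product with mu is read at [x1^n] in the
    second component, and that with alpha at [x0 x1^(n-1)] in the first. *)
Lemma read_param (j : 'I_N) : readable j.
Proof.
have tj t : t j = tv t j by rewrite /tv inord_val.
have bE : base j = (bv j)%:R by [].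
have b01 : base j = 1 \/ base j = 0 by rewrite bE; case: (bv j); [left|right].
have o0 : (1 : K) != 0 by apply: oner_neq0.
have n1 : (1 <= n)%N by apply: ltnW.
have direct a s : (size s <= n)%N -> (forall t, mcoeff (W s) (pr (fv t) (gv t) a) = tv t j) -> readable j.
  by move=> sn h; exists a, s, (fun=> 1); split=> // t; rewrite mulr1 tj h.
have top a s : (size s <= n)%N -> ~~ bv j -> (forall t, mcoeff (W s) (pr (fv t) (gv t) a) = tv t j * tv t (5 + n)) -> readable j.
  move=> sn bj h; exists a, s, (fun t => tv t (5 + n)); split=> //.
  - by move=> t; rewrite tj h.
  - by rewrite bE (negPf bj) => /eqP; rewrite eq_sym oner_eq0.
  - move=> z z0; rewrite tv_upd ?ltn_add2r //; case: ifP => // _.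
    by rewrite /bv eqxx !orbT.
have qv0 t : qv t 0 = 0 by [].
have qv1 t : qv t 1 = 0 by [].
have qvn t : qv t n = tv t (5 + n) by rewrite /qv hn.
have [j7|j7] := ltnP j 7; last first.
  have [i ji i2] : exists2 i, (j : nat) = (5 + i)%N & (2 <= i)%N.
    by exists (j - 5)%N; move: j7; move: (nat_of_ord j) => m; clear; lia.
  have i_n : (i <= n)%N by have := ltn_ord j; rewrite ji; clear; lia.
  apply: (direct i0 (nseq i i1)); first by rewrite size_nseq.
  move=> t; rewrite coef_f ?size_nseq // ji /qv i2 count_nseq mul0n expr0 mulr1 mul1r.
  by case: (i) i2 => [|[|i']] // _; rewrite !mulr0 !add0r.
move: j7 direct top; rewrite -ltnS; case: (nat_of_ord j) => [|[|[|[|[|[|[|//]]]]]]] _ direct top.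
- apply: (direct i0 [:: i0]) => // t.
  by rewrite coef_f // qv1 !eqxx mulr1 !mulr0 !mul0r !mulr0 !addr0.
- apply: (direct i0 [:: i1]) => // t.
  by rewrite coef_f // qv1 !eqxx mulr1 !mulr0 !mul0r !mulr0 !addr0 add0r.
- apply: (direct i0 [::]) => // t.
  by rewrite coef_f // qv0 !eqxx mulr1 !mulr0 !mul0r !mulr0 !addr0 add0r.
- apply: (direct i1 [:: i1]) => // t.
  by rewrite coef_g // qv1 !eqxx mulr1 !mulr0 !mul0r !mulr0 !addr0 add0r.
- apply: (direct i1 [::]) => // t.
  by rewrite coef_g // qv0 !eqxx mulr1 !mulr0 !mul0r !mulr0 !addr0 add0r.
- apply: (top i1 (nseq n i1)); first by rewrite size_nseq.
    by rewrite /bv /=; lia.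
  move=> t; rewrite coef_g ?size_nseq // qvn count_nseq mul0n expr0 mulr1.
  by case: (n) hn => [|[|m]] // _; rewrite !mulr0 !add0r.
apply: (top i0 (i0 :: nseq n.-1 i1)); first by rewrite /= size_nseq prednK.
  by rewrite /bv /=; lia.
move=> t; rewrite coef_f /= size_nseq prednK // qvn count_nseq mul0n addn0 expr1 mul1r.
rewrite [RHS]mulrC; case: (n) hn => [|[|m]] // _; rewrite !mulr0 !add0r.
by [].
Qed.

Theorem aut_locus_lower : exists F, irreducible_chain (closure (aut_locus K n)) (6 + n) F.
Proof.
have : forall k : 'I_p, exists q : mpoly N K, forall t, (pt n (fv t) (gv t) : 'rV[K]_p) 0 k = q.@[t].
  move=> k; case E: (@coord_of n k) => [a w].
  have [r hr] : polyf (fun t => mcoeff (FMonom (tagged w)) (pr (fv t) (gv t) a)).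
    by case: (I2_cases a i01) => ->; apply: polyf_mcoeff; [exact: polyS_fv|exact: polyS_gv].
  by exists r => t; rewrite mxE E; apply: hr.
move/choice => [pi hpi]; have [D hD] := polyf_Dv.
have [z [z0 z1]] := two_values.
apply: (@dim_lower K p N pi D base).
- by rewrite -hD; exact: Dv_base.
- move=> j; have [a [s [G [sn hG b01 hG1 hGz]]]] := read_param j.
  have [k hk] := pt_coord a sn.
  exists k, (base j); split=> [t tb|].
    rewrite -hpi hk hG tb; case: b01 => b; last by rewrite b mul0r.
    by rewrite (hG1 b) mulr1.
  exists z; split; first by rewrite -hD Dv_upd.
  rewrite -hpi hk hG {1}/upd eqxx; case: b01 => b.
    by rewrite (hG1 b) mulr1 b.
  by rewrite b mulf_neq0 // hGz.
move=> t; rewrite -hD => /family_locus; congr (aut_locus _ _ _).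
by apply/rowP => k; rewrite hpi mxE.
Qed.

End Family.

Theorem mainTheorem4 (K : closedFieldType) (n : nat) (hn : (2 <= n)%N) :
  constructible (aut_locus K n) /\ has_dim (aut_locus K n) (n + 6)%N.
Proof.
have [I [m [pi [D [le hA]]]]] := aut_families K hn.
split; first exact: (constructible_images hA).
split; first by rewrite addnC; apply: aut_locus_lower.
exact: (dim_upper le (fun v => (hA v).1)).
Qed.
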